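(* Let $0<q<1$, $\eta:=\frac{q^{1/4}+q^{-1/4}}{2}$, $\gamma:=\frac{2q^{1/4}}{1-q}$, and let $\widetilde{w}_1$ be the smallest positive zero of $w\mapsto C_q(\eta;w)$. Assume that $f$ is an entire function of $q$-exponential growth of order less than $2\ln q^{-1}$, or of order $2\ln q^{-1}$ and type less than $\frac{2\ln 2}{\ln q^{-1}}$. Then $f$ has the expansion $$f(x)=\sum_{k=0}^{\infty} f_k\,\rho_k(x),\qquad f_k:=\frac{q^{\frac{k^2-k}{4}}(1-q)^k}{2^k (q;q)_k}\,(\mathcal{D}_q^k f)(0).$$ If moreover $$\limsup_{n\to\infty}\sqrt[n]{|(\mathcal{D}_q^n f)(0)|\,q^{-n/4}}=\tau,\qquad 0<\tau<\min(1,\widetilde{w}_1),$$ then for every $x\in\mathbb{C}$ $$f(x)=\sum_{k=0}^{\infty}\gamma^{-2k-1}\,\widetilde{E}_{2k+1}(x;q)\,(\mathcal{D}_q^{2k+1}f)(0)+2\sum_{k=0}^{\infty}\gamma^{-2k}\,\mathcal{E}_{2k}(x;q)\,(\mathcal{D}_q^{2k}f)(\eta).$$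
   Context: Throughout $0<q<1$; $(a;q)_n=\prod_{j=0}^{n-1}(1-aq^j)$ for $n\in\{0,1,2,\dots\}\cup\{\infty\}$, and $(a,b;q)_n=(a;q)_n(b;q)_n$. Askey--Wilson operator: for $f$ entire put $\breve f(z):=f((z+1/z)/2)$, $x=(z+1/z)/2$, $z=e^{i\theta}$, $x=\cos\theta$. Then $\mathcal{D}_q f(x)=\dfrac{\breve f(q^{1/2}z)-\breve f(q^{-1/2}z)}{i(q^{1/2}-q^{-1/2})\sin\theta}$ (extended by continuity where $\sin\theta=0$), and $\mathcal{D}_q^k$ is its $k$-th iterate. Growth: an entire function $f$ has $q$-exponential growth of order $k$ and (finite) type $\alpha$ if there are a real $K>0$ and real $\alpha$ with $|f(x)|<K|x|^{\alpha}\exp\left(\frac{k\ln^2|x|}{2\ln^2 q}\right)$ for $x\neq0$. The functions $\rho_n$: $\rho_0(x)=1$ and $\rho_n(x)=(1+e^{2i\theta})(-q^{2-n}e^{2i\theta};q^2)_{n-1}e^{-in\theta}$ for $n\ge1$, $x=\cos\theta$ (a polynomial in $x$). The $q$-exponential function: for $|\alpha|<1$, $x=\cos\theta$, $$\mathcal{E}_q(x;\alpha)=\frac{(\alpha^2;q^2)_\infty}{(q\alpha^2;q^2)_\infty}\sum_{n=0}^\infty\frac{(-i\alpha)^n}{(q;q)_n}q^{n^2/4}\left(-ie^{i\theta}q^{(1-n)/2},-ie^{-i\theta}q^{(1-n)/2};q\right)_n=\sum_{n=0}^\infty\frac{q^{n^2/4}}{(q;q)_n}\alpha^n\rho_n(x),$$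 and $(q\alpha^2;q^2)_\infty\mathcal{E}_q(x;\alpha)$ extends to an entire function of $\alpha$, by which $\mathcal{E}_q(x;\alpha)$ is defined for other $\alpha$. One has $\mathcal{E}_q(\eta;w)=\frac{(-w;q^{1/2})_\infty}{(qw^2;q^2)_\infty}$. The basic sine and cosine are defined by $\mathcal{E}_q(x;iw)=C_q(x;w)+iS_q(x;w)$ with $C_q$ even and $S_q$ odd in $w$; in particular $C_q(\eta;w)=\frac{(-iw;q^{1/2})_\infty+(iw;q^{1/2})_\infty}{2(-qw^2;q^2)_\infty}$. The $q$-Euler polynomials $\mathcal{E}_n(x;q)$ and $\widetilde{E}_n(x;q)$ (not to be confused with the function $\mathcal{E}_q(x;w)$) are defined by the generating functions (power series in $w$ near $0$) $$\sum_{n=0}^\infty\mathcal{E}_n(x;q)w^n=\frac{\mathcal{E}_q(x;w)}{\mathcal{E}_q(\eta;w)+\mathcal{E}_q(\eta;-w)},\qquad \sum_{n=0}^\infty\widetilde{E}_n(x;q)w^n=\frac{2\,\mathcal{E}_q(\eta;-w)\,\mathcal{E}_q(x;w)}{\mathcal{E}_q(\eta;w)+\mathcal{E}_q(\eta;-w)}.$$ *)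

(* Defs.v *)
(* Stdlib reals with Coquelicot complex numbers. *)
From Stdlib Require Import Reals Lra Psatz ClassicalEpsilon.
From Coquelicot Require Import Coquelicot.

Open Scope R_scope.
Open Scope C_scope.

Definition entire (f : C -> C) : Prop :=
  forall z : C, @ex_derive C_AbsRing C_NormedModule f z.

(* Componentwise value of a limit or of a series; junk when it diverges. *)
Definition CLim_seq (u : nat -> C) : C :=
  (real (Lim_seq (fun n => Re (u n))), real (Lim_seq (fun n => Im (u n)))).

Definition CSeries (a : nat -> C) : C :=
  (Series (fun n => Re (a n)), Series (fun n => Im (a n))).

(* (a; q)_n and (a; q)_oo *)
Fixpoint qpoch (a : C) (q : R) (n : nat) : C :=
  match n with
  | O => 1
  | S m => qpoch a q m * (1 - a * RtoC (q ^ m))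
  end.

Definition qpoch_inf (a : C) (q : R) : C := CLim_seq (qpoch a q).

Definition joukowski (z : C) : C := (z + / z) / 2.

(* Some z = e^{i theta} with x = cos theta = (z + 1/z)/2.  The other choice is
   1/z, and the functions of x built from [expitheta x] below take the same
   value for both choices. *)
Definition expitheta (x : C) : C :=
  epsilon (inhabits (RtoC 1)) (fun z => z <> 0 /\ joukowski z = x).

Lemma Csqrt_ex (c : C) : exists s : C, s * s = c.
Proof.
destruct c as [a b].
set (m := Cmod (a, b)).
assert (Hm0 : (0 <= m)%R) by apply Cmod_ge_0.
assert (Hm : (m * m = a * a + b * b)%R).
{ unfold m, Cmod; simpl fst; simpl snd.
  rewrite sqrt_sqrt; [ring | nra]. }
assert (H1 : (0 <= (m + a) / 2)%R) by nra.
assert (H2 : (0 <= (m - a) / 2)%R) by nra.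
assert (E1 := sqrt_sqrt _ H1).
assert (E2 := sqrt_sqrt _ H2).
assert (E3 : (sqrt ((m + a) / 2) * sqrt ((m - a) / 2) = Rabs b / 2)%R).
{ rewrite <- sqrt_mult by assumption.
  replace ((m + a) / 2 * ((m - a) / 2))%R with (Rsqr (b / 2))
    by (unfold Rsqr; nra).
  rewrite sqrt_Rsqr_abs, Rabs_div by lra.
  rewrite (Rabs_right 2) by lra; reflexivity. }
destruct (Rle_dec 0 b) as [Hb | Hb].
- exists (sqrt ((m + a) / 2), sqrt ((m - a) / 2)).
  rewrite Rabs_right in E3 by lra.
  unfold Cmult; simpl; apply injective_projections; simpl; nra.
- exists (sqrt ((m + a) / 2), (- sqrt ((m - a) / 2))%R).
  rewrite Rabs_left in E3 by lra.
  unfold Cmult; simpl; apply injective_projections; simpl; nra.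
Qed.

Lemma expitheta_spec (x : C) :
  expitheta x <> 0 /\ joukowski (expitheta x) = x.
Proof.
apply (epsilon_spec (inhabits (RtoC 1)) (fun z => z <> 0 /\ joukowski z = x)).
destruct (Csqrt_ex (x * x - 1)) as [s Hs].
assert (Hprod : (x + s) * (x - s) = 1).
{ replace ((x + s) * (x - s)) with (x * x - s * s) by ring.
  rewrite Hs; ring. }
assert (Hz : x + s <> 0).
{ intro H; rewrite H, Cmult_0_l in Hprod.
  apply (f_equal fst) in Hprod; simpl in Hprod; lra. }
exists (x + s); split; [exact Hz |].
assert (Hinv : / (x + s) = x - s).
{ replace (x - s) with (/ (x + s) * ((x + s) * (x - s))) by (field; exact Hz).
  rewrite Hprod; ring. }
unfold joukowski; rewrite Hinv; field.
Qed.

Definition breve (f : C -> C) (z : C) : C := f (joukowski z).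

Definition sintheta (z : C) : C := (z - / z) / (2 * Ci).

Definition AW_quotient (q : R) (f : C -> C) (x : C) : C :=
  let z := expitheta x in
  (breve f (RtoC (Rpower q (1/2)) * z) - breve f (RtoC (Rpower q (-1/2)) * z))
  / (Ci * RtoC (Rpower q (1/2) - Rpower q (-1/2)) * sintheta z).

(* At x = 1, -1, where sin theta = 0, [C_lim] is the limit of the quotient: for
   entire f the limit exists, and [C_lim] agrees with it by
   [is_C_lim_unique]. *)
Definition AW (q : R) (f : C -> C) (x : C) : C :=
  if Ceq_dec (sintheta (expitheta x)) 0
  then C_lim (AW_quotient q f) x
  else AW_quotient q f x.

Definition AW_iter (q : R) (k : nat) (f : C -> C) : C -> C :=
  Nat.iter k (AW q) f.

Definition qexp_growth (q : R) (f : C -> C) (k alpha : R) : Prop :=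
  exists K : R, (0 < K)%R /\
    forall x : C, x <> 0 ->
      (Cmod (f x) < K * Rpower (Cmod x) alpha
                    * exp (k * (ln (Cmod x)) ^ 2 / (2 * (ln q) ^ 2)))%R.

Definition rho (q : R) (n : nat) (x : C) : C :=
  match n with
  | O => 1
  | S m =>
      let z := expitheta x in
      (1 + z ^ 2) * qpoch (- (RtoC (Rpower q (2 - INR n)) * z ^ 2)) (q ^ 2) m
      / z ^ n
  end.

Definition qexp_series (q : R) (x alpha : C) : C :=
  let z := expitheta x in
  qpoch_inf (alpha ^ 2) (q ^ 2) / qpoch_inf (RtoC q * alpha ^ 2) (q ^ 2)
  * CSeries (fun n =>
      (- Ci * alpha) ^ n / qpoch (RtoC q) q n * RtoC (Rpower q (INR n ^ 2 / 4))
      * (qpoch (- Ci * z * RtoC (Rpower q ((1 - INR n) / 2))) q n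
         * qpoch (- Ci * / z * RtoC (Rpower q ((1 - INR n) / 2))) q n)).

(* The entire function of alpha that extends
   (q alpha^2; q^2)_oo E_q(x; alpha) from the unit disc. *)
Definition qexp_entire (q : R) (x : C) : C -> C :=
  epsilon (inhabits (fun _ : C => RtoC 0))
    (fun G => entire G /\
       forall alpha : C, (Cmod alpha < 1)%R ->
         G alpha = qpoch_inf (RtoC q * alpha ^ 2) (q ^ 2)
                   * qexp_series q x alpha).

(* E_q(x; alpha) *)
Definition qexp (q : R) (x alpha : C) : C :=
  if Rlt_dec (Cmod alpha) 1
  then qexp_series q x alpha
  else qexp_entire q x alpha / qpoch_inf (RtoC q * alpha ^ 2) (q ^ 2).

(* C_q(x; w): the part of E_q(x; i w) that is even in w. *)
Definition qcos (q : R) (x w : C) : C :=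
  (qexp q x (Ci * w) + qexp q x (Ci * - w)) / 2.

Definition smallest_positive_zero (g : C -> C) (w : R) : Prop :=
  (0 < w)%R /\ g (RtoC w) = 0 /\
  forall v : R, (0 < v < w)%R -> g (RtoC v) <> 0.

Definition eta (q : R) : R := ((Rpower q (1/4) + Rpower q (-1/4)) / 2)%R.

Definition gamma (q : R) : R := (2 * Rpower q (1/4) / (1 - q))%R.

(* The coefficients of the power series of g at 0. *)
Definition taylor_coef (g : C -> C) : nat -> C :=
  epsilon (inhabits (fun _ : nat => RtoC 0))
    (fun a => exists r : R, (0 < r)%R /\
       forall w : C, (Cmod w < r)%R ->
         @is_pseries C_AbsRing C_NormedModule a w (g w)).

Definition qEuler (q : R) (n : nat) (x : C) : C :=
  taylor_coef (fun w =>
    qexp q x w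
    / (qexp q (RtoC (eta q)) w + qexp q (RtoC (eta q)) (- w))) n.

Definition qEuler_tilde (q : R) (n : nat) (x : C) : C :=
  taylor_coef (fun w =>
    2 * qexp q (RtoC (eta q)) (- w) * qexp q x w
    / (qexp q (RtoC (eta q)) w + qexp q (RtoC (eta q)) (- w))) n.

(* The case split is needed because [Rpower 0 y = 1]. *)
Definition nth_root (n : nat) (x : R) : R :=
  if Req_EM_T x 0 then 0%R else Rpower x (/ INR n).

(* Main.v *)
(* Write v_k = q^(k^2/4) / (q;q)_k rho_k, so that D_q v_k = gamma v_(k-1), v_0 = 1 and
   v_k(0) = 0 for k > 0.  The zeros of rho_k are explicit, and rho_(k+2) is rho_k times a
   quadratic factor, so x^m expands in the rho_k with coefficients bounded by a product over
   the zeros; inserting this into the Taylor series of f, whose coefficients are controlled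
   by Cauchy's estimate on circles of radius about q^(-k/2), gives an absolutely convergent
   double series under the growth hypothesis, hence f = sum b_k v_k.  Applying D_q^k at 0,
   where only the values of f on the orbit i q^(m/2) matter, identifies
   b_k = gamma^(-k) (D_q^k f)(0).

   Applied to the polynomials in the definition of the q-exponential function, the same
   expansion and the q-binomial theorem give E_q(x;w) = sum v_n(x) w^n for |w| < 1.  Put
   h(w) = E_q(eta;w).  From (1 - q^(1/2) w) h(w) = (1 + w) h(qw) it follows that
   |h(-w)| < |h(w)| when Re w > 0, so the zeros of h(w) + h(-w) in the unit disc are
   imaginary, i.e. they come from zeros of C_q(eta; .), and the generating functions of the
   q-Euler polynomials are analytic for |w| < min(1, w_1).  The second expansion is the
   image of an identity between these generating functions under the functional
   w^n |-> b_n, under which w^n h(w) goes to gamma^(-n) (D_q^n f)(eta). *)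
Require Import Defs.
From Stdlib Require Import Reals Lra Lia ClassicalEpsilon.
From Coquelicot Require Import Coquelicot.

Open Scope R_scope.
Open Scope C_scope.

(** * Complex differentiability and line integrals *)

(** The growth hypothesis is critical for the following reason. The coefficient of rho_k in x^m is
    controlled by r^m only for r beyond the zeros of the rho_j involved, which forces r of size
    q^(-k/2) / 2. Cauchy's estimate there costs up to q^(-k^2/4), while rho_k times the bound for
    its coefficient gains q^(k^2/4), so at order 2 ln(1/q) the quadratic exponents cancel exactly
    and the terms linear in k decide. The factor 1/2 in the radius, from x = (z + 1/z)/2, is the
    source of 2 ln 2 in the condition on the type.

    The obstacle on the side of the operator is that D_q is a limit at x = 1, -1, so applying its
    iterates termwise to a series would call for uniform convergence. This is avoided by working on
    sets of z that are stable under multiplication by q^(1/2) and q^(-1/2) and contain no solution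
    of z^2 = 1: there D_q^n f is a finite combination of values of f, and pointwise convergence is
    enough. Both points of evaluation lie on such sets, 0 with z = i and eta with z = q^(1/4).

    Cauchy's theory is developed in the coordinate w with z = exp w, where concentric circles become
    parallel segments and Goursat's theorem for rectangles suffices. *)

Lemma Ceq_minus (x y : C) : x - y = 0 -> x = y.
Proof. intros H; replace x with (x - y + y) by ring; rewrite H; ring. Qed.

Lemma Cminus_neq_0 (x y : C) : x <> y -> x - y <> 0.
Proof. intros H E; apply H, Ceq_minus, E. Qed.

Lemma Cmod_diag (z : C) : Cmod (z - z) = 0%R.
Proof. replace (z - z) with (RtoC 0) by ring; apply Cmod_0. Qed.

Lemma geom_small (q K e : R) : (0 <= q < 1)%R -> (0 <= K)%R -> (0 < e)%R ->
  exists N, forall n, (N <= n)%nat -> (K * q ^ n < e)%R.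
Proof.
intros Hq HK He.
destruct (pow_lt_1_zero q ltac:(rewrite Rabs_right; lra) (e / (K + 1))%R) as [N HN];
  [apply Rdiv_lt_0_compat; lra|].
exists N; intros n Hn; specialize (HN n Hn).
assert (P : (0 <= q ^ n)%R) by (apply pow_le; lra).
rewrite Rabs_right in HN by lra.
apply (Rmult_lt_compat_l (K + 1)) in HN; [|lra].
replace ((K + 1) * (e / (K + 1)))%R with e in HN by (field; lra); lra.
Qed.

Definition cont (f : C -> C) (z : C) : Prop :=
  forall eps : R, (0 < eps)%R -> exists d : R, (0 < d)%R /\
    forall w, (Cmod (w - z) < d)%R -> (Cmod (f w - f z) < eps)%R.

(* Caratheodory's form of complex differentiability, for which the chain and product rules
   reduce to algebra and continuity. *)
Definition diff (f : C -> C) (z : C) : Prop :=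
  exists k : C -> C, (forall w, f w - f z = k w * (w - z)) /\ cont k z.

Lemma cont_const (c z : C) : cont (fun _ => c) z.
Proof.
intros eps He; exists 1; split; [lra|]; intros w _.
rewrite Cmod_diag; exact He.
Qed.

Lemma cont_id (z : C) : cont (fun w => w) z.
Proof. intros eps He; exists eps; split; auto. Qed.

Lemma cont_plus (f g : C -> C) (z : C) :
  cont f z -> cont g z -> cont (fun w => f w + g w) z.
Proof.
intros Hf Hg eps He.
destruct (Hf (eps / 2)%R) as [d1 [Hd1 H1]]; [lra|].
destruct (Hg (eps / 2)%R) as [d2 [Hd2 H2]]; [lra|].
exists (Rmin d1 d2); split; [apply Rmin_glb_lt; auto|]; intros w Hw.
replace (f w + g w - (f z + g z)) with ((f w - f z) + (g w - g z)) by ring.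
eapply Rle_lt_trans; [apply Cmod_triangle|].
specialize (H1 w (Rlt_le_trans _ _ _ Hw (Rmin_l _ _))).
specialize (H2 w (Rlt_le_trans _ _ _ Hw (Rmin_r _ _))).
lra.
Qed.

Lemma cont_mult (f g : C -> C) (z : C) :
  cont f z -> cont g z -> cont (fun w => f w * g w) z.
Proof.
intros Hf Hg eps He.
set (A := Cmod (f z)); set (B := Cmod (g z)).
assert (HA : (0 <= A)%R) by apply Cmod_ge_0.
assert (HB : (0 <= B)%R) by apply Cmod_ge_0.
set (e := Rmin 1 (eps / (A + B + 2))%R).
assert (He2 : (0 < eps / (A + B + 2))%R) by (apply Rdiv_lt_0_compat; lra).
assert (He0 : (0 < e)%R) by (apply Rmin_glb_lt; lra).
assert (He1 : (e <= 1)%R) by apply Rmin_l.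
assert (He3 : (e * (A + B + 2) <= eps)%R).
{ apply Rle_trans with (eps / (A + B + 2) * (A + B + 2))%R.
  - apply Rmult_le_compat_r; [lra | apply Rmin_r].
  - right; field; lra. }
destruct (Hf e He0) as [d1 [Hd1 H1]].
destruct (Hg e He0) as [d2 [Hd2 H2]].
exists (Rmin d1 d2); split; [apply Rmin_glb_lt; auto|]; intros w Hw.
specialize (H1 w (Rlt_le_trans _ _ _ Hw (Rmin_l _ _))).
specialize (H2 w (Rlt_le_trans _ _ _ Hw (Rmin_r _ _))).
replace (f w * g w - f z * g z) with
  ((f w - f z) * (g w - g z) + (f z * (g w - g z) + (f w - f z) * g z)) by ring.
eapply Rle_lt_trans; [apply Cmod_triangle|].
eapply Rle_lt_trans; [apply Rplus_le_compat_l, Cmod_triangle|].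
rewrite !Cmod_mult; fold A B.
assert (P1 := Cmod_ge_0 (f w - f z)); assert (P2 := Cmod_ge_0 (g w - g z)).
nra.
Qed.

Lemma cont_inv (f : C -> C) (z : C) :
  cont f z -> f z <> 0 -> cont (fun w => / f w) z.
Proof.
intros Hf Hz eps He.
set (A := Cmod (f z)).
assert (HA : (0 < A)%R) by (apply Cmod_gt_0; exact Hz).
set (e := Rmin (A / 2) (eps * A * A / 2)%R).
assert (He0 : (0 < e)%R).
{ apply Rmin_glb_lt; [lra|]. assert (0 < eps * A)%R by nra; nra. }
destruct (Hf e He0) as [d [Hd H]].
exists d; split; [exact Hd|]; intros w Hw; specialize (H w Hw).
assert (H1 : (Cmod (f w - f z) < A / 2)%R)
  by (eapply Rlt_le_trans; [exact H | apply Rmin_l]).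
assert (H2 : (Cmod (f w - f z) < eps * A * A / 2)%R)
  by (eapply Rlt_le_trans; [exact H | apply Rmin_r]).
assert (H3 : (A / 2 < Cmod (f w))%R).
{ assert (T := Cmod_triangle (f w) (- (f w - f z))).
  replace (f w + - (f w - f z)) with (f z) in T by ring.
  rewrite Cmod_opp in T; fold A in T; lra. }
assert (Hw0 : f w <> 0) by (apply Cmod_gt_0; lra).
replace (/ f w - / f z) with (- (f w - f z) / (f w * f z))
  by (field; split; assumption).
rewrite Cmod_div by (apply Cmult_neq_0; assumption).
rewrite Cmod_opp, Cmod_mult; fold A.
apply Rmult_lt_reg_r with (Cmod (f w) * A)%R; [nra|].
unfold Rdiv; rewrite Rmult_assoc, Rinv_l by nra.
assert (eps * A * (A / 2) < eps * A * Cmod (f w))%R.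
{ apply Rmult_lt_compat_l; nra. }
nra.
Qed.

Lemma cont_comp (f g : C -> C) (z : C) :
  cont g z -> cont f (g z) -> cont (fun w => f (g w)) z.
Proof.
intros Hg Hf eps He.
destruct (Hf eps He) as [d [Hd H]].
destruct (Hg d Hd) as [d' [Hd' H']].
exists d'; split; auto.
Qed.

Lemma cont_ext (f g : C -> C) (z : C) :
  (exists r : R, (0 < r)%R /\ forall w, (Cmod (w - z) < r)%R -> f w = g w) ->
  cont f z -> cont g z.
Proof.
intros [r [Hr E]] Hf eps He.
destruct (Hf eps He) as [d [Hd H]].
exists (Rmin d r); split; [apply Rmin_glb_lt; auto|]; intros w Hw.
rewrite <- !E.
- apply H; eapply Rlt_le_trans; [exact Hw | apply Rmin_l].
- rewrite Cmod_diag; exact Hr.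
- eapply Rlt_le_trans; [exact Hw | apply Rmin_r].
Qed.

Lemma diff_cont (f : C -> C) (z : C) : diff f z -> cont f z.
Proof.
intros [k [E Hk]].
apply (cont_ext (fun w => f z + k w * (w - z))).
- exists 1; split; [lra|]; intros w _; rewrite <- E; ring.
- apply cont_plus; [apply cont_const|].
  apply cont_mult; [exact Hk|].
  apply cont_plus; [apply cont_id | apply cont_const].
Qed.

Lemma diff_const (c z : C) : diff (fun _ => c) z.
Proof. exists (fun _ => RtoC 0); split; [intros; ring | apply cont_const]. Qed.

Lemma diff_id (z : C) : diff (fun w => w) z.
Proof. exists (fun _ => RtoC 1); split; [intros; ring | apply cont_const]. Qed.

Lemma diff_plus (f g : C -> C) (z : C) :
  diff f z -> diff g z -> diff (fun w => f w + g w) z.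
Proof.
intros [k [E Hk]] [l [E' Hl]].
exists (fun w => k w + l w); split; [|apply cont_plus; auto].
intros w; replace (f w + g w - (f z + g z))
  with ((f w - f z) + (g w - g z)) by ring.
rewrite E, E'; ring.
Qed.

Lemma diff_mult (f g : C -> C) (z : C) :
  diff f z -> diff g z -> diff (fun w => f w * g w) z.
Proof.
intros [k [E Hk]] Hg; assert (Hgc := diff_cont g z Hg).
destruct Hg as [l [E' Hl]].
exists (fun w => k w * g w + f z * l w); split.
- intros w; replace (f w * g w - f z * g z)
    with ((f w - f z) * g w + f z * (g w - g z)) by ring.
  rewrite E, E'; ring.
- apply cont_plus; apply cont_mult; auto; apply cont_const.
Qed.

Lemma diff_pow (f : C -> C) (n : nat) (z : C) :
  diff f z -> diff (fun w => f w ^ n) z.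
Proof.
intros Hf; induction n as [|n IH]; simpl;
  [apply diff_const | apply diff_mult; assumption].
Qed.

Lemma diff_comp (f g : C -> C) (z : C) :
  diff g z -> diff f (g z) -> diff (fun w => f (g w)) z.
Proof.
intros Hg [k [E Hk]]; assert (Hgc := diff_cont g z Hg).
destruct Hg as [l [E' Hl]].
exists (fun w => k (g w) * l w); split.
- intros w; rewrite E, E'; ring.
- apply cont_mult; [apply (cont_comp k g)|]; auto.
Qed.

(** The slope function has to satisfy its identity for all w, not only near z; hence it is the
    difference quotient of g everywhere, and only near z is it compared with the slope of f. *)
Lemma diff_ext (f g : C -> C) (z : C) :
  (exists r : R, (0 < r)%R /\ forall w, (Cmod (w - z) < r)%R -> f w = g w) ->
  diff f z -> diff g z.
Proof.
intros [r [Hr E]] [k [Ek Hk]].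
exists (fun w => if Ceq_dec w z then k z else (g w - g z) / (w - z)); split.
- intros w; destruct (Ceq_dec w z) as [->|N]; [ring|].
  field; apply Cminus_neq_0, N.
- apply (cont_ext k); [|exact Hk].
  exists r; split; [exact Hr|]; intros w Hw.
  destruct (Ceq_dec w z) as [->|N]; [reflexivity|].
  assert (N' := Cminus_neq_0 _ _ N).
  rewrite <- (E w Hw), <- (E z), Ek; [field; exact N'|].
  rewrite Cmod_diag; exact Hr.
Qed.

Lemma diff_inv (f : C -> C) (z : C) :
  diff f z -> f z <> 0 -> diff (fun w => / f w) z.
Proof.
intros Hf Hz; assert (Hc := diff_cont f z Hf).
assert (Hn : exists r : R, (0 < r)%R /\
          forall w, (Cmod (w - z) < r)%R -> f w <> 0).
{ destruct (Hc (Cmod (f z))) as [d [Hd H]]; [apply Cmod_gt_0; exact Hz|].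
  exists d; split; [exact Hd|]; intros w Hw E; specialize (H w Hw).
  rewrite E in H; replace (0 - f z) with (- f z) in H by ring.
  rewrite Cmod_opp in H; lra. }
destruct Hn as [r [Hr Hn]].
destruct Hf as [k [E Hk]].
(* Far from z, f may vanish and the slope identity may fail for the inverse. The function h
   satisfies such an identity everywhere by its form and coincides with the inverse near z. *)
set (h := fun w => / f z - k w * / f w * / f z * (w - z)).
apply (diff_ext h).
- exists r; split; [exact Hr|]; intros w Hw; unfold h.
  replace (k w * / f w * / f z * (w - z)) with
     (k w * (w - z) * / f w * / f z) by ring.
  rewrite <- E; field; split; auto.
- exists (fun w => - (k w * / f w * / f z)); split.
  + intros w; unfold h; ring.
  + apply (cont_ext (fun w => (- / f z) * (k w * / f w))).
    * exists 1; split; [lra|]; intros; ring.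
    * apply cont_mult; [apply cont_const|].
      apply cont_mult; [exact Hk|]; apply cont_inv; assumption.
Qed.

Lemma diff_intro (f : C -> C) (z l : C) :
  (forall eps, (0 < eps)%R -> exists d, (0 < d)%R /\ forall w, (Cmod (w - z) < d)%R ->
     (Cmod (f w - f z - l * (w - z)) <= eps * Cmod (w - z))%R) -> diff f z.
Proof.
intros H; exists (fun w => if Ceq_dec w z then l else (f w - f z) / (w - z)); split.
- intros w; destruct (Ceq_dec w z) as [->|Hw]; [ring | field; apply Cminus_neq_0, Hw].
- intros eps He; destruct (H (eps / 2)%R) as [d [Hd Hw]]; [lra|].
  exists d; split; [exact Hd|]; intros w Hwd; specialize (Hw w Hwd).
  destruct (Ceq_dec z z) as [_|F]; [|congruence].
  destruct (Ceq_dec w z) as [E|N]; [rewrite Cmod_diag; exact He|].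
  assert (N' := Cminus_neq_0 _ _ N).
  assert (P : (0 < Cmod (w - z))%R) by (apply Cmod_gt_0; exact N').
  replace ((f w - f z) / (w - z) - l) with ((f w - f z - l * (w - z)) / (w - z))
    by (field; exact N').
  rewrite Cmod_div by exact N'.
  apply Rmult_lt_reg_r with (Cmod (w - z)); [exact P|].
  unfold Rdiv; rewrite Rmult_assoc, Rinv_l by lra; nra.
Qed.

Lemma ex_derive_diff (f : C -> C) (z : C) :
  @ex_derive C_AbsRing C_NormedModule f z -> diff f z.
Proof.
intros [l [_ H]]; apply (diff_intro f z l); intros eps He.
destruct (H z (fun P HP => HP) (mkposreal _ He)) as [d Hd].
exists d; split; [apply cond_pos|]; intros w Hw; specialize (Hd w Hw).
rewrite (Cmult_comm l); exact Hd.
Qed.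

(** * Integrals of complex-valued functions of a real variable *)

Definition CI (g : R -> C) (a b : R) : C :=
  (RInt (fun t => Re (g t)) a b, RInt (fun t => Im (g t)) a b).

Definition contR (g : R -> C) (t : R) : Prop :=
  forall eps : R, (0 < eps)%R -> exists d : R, (0 < d)%R /\
    forall s, (Rabs (s - t) < d)%R -> (Cmod (g s - g t) < eps)%R.

Lemma contR_plus (g h : R -> C) (t : R) :
  contR g t -> contR h t -> contR (fun s => g s + h s) t.
Proof.
intros Hg Hh eps He.
destruct (Hg (eps / 2)%R) as [d1 [Hd1 H1]]; [lra|].
destruct (Hh (eps / 2)%R) as [d2 [Hd2 H2]]; [lra|].
exists (Rmin d1 d2); split; [apply Rmin_glb_lt; auto|]; intros s Hs.
replace (g s + h s - (g t + h t)) with ((g s - g t) + (h s - h t)) by ring.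
eapply Rle_lt_trans; [apply Cmod_triangle|].
specialize (H1 s (Rlt_le_trans _ _ _ Hs (Rmin_l _ _))).
specialize (H2 s (Rlt_le_trans _ _ _ Hs (Rmin_r _ _))).
lra.
Qed.

Lemma im_le_Cmod (z : C) : (Rabs (Im z) <= Cmod z)%R.
Proof. eapply Rle_trans; [apply Rmax_r | apply Rmax_Cmod]. Qed.

Lemma Cmod_le_abs (x y : R) : (Cmod (x, y) <= Rabs x + Rabs y)%R.
Proof.
replace ((x, y) : C) with (RtoC x + Ci * RtoC y)
  by (apply injective_projections; simpl; ring).
eapply Rle_trans; [apply Cmod_triangle|].
rewrite Cmod_mult, Cmod_Ci, !Cmod_R; lra.
Qed.

Lemma contR_components (g : R -> C) (t : R) :
  contR g t -> continuous (fun s => Re (g s)) t /\ continuous (fun s => Im (g s)) t.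
Proof.
intros H; split; apply filterlim_locally; intros eps;
  destruct (H eps (cond_pos eps)) as [d [Hd Hs]];
  exists (mkposreal d Hd); intros s Hs1; specialize (Hs s Hs1).
- eapply Rle_lt_trans; [|exact Hs].
  change (Rabs (Re (g s) - Re (g t)) <= Cmod (g s - g t))%R.
  replace (Re (g s) - Re (g t))%R with (Re (g s - g t)) by reflexivity.
  apply re_le_Cmod.
- eapply Rle_lt_trans; [|exact Hs].
  change (Rabs (Im (g s) - Im (g t)) <= Cmod (g s - g t))%R.
  replace (Im (g s) - Im (g t))%R with (Im (g s - g t)) by reflexivity.
  apply im_le_Cmod.
Qed.

Lemma contR_ex_RInt (g : R -> C) (a b : R) : (a <= b)%R ->
  (forall t, (a <= t <= b)%R -> contR g t) ->
  ex_RInt (fun t => Re (g t)) a b /\ ex_RInt (fun t => Im (g t)) a b.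
Proof.
intros Hab H; split;
  apply (@ex_RInt_continuous R_CompleteNormedModule); intros t Ht;
  rewrite Rmin_left, Rmax_right in Ht by exact Hab;
  apply contR_components, H, Ht.
Qed.

Lemma CI_ext (g h : R -> C) (a b : R) : (a <= b)%R ->
  (forall t, (a <= t <= b)%R -> g t = h t) -> CI g a b = CI h a b.
Proof.
intros Hab H; unfold CI; f_equal; apply RInt_ext; intros t Ht;
  rewrite Rmin_left, Rmax_right in Ht by exact Hab; rewrite H; auto; lra.
Qed.

Lemma CI_plus (g h : R -> C) (a b : R) : (a <= b)%R ->
  (forall t, (a <= t <= b)%R -> contR g t) ->
  (forall t, (a <= t <= b)%R -> contR h t) ->
  CI (fun t => g t + h t) a b = CI g a b + CI h a b.
Proof.
intros Hab Hg Hh.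
destruct (contR_ex_RInt g a b Hab Hg), (contR_ex_RInt h a b Hab Hh).
apply injective_projections;
  [ exact (RInt_plus (fun t => Re (g t)) (fun t => Re (h t)) a b ltac:(assumption) ltac:(assumption))
  | exact (RInt_plus (fun t => Im (g t)) (fun t => Im (h t)) a b ltac:(assumption) ltac:(assumption))].
Qed.

Lemma CI_scal (c : C) (g : R -> C) (a b : R) : (a <= b)%R ->
  (forall t, (a <= t <= b)%R -> contR g t) ->
  CI (fun t => c * g t) a b = c * CI g a b.
Proof.
intros Hab Hg.
destruct (contR_ex_RInt g a b Hab Hg) as [H1 H2].
assert (S : forall k (f : R -> R), ex_RInt f a b ->
   RInt (fun t => k * f t)%R a b = (k * RInt f a b)%R)
  by (intros k f Hf; exact (RInt_scal f a b k Hf)).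
assert (E : forall k (f : R -> R), ex_RInt f a b -> ex_RInt (fun t => k * f t)%R a b)
  by (intros k f Hf; exact (ex_RInt_scal f a b k Hf)).
apply injective_projections; simpl.
- rewrite <- !S by assumption.
  exact (RInt_minus (fun t => Re c * Re (g t))%R (fun t => Im c * Im (g t))%R a b
           (E _ _ H1) (E _ _ H2)).
- rewrite <- !S by assumption.
  exact (RInt_plus (fun t => Re c * Im (g t))%R (fun t => Im c * Re (g t))%R a b
           (E _ _ H2) (E _ _ H1)).
Qed.

Lemma CI_Chasles (g : R -> C) (a m b : R) : (a <= m <= b)%R ->
  (forall t, (a <= t <= b)%R -> contR g t) ->
  CI g a b = CI g a m + CI g m b.
Proof.
intros Hm Hg.
destruct (contR_ex_RInt g a m) as [H1 H2]; [lra | intros; apply Hg; lra|].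
destruct (contR_ex_RInt g m b) as [H3 H4]; [lra | intros; apply Hg; lra|].
unfold CI, Cplus; simpl; f_equal; symmetry;
  apply (RInt_Chasles (V := R_CompleteNormedModule)); assumption.
Qed.

(* The factor 2 comes from estimating the two components separately. *)
Lemma CI_bound (g : R -> C) (a b M : R) : (a <= b)%R ->
  (forall t, (a <= t <= b)%R -> contR g t) ->
  (forall t, (a <= t <= b)%R -> (Cmod (g t) <= M)%R) ->
  (Cmod (CI g a b) <= 2 * ((b - a) * M))%R.
Proof.
intros Hab Hg HM.
destruct (contR_ex_RInt g a b Hab Hg) as [H1 H2].
unfold CI; eapply Rle_trans; [apply Cmod_le_abs|].
assert (A1 : (Rabs (RInt (fun t => Re (g t)) a b) <= (b - a) * M)%R).
{ apply (norm_RInt_le_const (V := R_NormedModule) (fun t => Re (g t)) a b);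
    [exact Hab| |exact (RInt_correct (V := R_CompleteNormedModule) _ _ _ H1)].
  intros t Ht; eapply Rle_trans; [apply re_le_Cmod | apply HM, Ht]. }
assert (A2 : (Rabs (RInt (fun t => Im (g t)) a b) <= (b - a) * M)%R).
{ apply (norm_RInt_le_const (V := R_NormedModule) (fun t => Im (g t)) a b);
    [exact Hab| |exact (RInt_correct (V := R_CompleteNormedModule) _ _ _ H2)].
  intros t Ht; eapply Rle_trans; [apply im_le_Cmod | apply HM, Ht]. }
lra.
Qed.

Lemma CI_affine (A B : C) (a b : R) :
  CI (fun t => A + B * RtoC t) a b
  = A * RtoC (b - a) + B * RtoC ((b * b - a * a) / 2).
Proof.
assert (S : forall u v : R,
   RInt (fun t => u + v * t)%R a b = (u * (b - a) + v * ((b * b - a * a) / 2))%R).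
{ intros u v; apply is_RInt_unique.
  replace (u * (b - a) + v * ((b * b - a * a) / 2))%R with
   (minus (u * b + v * (b * b / 2)) (u * a + v * (a * a / 2)))%R
   by (unfold minus, plus, opp; simpl; field).
  apply (is_RInt_derive (V := R_CompleteNormedModule)
           (fun t => u * t + v * (t * t / 2))%R).
  - intros t _; auto_derive; [auto | field].
  - intros t _; apply continuity_pt_filterlim; reg. }
unfold CI; apply injective_projections; simpl.
- rewrite <- (RInt_ext (fun t => fst A + fst B * t)%R); [rewrite S; ring|].
  intros t _; simpl; ring.
- rewrite <- (RInt_ext (fun t => snd A + snd B * t)%R); [rewrite S; ring|].
  intros t _; simpl; ring.
Qed.

(** * Goursat's theorem on rectangles *)

Lemma contR_of_cont (G : C -> C) (g : R -> C) (t : R) :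
  (forall s, (Cmod (g s - g t) <= Rabs (s - t))%R) ->
  cont G (g t) -> contR (fun s => G (g s)) t.
Proof.
intros Hg H eps He; destruct (H eps He) as [d [Hd Hs]].
exists d; split; [exact Hd|]; intros s Hst; apply Hs.
eapply Rle_lt_trans; [apply Hg | exact Hst].
Qed.

Lemma contR_horizontal (G : C -> C) (x y : R) :
  cont G (x, y) -> contR (fun s => G (s, y)) x.
Proof.
apply (contR_of_cont G (fun s => (s, y))); intros s.
replace ((s, y) - (x, y)) with (RtoC (s - x))
  by (apply injective_projections; simpl; ring).
rewrite Cmod_R; lra.
Qed.

Lemma contR_vertical (G : C -> C) (x y : R) :
  cont G (x, y) -> contR (fun s => G (x, s)) y.
Proof.
apply (contR_of_cont G (fun s => (x, s))); intros s.
replace ((x, s) - (x, y)) with (Ci * RtoC (s - y))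
  by (apply injective_projections; simpl; ring).
rewrite Cmod_mult, Cmod_Ci, Cmod_R; lra.
Qed.

Definition cont_rect (G : C -> C) (a b c d : R) : Prop :=
  forall x y, (a <= x <= b)%R -> (c <= y <= d)%R -> cont G (x, y).

Definition boundary_int (G : C -> C) (a b c d : R) : C :=
  (CI (fun x => G (x, c)) a b - CI (fun x => G (x, d)) a b)
  + Ci * (CI (fun y => G (b, y)) c d - CI (fun y => G (a, y)) c d).

Lemma boundary_int_split (G : C -> C) (a m b c n d : R) :
  (a <= m <= b)%R -> (c <= n <= d)%R -> cont_rect G a b c d ->
  boundary_int G a b c d =
  boundary_int G a m c n + boundary_int G m b c n
  + boundary_int G a m n d + boundary_int G m b n d.
Proof.
intros Hm Hn H; unfold boundary_int.
assert (Hh : forall y, (c <= y <= d)%R ->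
  CI (fun x => G (x, y)) a b = CI (fun x => G (x, y)) a m + CI (fun x => G (x, y)) m b).
{ intros y Hy; apply CI_Chasles; [exact Hm|].
  intros; apply contR_horizontal, H; assumption. }
assert (Hv : forall x, (a <= x <= b)%R ->
  CI (fun y => G (x, y)) c d = CI (fun y => G (x, y)) c n + CI (fun y => G (x, y)) n d).
{ intros x Hx; apply CI_Chasles; [exact Hn|].
  intros; apply contR_vertical, H; assumption. }
rewrite (Hh c), (Hh d), (Hv a), (Hv b) by lra; ring.
Qed.

(** Computed edge by edge. In Goursat's argument this removes the first-order part of [G] at the
    limit point of the rectangles. *)
Lemma boundary_int_affine (A B : C) (a b c d : R) :
  boundary_int (fun z => A + B * z) a b c d = 0.
Proof.
unfold boundary_int.
assert (Hh : forall y, CI (fun x => A + B * (x, y)) a b =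
   (A + B * (Ci * RtoC y)) * RtoC (b - a) + B * RtoC ((b * b - a * a) / 2)).
{ intros y; rewrite <- CI_affine; unfold CI; f_equal; apply RInt_ext; intros x _;
   simpl; ring. }
assert (Hv : forall x, CI (fun y => A + B * (x, y)) c d =
   (A + B * RtoC x) * RtoC (d - c) + (B * Ci) * RtoC ((d * d - c * c) / 2)).
{ intros x; rewrite <- CI_affine; unfold CI; f_equal; apply RInt_ext; intros y _;
   simpl; ring. }
rewrite !Hh, !Hv.
apply injective_projections; simpl; field.
Qed.

Lemma boundary_int_plus (G H : C -> C) (a b c d : R) :
  (a <= b)%R -> (c <= d)%R ->
  cont_rect G a b c d -> cont_rect H a b c d ->
  boundary_int (fun z => G z + H z) a b c d
  = boundary_int G a b c d + boundary_int H a b c d.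
Proof.
intros Hab Hcd HG HH; unfold boundary_int.
rewrite !(CI_plus (fun x => G (x, _)) (fun x => H (x, _))), 
        !(CI_plus (fun y => G (_, y)) (fun y => H (_, y)));
  try assumption;
  try (intros; first [apply contR_horizontal | apply contR_vertical];
       (apply HG || apply HH); lra).
ring.
Qed.

Lemma boundary_int_bound (G : C -> C) (a b c d M : R) :
  (a <= b)%R -> (c <= d)%R -> cont_rect G a b c d ->
  (forall x y, (a <= x <= b)%R -> (c <= y <= d)%R -> (Cmod (G (x, y)) <= M)%R) ->
  (Cmod (boundary_int G a b c d) <= 4 * ((b - a) + (d - c)) * M)%R.
Proof.
intros Hab Hcd HG HM; unfold boundary_int.
assert (Hh : forall y, (c <= y <= d)%R ->
  (Cmod (CI (fun x => G (x, y)) a b) <= 2 * ((b - a) * M))%R).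
{ intros y Hy; apply CI_bound; auto; intros; apply contR_horizontal; auto. }
assert (Hv : forall x, (a <= x <= b)%R ->
  (Cmod (CI (fun y => G (x, y)) c d) <= 2 * ((d - c) * M))%R).
{ intros x Hx; apply CI_bound; auto; intros; apply contR_vertical; auto. }
assert (T : forall u v w z : C,
  (Cmod ((u - v) + Ci * (w - z)) <= (Cmod u + Cmod v) + (Cmod w + Cmod z))%R).
{ intros; eapply Rle_trans; [apply Cmod_triangle|].
  rewrite Cmod_mult, Cmod_Ci, Rmult_1_l; unfold Cminus.
  apply Rplus_le_compat; eapply Rle_trans; try apply Cmod_triangle;
    rewrite Cmod_opp; lra. }
eapply Rle_trans; [apply T|].
assert (H1 := Hh c); assert (H2 := Hh d); assert (H3 := Hv a); assert (H4 := Hv b).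
lra.
Qed.

Section Goursat.

Variables (G : C -> C) (a0 c0 U V : R).
Hypotheses (HU : (0 <= U)%R) (HV : (0 <= V)%R).
Hypothesis HG : forall x y, (a0 <= x <= a0 + U)%R -> (c0 <= y <= c0 + V)%R ->
  diff G (x, y).
Variable eps : R.
Hypothesis Heps : (0 < eps)%R.

Let sc (n : nat) : R := ((/ 2) ^ n)%R.

(** The bound scales like the square of the side, so that it fails for one of the four quarters
    whenever it fails for a rectangle. The constant 4 is the one that [boundary_int_bound] yields
    for an integrand of size eps times half the perimeter. *)
Let small (n : nat) (a c : R) : Prop :=
  (Cmod (boundary_int G a (a + U * sc n) c (c + V * sc n))
   <= 4 * eps * ((U + V) * sc n) ^ 2)%R.

Let inside (n : nat) (a c : R) : Prop :=
  (a0 <= a /\ a + U * sc n <= a0 + U /\ c0 <= c /\ c + V * sc n <= c0 + V)%R.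

Lemma sc_pos n : (0 < sc n)%R.
Proof. apply pow_lt; lra. Qed.

Lemma sc_S n : sc n = (2 * sc (S n))%R.
Proof. unfold sc; simpl; field. Qed.

Lemma quarter (n : nat) (a c : R) : inside n a c -> ~ small n a c ->
  exists a' c', inside (S n) a' c' /\ ~ small (S n) a' c' /\
    (a <= a' /\ a' + U * sc (S n) <= a + U * sc n)%R /\
    (c <= c' /\ c' + V * sc (S n) <= c + V * sc n)%R.
Proof.
intros Hin Hns.
assert (Hp := sc_pos (S n)).
assert (PU : (0 <= U * sc (S n))%R) by (apply Rmult_le_pos; lra).
assert (PV : (0 <= V * sc (S n))%R) by (apply Rmult_le_pos; lra).
unfold inside, small in *.
rewrite (sc_S n) in Hin, Hns.
rewrite (sc_S n).
set (u := (U * sc (S n))%R) in *; set (v := (V * sc (S n))%R) in *.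
replace (U * (2 * sc (S n)))%R with (u + u)%R in * by (unfold u; ring).
replace (V * (2 * sc (S n)))%R with (v + v)%R in * by (unfold v; ring).
replace ((U + V) * (2 * sc (S n)))%R with (2 * (u + v))%R in * by (unfold u, v; ring).
replace ((U + V) * sc (S n))%R with (u + v)%R in * by (unfold u, v; ring).
rewrite (boundary_int_split G a (a + u) (a + (u + u)) c (c + v) (c + (v + v))) in Hns;
  [|lra|lra| intros x y Hx Hy; apply diff_cont, HG; lra].
replace (a + (u + u))%R with (a + u + u)%R in * by ring.
replace (c + (v + v))%R with (c + v + v)%R in * by ring.
set (Q1 := boundary_int G a (a + u) c (c + v)) in *.
set (Q2 := boundary_int G (a + u) (a + u + u) c (c + v)) in *.
set (Q3 := boundary_int G a (a + u) (c + v) (c + v + v)) in *.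
set (Q4 := boundary_int G (a + u) (a + u + u) (c + v) (c + v + v)) in *.
set (B := (4 * eps * (u + v) ^ 2)%R) in *.
assert (T : (Cmod (Q1 + Q2 + Q3 + Q4) <= Cmod Q1 + Cmod Q2 + Cmod Q3 + Cmod Q4)%R).
{ eapply Rle_trans; [apply Cmod_triangle|]; apply Rplus_le_compat_r.
  eapply Rle_trans; [apply Cmod_triangle|]; apply Rplus_le_compat_r.
  apply Cmod_triangle. }
replace (4 * eps * (2 * (u + v)) ^ 2)%R with (4 * B)%R in Hns by (unfold B; ring).
destruct (Rle_dec (Cmod Q1) B) as [L1|N]; [|exists a, c; repeat split; auto; lra].
destruct (Rle_dec (Cmod Q2) B) as [L2|N]; [|exists (a + u)%R, c; repeat split; auto; lra].
destruct (Rle_dec (Cmod Q3) B) as [L3|N]; [|exists a, (c + v)%R; repeat split; auto; lra].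
destruct (Rle_dec (Cmod Q4) B) as [L4|N];
  [|exists (a + u)%R, (c + v)%R; repeat split; auto; lra].
exfalso; apply Hns; lra.
Qed.

Lemma nested_point (A : nat -> R) (W : R) : (0 <= W)%R ->
  (forall n, (A n <= A (S n) /\ A (S n) + W * sc (S n) <= A n + W * sc n)%R) ->
  exists p, forall n, (A n <= p <= A n + W * sc n)%R.
Proof.
intros HW H.
assert (D : forall n k, (A n <= A (n + k)%nat /\
             A (n + k)%nat + W * sc (n + k) <= A n + W * sc n)%R).
{ intros n k; induction k as [|k IH].
  - rewrite Nat.add_0_r; lra.
  - rewrite Nat.add_succ_r; specialize (H (n + k)%nat); lra. }
assert (Wp : forall n, (0 <= W * sc n)%R)
  by (intros; apply Rmult_le_pos; [exact HW | left; apply sc_pos]).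
destruct (ex_finite_lim_seq_incr A (A 0%nat + W * sc 0)) as [p Hp].
- intros n; apply H.
- intros n; destruct (D 0%nat n) as [_ D2]; simpl in D2; specialize (Wp n); lra.
- exists p; intros n; split.
  + apply (is_lim_seq_incr_compare A); [exact Hp | intros; apply H].
  + apply (is_lim_seq_le_loc A (fun _ => (A n + W * sc n)%R) p (A n + W * sc n)%R);
      [|exact Hp|apply is_lim_seq_const].
    exists n; intros m Hm; replace m with (n + (m - n))%nat by lia.
    destruct (D n (m - n)%nat) as [_ D2]; specialize (Wp (n + (m - n))%nat); lra.
Qed.

Lemma small_whole : small 0 a0 c0.
Proof.
apply NNPP; intros Hns.
assert (Hin : inside 0 a0 c0) by (unfold inside, sc; simpl; lra).
(* Each chosen corner carries the proof that its rectangle is bad, since [quarter] needs that proof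
   to produce the next one. *)
set (St := fun n => {ac : R * R | inside n (fst ac) (snd ac) /\ ~ small n (fst ac) (snd ac)}).
set (step := fun (n : nat) (s : St n) =>
  let ac := proj1_sig s in
  constructive_indefinite_description
    (fun ac' : R * R => (inside (S n) (fst ac') (snd ac') /\ ~ small (S n) (fst ac') (snd ac')) /\
       (fst ac <= fst ac' /\ fst ac' + U * sc (S n) <= fst ac + U * sc n)%R /\
       (snd ac <= snd ac' /\ snd ac' + V * sc (S n) <= snd ac + V * sc n)%R)
    (match quarter n (fst ac) (snd ac) (proj1 (proj2_sig s)) (proj2 (proj2_sig s)) with
     | ex_intro a' (ex_intro c' (conj h1 (conj h2 (conj h3 h4)))) =>
         ex_intro _ (a', c') (conj (conj h1 h2) (conj h3 h4))
     end)).
set (s := fix s (n : nat) : St n :=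
  match n with
  | O => exist _ (a0, c0) (conj Hin Hns)
  | S m => exist _ (proj1_sig (step m (s m))) (proj1 (proj2_sig (step m (s m))))
  end).
set (A := fun n => fst (proj1_sig (s n))); set (B := fun n => snd (proj1_sig (s n))).
destruct (nested_point A U HU) as [p Hp].
{ intros n; apply (proj1 (proj2 (proj2_sig (step n (s n))))). }
destruct (nested_point B V HV) as [r Hr].
{ intros n; apply (proj2 (proj2 (proj2_sig (step n (s n))))). }
assert (Hpr : diff G (p, r)).
{ assert (E1 := Hp 0%nat); assert (E2 := Hr 0%nat).
  change (a0 <= p <= a0 + U * 1)%R in E1; change (c0 <= r <= c0 + V * 1)%R in E2.
  apply HG; lra. }
destruct Hpr as [k [Ek Hk]].
destruct (Hk eps Heps) as [d [Hd Hkd]].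
destruct (geom_small (/ 2) (U + V) d) as [n Hn]; [lra|lra|exact Hd|].
specialize (Hn n (Nat.le_refl n)); fold (sc n) in Hn.
assert (Hsc := sc_pos n).
destruct (proj2_sig (s n)) as [Hi Hs]; fold (A n) (B n) in Hi, Hs; apply Hs.
specialize (Hp n); specialize (Hr n).
unfold small, inside in *.
set (u := (U * sc n)%R) in *; set (v := (V * sc n)%R) in *.
replace ((U + V) * sc n)%R with (u + v)%R in * by (unfold u, v; ring).
assert (Pu : (0 <= u)%R) by (apply Rmult_le_pos; lra).
assert (Pv : (0 <= v)%R) by (apply Rmult_le_pos; lra).
set (z0 := ((p, r) : C)) in *.
(* The first-order expansion of [G] at the limit point. Its boundary integral is 0, so only the
   error [E], at most eps times the distance to z0, contributes. *)
set (L := fun z : C => (G z0 - k z0 * z0) + k z0 * z).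
set (E := fun z : C => G z + (-1) * L z).
assert (HcG : cont_rect G (A n) (A n + u) (B n) (B n + v))
  by (intros x y Hx Hy; apply diff_cont, HG; lra).
assert (HcL : cont_rect L (A n) (A n + u) (B n) (B n + v)).
{ intros x y _ _; apply cont_plus; [apply cont_const|].
  apply cont_mult; [apply cont_const | apply cont_id]. }
assert (HcE : cont_rect E (A n) (A n + u) (B n) (B n + v)).
{ intros x y Hx Hy; apply cont_plus; [apply HcG; assumption|].
  apply cont_mult; [apply cont_const | apply HcL; assumption]. }
replace (boundary_int G (A n) (A n + u) (B n) (B n + v))
  with (boundary_int E (A n) (A n + u) (B n) (B n + v)).
2:{ transitivity (boundary_int (fun z => E z + L z) (A n) (A n + u) (B n) (B n + v)).
    - rewrite boundary_int_plus by (auto; lra).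
      replace (boundary_int L (A n) (A n + u) (B n) (B n + v)) with (RtoC 0)
        by (symmetry; apply boundary_int_affine); ring.
    - unfold boundary_int; f_equal; [|f_equal]; f_equal; apply CI_ext; try lra;
      intros; unfold E; ring. }
eapply Rle_trans.
- apply (boundary_int_bound E _ _ _ _ (eps * (u + v))%R); [lra|lra|exact HcE|].
  intros x y Hx Hy.
  replace (E (x, y)) with ((k (x, y) - k z0) * ((x, y) - z0)).
  2:{ unfold E, L; replace (G (x, y)) with (G z0 + k (x, y) * ((x, y) - z0))
        by (rewrite <- Ek; ring); ring. }
  assert (Hz : (Cmod ((x, y) - z0) <= u + v)%R).
  { unfold z0; replace ((x, y) - (p, r)) with (((x - p)%R, (y - r)%R) : C) by reflexivity.
    eapply Rle_trans; [apply Cmod_le_abs|].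
    apply Rplus_le_compat; apply Rabs_le; lra. }
  rewrite Cmod_mult; apply Rmult_le_compat; try apply Cmod_ge_0; [|exact Hz].
  left; apply Hkd; lra.
- right; ring.
Qed.

End Goursat.

Theorem goursat (G : C -> C) (a b c d : R) : (a <= b)%R -> (c <= d)%R ->
  (forall x y, (a <= x <= b)%R -> (c <= y <= d)%R -> diff G (x, y)) ->
  boundary_int G a b c d = 0.
Proof.
intros Hab Hcd HG.
apply Cmod_eq_0, Rle_antisym; [|apply Cmod_ge_0].
apply le_epsilon; intros e He; rewrite Rplus_0_l.
set (W := ((b - a) + (d - c))%R).
set (eps := (e / (4 * (W ^ 2 + 1)))%R).
assert (HW : (0 <= W ^ 2)%R) by apply pow2_ge_0.
assert (Heps : (0 < eps)%R) by (apply Rdiv_lt_0_compat; lra).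
assert (H := small_whole G a c (b - a) (d - c) ltac:(lra) ltac:(lra)).
replace (a + (b - a))%R with b in H by ring.
replace (c + (d - c))%R with d in H by ring.
specialize (H HG eps Heps); simpl in H; rewrite !Rmult_1_r in H.
replace (a + (b - a))%R with b in H by ring.
replace (c + (d - c))%R with d in H by ring.
fold W in H; eapply Rle_trans; [exact H|].
apply Rle_trans with (4 * eps * (W ^ 2 + 1))%R; [nra|].
right; unfold eps; field; lra.
Qed.

(** * Integrals over circles *)

Definition clim (u : nat -> C) (l : C) : Prop :=
  forall eps : R, (0 < eps)%R -> exists N : nat, forall n : nat, (N <= n)%nat ->
    (Cmod (u n - l) < eps)%R.

Lemma Cmod_minus_sym (x y : C) : Cmod (x - y) = Cmod (y - x).
Proof. rewrite <- Cmod_opp; f_equal; ring. Qed.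

Lemma Cmod_eq_0_eps (x : C) : (forall e, (0 < e)%R -> (Cmod x <= e)%R) -> x = 0.
Proof.
intros H; apply Cmod_eq_0, Rle_antisym; [|apply Cmod_ge_0].
apply le_epsilon; intros e He; rewrite Rplus_0_l; auto.
Qed.

Lemma Cmod_triangle_minus (x y z : C) : (Cmod (x - z) <= Cmod (x - y) + Cmod (y - z))%R.
Proof. replace (x - z) with ((x - y) + (y - z)) by ring; apply Cmod_triangle. Qed.

Lemma clim_unique (u : nat -> C) (l l' : C) : clim u l -> clim u l' -> l = l'.
Proof.
intros H H'; apply Ceq_minus, Cmod_eq_0_eps; intros e He.
destruct (H (e / 2)%R) as [N HN]; [lra|]; destruct (H' (e / 2)%R) as [N' HN']; [lra|].
specialize (HN (N + N')%nat ltac:(lia)); specialize (HN' (N + N')%nat ltac:(lia)).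
assert (T := Cmod_triangle_minus l (u (N + N')%nat) l').
rewrite (Cmod_minus_sym l (u _)) in T; lra.
Qed.

(** Sums the n terms of index below n, so that the empty sum is included; [sum_n] also takes the
    term of index n, which explains the successors in the comparisons below. *)
Fixpoint csum (a : nat -> C) (n : nat) : C :=
  match n with O => 0 | S m => csum a m + a m end.

Definition csums (a : nat -> C) (l : C) : Prop := clim (csum a) l.

Lemma csum_ext (a b : nat -> C) (n : nat) :
  (forall k, (k < n)%nat -> a k = b k) -> csum a n = csum b n.
Proof.
induction n as [|n IH]; intros H; simpl; [reflexivity|].
rewrite IH, (H n) by auto; reflexivity.
Qed.

Lemma csum_plus (a b : nat -> C) (n : nat) :
  csum (fun k => a k + b k) n = csum a n + csum b n.
Proof. induction n as [|n IH]; simpl; [ring | rewrite IH; ring]. Qed.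

Lemma csum_scal (c : C) (a : nat -> C) (n : nat) :
  csum (fun k => c * a k) n = c * csum a n.
Proof. induction n as [|n IH]; simpl; [ring | rewrite IH; ring]. Qed.

Lemma csums_ext (a b : nat -> C) (l : C) :
  (forall n, a n = b n) -> csums a l -> csums b l.
Proof.
intros E H eps He; destruct (H eps He) as [N HN]; exists N; intros n Hn.
rewrite <- (csum_ext a b) by auto; auto.
Qed.

Lemma csum_sum_n (a : nat -> C) (n : nat) :
  csum a (S n) = @sum_n C_AbelianGroup a n.
Proof.
induction n as [|n IH].
- rewrite sum_O; simpl; ring.
- rewrite sum_Sn, <- IH; reflexivity.
Qed.

Lemma csums_series (a : nat -> C) (l : C) :
  csums a l <-> @is_series C_AbsRing C_NormedModule a l.
Proof.
split; intros H.
- apply filterlim_locally; intros eps.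
  destruct (H eps (cond_pos eps)) as [N HN].
  exists N; intros n Hn; apply C_NormedModule_mixin_compat1.
  change (Cmod (@sum_n C_AbelianGroup a n - l) < eps)%R.
  rewrite <- csum_sum_n; apply HN; lia.
- intros eps He.
  (* Balls of the product structure control [Cmod] only up to the factor sqrt 2 < 2, hence the
     radius eps / 2. *)
  destruct (proj1 (filterlim_locally _ _) H (mkposreal (eps / 2) ltac:(lra))) as [N HN].
  exists (S N); intros n Hn; destruct n as [|n]; [lia|].
  assert (B := C_NormedModule_mixin_compat2 _ _ _ (HN n ltac:(lia))).
  rewrite csum_sum_n; eapply Rlt_trans; [exact B|]; simpl.
  assert (sqrt 2 < 2)%R.
  { rewrite <- (sqrt_square 2) at 2 by lra; apply sqrt_lt_1; lra. }
  nra.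
Qed.

Lemma csums_unique (a : nat -> C) (l l' : C) : csums a l -> csums a l' -> l = l'.
Proof. apply clim_unique. Qed.

(** * The complex exponential function *)

Definition cexp (w : C) : C := ((exp (Re w) * cos (Im w))%R, (exp (Re w) * sin (Im w))%R).

Lemma cexp_plus (w h : C) : cexp (w + h) = cexp w * cexp h.
Proof.
destruct w as [x y], h as [u v]; unfold cexp; simpl.
rewrite exp_plus, cos_plus, sin_plus; apply injective_projections; simpl; ring.
Qed.

Lemma Cmod_cexp (w : C) : Cmod (cexp w) = exp (Re w).
Proof.
unfold cexp, Cmod; simpl.
replace (exp (Re w) * cos (Im w) * (exp (Re w) * cos (Im w) * 1) +
 exp (Re w) * sin (Im w) * (exp (Re w) * sin (Im w) * 1))%R
 with (exp (Re w) * exp (Re w) * (Rsqr (sin (Im w)) + Rsqr (cos (Im w))))%R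
 by (unfold Rsqr; ring).
rewrite sin2_cos2, Rmult_1_r; apply sqrt_square; left; apply exp_pos.
Qed.

Lemma cexp_neq_0 (w : C) : cexp w <> 0.
Proof. apply Cmod_gt_0; rewrite Cmod_cexp; apply exp_pos. Qed.

Lemma derivable_pt_lim_littleo (f : R -> R) (l : R) : derivable_pt_lim f 0 l ->
  forall eps, (0 < eps)%R -> exists d, (0 < d)%R /\
    forall h, (Rabs h < d)%R -> (Rabs (f h - f 0 - l * h) <= eps * Rabs h)%R.
Proof.
intros H eps He; destruct (H eps He) as [d Hd].
exists d; split; [apply cond_pos|]; intros h Hh.
destruct (Req_dec h 0) as [->|N].
- replace (f 0 - f 0 - l * 0)%R with 0%R by ring; rewrite Rabs_R0; lra.
- specialize (Hd h N Hh); rewrite Rplus_0_l in Hd.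
  replace (f h - f 0 - l * h)%R with (((f h - f 0) / h - l) * h)%R by (field; exact N).
  rewrite Rabs_mult; apply Rmult_le_compat_r; [apply Rabs_pos | lra].
Qed.

Lemma cexp_littleo (eps : R) : (0 < eps)%R -> exists d, (0 < d)%R /\
  forall h, (Cmod h < d)%R -> (Cmod (cexp h - 1 - h) <= eps * Cmod h)%R.
Proof.
intros He.
(* The two components of the remainder are bounded below by 4 e |h| and 5 e |h| from above, 9 e |h|
   in total; e <= 1 serves to bound exp x by 3. *)
set (e := Rmin 1 (eps / 12)%R).
assert (He0 : (0 < e)%R) by (apply Rmin_glb_lt; lra).
assert (He1 : (e <= 1)%R) by apply Rmin_l.
assert (He2 : (e <= eps / 12)%R) by apply Rmin_r.
assert (D1 : derivable_pt_lim exp 0 1) by (assert (T := derivable_pt_lim_exp 0); rewrite exp_0 in T; exact T).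
assert (D2 : derivable_pt_lim cos 0 (- 0)%R) by (assert (T := derivable_pt_lim_cos 0); rewrite sin_0 in T; exact T).
assert (D3 : derivable_pt_lim sin 0 1) by (assert (T := derivable_pt_lim_sin 0); rewrite cos_0 in T; exact T).
destruct (derivable_pt_lim_littleo _ _ D1 e He0) as [d1 [P1 H1]].
destruct (derivable_pt_lim_littleo _ _ D2 e He0) as [d2 [P2 H2]].
destruct (derivable_pt_lim_littleo _ _ D3 e He0) as [d3 [P3 H3]].
exists (Rmin (Rmin d1 d2) (Rmin d3 e)); split.
{ apply Rmin_glb_lt; apply Rmin_glb_lt; assumption. }
intros [x y] Hh.
set (m := Cmod (x, y)) in *.
assert (Hx : (Rabs x <= m)%R) by (apply (re_le_Cmod (x, y))).
assert (Hy : (Rabs y <= m)%R) by (apply (im_le_Cmod (x, y))).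
assert (B1 := Rmin_l (Rmin d1 d2) (Rmin d3 e)).
assert (B2 := Rmin_r (Rmin d1 d2) (Rmin d3 e)).
assert (B3 := Rmin_l d1 d2); assert (B4 := Rmin_r d1 d2).
assert (B5 := Rmin_l d3 e); assert (B6 := Rmin_r d3 e).
specialize (H1 x ltac:(lra)); specialize (H2 y ltac:(lra)); specialize (H3 y ltac:(lra)).
rewrite exp_0 in H1; rewrite cos_0 in H2; rewrite sin_0 in H3.
assert (X0 := Rabs_pos x); assert (Y0 := Rabs_pos y).
replace (cexp (x, y) - 1 - (x, y)) with
  (((exp x - 1 - 1 * x) + exp x * (cos y - 1 - - 0 * y))%R,
   (exp x * (sin y - 0 - 1 * y) + ((exp x - 1 - 1 * x) + x) * y)%R)
  by (unfold cexp; apply injective_projections; simpl; ring).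
set (E := (exp x - 1 - 1 * x)%R) in *.
set (Cy := (cos y - 1 - - 0 * y)%R) in *.
set (Sy := (sin y - 0 - 1 * y)%R) in *.
assert (Hex : (Rabs (exp x) <= 3)%R).
{ replace (exp x) with (E + (1 + x))%R by (unfold E; ring).
  eapply Rle_trans; [apply Rabs_triang|].
  assert (Rabs (1 + x) <= 1 + Rabs x)%R
    by (eapply Rle_trans; [apply Rabs_triang|]; rewrite Rabs_R1; lra).
  nra. }
eapply Rle_trans; [apply Cmod_le_abs|].
assert (T1 : (Rabs (E + exp x * Cy) <= e * m + 3 * (e * m))%R).
{ eapply Rle_trans; [apply Rabs_triang|]; rewrite Rabs_mult.
  apply Rplus_le_compat; [nra|]; apply Rmult_le_compat; try apply Rabs_pos; nra. }
assert (T2 : (Rabs (exp x * Sy + (E + x) * y) <= 3 * (e * m) + (2 * e) * m)%R).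
{ eapply Rle_trans; [apply Rabs_triang|]; rewrite !Rabs_mult.
  apply Rplus_le_compat; apply Rmult_le_compat; try apply Rabs_pos; try nra.
  eapply Rle_trans; [apply Rabs_triang|]; nra. }
assert (0 <= m)%R by apply Cmod_ge_0.
nra.
Qed.

Lemma diff_cexp (w : C) : diff cexp w.
Proof.
apply (diff_intro cexp w (cexp w)); intros eps He.
set (A := Cmod (cexp w)).
assert (HA : (0 < A)%R) by (apply Cmod_gt_0, cexp_neq_0).
destruct (cexp_littleo (eps / A)%R) as [d [Hd H]]; [apply Rdiv_lt_0_compat; lra|].
exists d; split; [exact Hd|]; intros v Hv; specialize (H _ Hv).
replace (cexp v) with (cexp w * cexp (v - w)) by (rewrite <- cexp_plus; f_equal; ring).
replace (cexp w * cexp (v - w) - cexp w - cexp w * (v - w))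
  with (cexp w * (cexp (v - w) - 1 - (v - w))) by ring.
rewrite Cmod_mult; fold A.
replace (eps * Cmod (v - w))%R with (A * (eps / A * Cmod (v - w)))%R by (field; lra).
apply Rmult_le_compat_l; lra.
Qed.

Lemma cexp_period (x : R) : cexp (x, (2 * PI)%R) = cexp (x, 0%R).
Proof. unfold cexp; simpl; rewrite cos_2PI, sin_2PI, cos_0, sin_0; reflexivity. Qed.

(** For G(w) = F(exp w) this is the integral of F over the circle |z| = exp s with respect to the
    angle. *)
Definition circle_int (G : C -> C) (s : R) : C := CI (fun t => G (s, t)) 0 (2 * PI).

Lemma two_PI_pos : (0 < 2 * PI)%R.
Proof. assert (H := PI_RGT_0); lra. Qed.

(** The horizontal sides of the rectangle cancel by periodicity; what Goursat's theorem leaves is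
    the difference of the two vertical sides. *)
Lemma circle_int_strip (G : C -> C) (s1 s2 : R) : (s1 <= s2)%R ->
  (forall x, G (x, (2 * PI)%R) = G (x, 0%R)) ->
  (forall x y, (s1 <= x <= s2)%R -> (0 <= y <= 2 * PI)%R -> diff G (x, y)) ->
  circle_int G s1 = circle_int G s2.
Proof.
intros Hs Hper HG; assert (P := two_PI_pos).
assert (H := goursat G s1 s2 0 (2 * PI) Hs (Rlt_le _ _ P) HG).
unfold boundary_int in H.
replace (CI (fun x => G (x, (2 * PI)%R)) s1 s2) with (CI (fun x => G (x, 0%R)) s1 s2) in H
  by (apply CI_ext; auto).
fold (circle_int G s1) (circle_int G s2) in H.
assert (E : Ci * (circle_int G s2 - circle_int G s1) = 0) by (etransitivity; [|exact H]; ring).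
symmetry; apply Ceq_minus.
replace (circle_int G s2 - circle_int G s1) with (- Ci * (Ci * (circle_int G s2 - circle_int G s1)))
  by (apply injective_projections; simpl; ring).
rewrite E; ring.
Qed.

Lemma cont_rect_uniform (G : C -> C) (a b c d : R) : cont_rect G a b c d ->
  forall eps, (0 < eps)%R -> exists e, (0 < e)%R /\
  forall x x' y, (a <= x <= b)%R -> (a <= x' <= b)%R -> (c <= y <= d)%R ->
    (Rabs (x' - x) < e)%R -> (Cmod (G (x', y) - G (x, y)) < eps)%R.
Proof.
intros HG eps He.
assert (L : forall p : C -> R, (forall z w : C, p (z - w)%C = (p z - p w)%R) ->
   (forall z, Rabs (p z) <= Cmod z)%R ->
   forall x y, (a <= x <= b)%R -> (c <= y <= d)%R ->
     continuity_2d_pt (fun u v => p (G (u, v))) x y).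
{ intros p Hp Hpm x y Hx Hy e.
  destruct (HG x y Hx Hy e (cond_pos e)) as [r [Hr H]].
  exists (mkposreal (r / 2) ltac:(lra)); simpl; intros u v Hu Hv.
  change (Rabs (p (G (u, v)) - p (G (x, y))) < e)%R; rewrite <- Hp; eapply Rle_lt_trans; [apply Hpm|]; apply H.
  replace ((u, v) - (x, y)) with (((u - x)%R, (v - y)%R) : C) by reflexivity.
  eapply Rle_lt_trans; [apply Cmod_le_abs|]; lra. }
destruct (uniform_continuity_2d _ a b c d
            (L Re (fun _ _ => eq_refl) re_le_Cmod) (mkposreal (eps / 2) ltac:(lra))) as [e1 H1].
destruct (uniform_continuity_2d _ a b c d
            (L Im (fun _ _ => eq_refl) im_le_Cmod) (mkposreal (eps / 2) ltac:(lra))) as [e2 H2].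
exists (Rmin e1 e2); split; [apply Rmin_glb_lt; apply cond_pos|].
intros x x' y Hx Hx' Hy Hxx.
assert (B1 := Rmin_l e1 e2); assert (B2 := Rmin_r e1 e2).
assert (Z : (Rabs (y - y) = 0)%R) by (rewrite Rminus_diag, Rabs_R0; reflexivity).
assert (Q1 := cond_pos e1); assert (Q2 := cond_pos e2).
specialize (H1 x y x' y Hx Hy Hx' Hy ltac:(lra) ltac:(lra)).
specialize (H2 x y x' y Hx Hy Hx' Hy ltac:(lra) ltac:(lra)).
simpl in H1, H2.
rewrite (surjective_pairing (G (x', y) - G (x, y))).
eapply Rle_lt_trans; [apply Cmod_le_abs|].
change (Rabs (Re (G (x', y)) - Re (G (x, y))) + Rabs (Im (G (x', y)) - Im (G (x, y))) < eps)%R.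
lra.
Qed.

Lemma circle_int_cont (G : C -> C) (a b : R) : cont_rect G a b 0 (2 * PI) ->
  forall eps, (0 < eps)%R -> exists e, (0 < e)%R /\
  forall x x', (a <= x <= b)%R -> (a <= x' <= b)%R -> (Rabs (x' - x) < e)%R ->
    (Cmod (circle_int G x' - circle_int G x) <= eps)%R.
Proof.
intros HG eps He; assert (P := two_PI_pos).
destruct (cont_rect_uniform G a b 0 (2 * PI) HG (eps / (2 * (2 * PI)))%R) as [e [He0 H]];
  [apply Rdiv_lt_0_compat; lra|].
exists e; split; [exact He0|]; intros x x' Hx Hx' Hxx.
assert (Cx : forall t, (0 <= t <= 2 * PI)%R -> contR (fun t => G (x, t)) t)
  by (intros; apply contR_vertical, HG; auto).
assert (Cx' : forall t, (0 <= t <= 2 * PI)%R -> contR (fun t => G (x', t)) t)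
  by (intros; apply contR_vertical, HG; auto).
assert (Cm : forall t, (0 <= t <= 2 * PI)%R -> contR (fun t => (-1) * G (x, t)) t).
{ intros t Ht; apply (contR_vertical (fun z => (-1) * G z)).
  apply cont_mult; [apply cont_const | apply HG; auto]. }
unfold circle_int.
replace (CI (fun t => G (x', t)) 0 (2 * PI) - CI (fun t => G (x, t)) 0 (2 * PI))
  with (CI (fun t => G (x', t) + (-1) * G (x, t)) 0 (2 * PI)).
2:{ rewrite CI_plus, CI_scal by (auto; lra); ring. }
eapply Rle_trans.
- apply (CI_bound _ _ _ (eps / (2 * (2 * PI)))%R); [lra| |].
  + intros t Ht; apply contR_plus; auto.
  + intros t Ht; left.
    replace (G (x', t) + (-1) * G (x, t)) with (G (x', t) - G (x, t)) by ring.
    apply H; auto.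
- right; field; lra.
Qed.

(** * The Cauchy series *)

Lemma circle_int_bound (G : C -> C) (s M : R) :
  (forall t, (0 <= t <= 2 * PI)%R -> cont G (s, t)) ->
  (forall t, (0 <= t <= 2 * PI)%R -> (Cmod (G (s, t)) <= M)%R) ->
  (Cmod (circle_int G s) <= 4 * PI * M)%R.
Proof.
intros HG HM; assert (P := two_PI_pos).
eapply Rle_trans; [apply (CI_bound _ _ _ M); [lra| |exact HM]|lra].
intros; apply contR_vertical; auto.
Qed.

Section Kernel.

Variables (k : C -> C) (a : C) (rad : R).
Hypothesis Hc : forall z, (Cmod z < rad)%R -> cont k z.
Hypothesis Hd : forall z, (Cmod z < rad)%R -> z <> a -> diff k z.

(** Since dz = z dw for z = exp w, the circle integral of [G] is the contour integral of k up to a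
    factor i. The k in view is the difference quotient of a function at a: continuous at a, but not
    yet known to be differentiable there. *)
Let G (w : C) : C := cexp w * k (cexp w).

Lemma kernel_cont x y : (exp x < rad)%R -> cont G (x, y).
Proof.
intros Hx; apply cont_mult; [apply diff_cont, diff_cexp|].
apply cont_comp; [apply diff_cont, diff_cexp|].
apply Hc; rewrite Cmod_cexp; exact Hx.
Qed.

Lemma kernel_strip s1 s2 : (s1 <= s2)%R -> (exp s2 < rad)%R ->
  (forall s, (s1 <= s <= s2)%R -> exp s <> Cmod a) ->
  circle_int G s1 = circle_int G s2.
Proof.
intros Hs Hr Ha; apply circle_int_strip; [exact Hs| |].
- intros x; unfold G; rewrite cexp_period; reflexivity.
- intros x y Hx _.
  assert (Hxr : (exp x < rad)%R).
  { eapply Rle_lt_trans; [|exact Hr].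
    destruct (proj2 Hx) as [L|E]; [left; apply exp_increasing; exact L | rewrite E; lra]. }
  apply diff_mult; [apply diff_cexp|].
  apply diff_comp; [apply diff_cexp|].
  apply Hd; [rewrite Cmod_cexp; exact Hxr|].
  intros E; apply (Ha x Hx); rewrite <- E, Cmod_cexp; reflexivity.
Qed.

(** Near 0 the function k is bounded by continuity, while the factor [cexp w] has modulus exp s,
    which tends to 0 with the radius. *)
Lemma kernel_small eps s0 : (0 < eps)%R -> (0 < rad)%R -> exists s, (s <= s0)%R /\
  (Cmod (circle_int G s) <= eps)%R.
Proof.
intros He Hr.
assert (H0 : cont k 0) by (apply Hc; rewrite Cmod_0; exact Hr).
destruct (H0 1%R Rlt_0_1) as [d [Hd0 H]].
set (M := (Cmod (k 0) + 1)%R).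
assert (HM : (0 < M)%R) by (assert (T := Cmod_ge_0 (k 0)); unfold M; lra).
assert (P := PI_RGT_0).
set (e := Rmin (Rmin rad d) (eps / (4 * PI * M))%R).
assert (He0 : (0 < e)%R).
{ apply Rmin_glb_lt; [apply Rmin_glb_lt; assumption|].
  apply Rdiv_lt_0_compat; [exact He|]; apply Rmult_lt_0_compat; lra. }
set (s := Rmin s0 (ln (e / 2))).
assert (Hs : (exp s <= e / 2)%R).
{ rewrite <- (exp_ln (e / 2)) by lra.
  destruct (Rle_lt_or_eq_dec _ _ (Rmin_r s0 (ln (e / 2)))) as [L|E].
  - left; apply exp_increasing; exact L.
  - right; unfold s; rewrite E; reflexivity. }
assert (E1 : (e <= rad)%R) by (eapply Rle_trans; apply Rmin_l).
assert (E2 : (e <= d)%R) by (eapply Rle_trans; [apply Rmin_l | apply Rmin_r]).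
assert (E3 : (e <= eps / (4 * PI * M))%R) by apply Rmin_r.
exists s; split; [apply Rmin_l|].
eapply Rle_trans; [apply (circle_int_bound _ _ (e * M))|].
- intros t _; apply kernel_cont; lra.
- intros t _; unfold G; rewrite Cmod_mult, Cmod_cexp; simpl.
  apply Rmult_le_compat; [left; apply exp_pos | apply Cmod_ge_0 | lra |].
  assert (Hk : (Cmod (k (cexp (s, t)) - k 0) < 1)%R).
  { apply H; replace (cexp (s, t) - 0) with (cexp (s, t)) by ring.
    rewrite Cmod_cexp; simpl; lra. }
  replace (k (cexp (s, t))) with (k 0 + (k (cexp (s, t)) - k 0)) by ring.
  eapply Rle_trans; [apply Cmod_triangle|]; unfold M; lra.
- apply Rle_trans with (4 * PI * (eps / (4 * PI * M) * M))%R.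
  + apply Rmult_le_compat_l; [lra|]; apply Rmult_le_compat_r; lra.
  + right; field; lra.
Qed.

Lemma kernel_inner s : (exp s < rad)%R ->
  (forall s', (s' <= s)%R -> exp s' <> Cmod a) -> circle_int G s = 0.
Proof.
intros Hs Ha; apply Cmod_eq_0, Rle_antisym; [|apply Cmod_ge_0].
apply le_epsilon; intros e He; rewrite Rplus_0_l.
assert (P := exp_pos s).
destruct (kernel_small e s He) as [s' [Hs' H]]; [lra|].
rewrite <- (kernel_strip s' s); auto.
intros u Hu; apply Ha; lra.
Qed.

(* The singular circle |z| = |a| is crossed by continuity of the circle integral. *)
Lemma circle_int_kernel s : (exp s < rad)%R -> exp s <> Cmod a -> circle_int G s = 0.
Proof.
intros Hs Hsa.
destruct (Rlt_or_le (exp s) (Cmod a)) as [L|L].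
{ apply kernel_inner; [exact Hs|]; intros s' Hs' E.
  assert (exp s' <= exp s)%R; [|lra].
  destruct Hs' as [Hl|He]; [left; apply exp_increasing; exact Hl | rewrite He; lra]. }
destruct (Ceq_dec a 0) as [Ea|Na].
{ apply kernel_inner; [exact Hs|]; intros s' _; rewrite Ea, Cmod_0.
  assert (T := exp_pos s'); lra. }
assert (Pa : (0 < Cmod a)%R) by (apply Cmod_gt_0; exact Na).
assert (Es : exp (ln (Cmod a)) = Cmod a) by (apply exp_ln; exact Pa).
set (s0 := ln (Cmod a)) in *.
assert (Hlt : (s0 < s)%R) by (apply exp_lt_inv; lra).
apply Cmod_eq_0, Rle_antisym; [|apply Cmod_ge_0].
apply le_epsilon; intros e He; rewrite Rplus_0_l.
destruct (circle_int_cont G (s0 - 1) s) with (eps := e) as [d [Hd0 H]]; [|exact He|].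
{ intros x y Hx _; apply kernel_cont; eapply Rle_lt_trans; [|exact Hs].
  destruct (proj2 Hx) as [Hl|E]; [left; apply exp_increasing; exact Hl | rewrite E; lra]. }
set (h := Rmin (d / 3) (Rmin 1 (s - s0))%R).
assert (Hh : (0 < h)%R) by (repeat apply Rmin_glb_lt; lra).
assert (Hh1 : (h <= d / 3)%R) by apply Rmin_l.
assert (Hh2 : (h <= 1)%R) by (eapply Rle_trans; [apply Rmin_r | apply Rmin_l]).
assert (Hh3 : (h <= s - s0)%R) by (eapply Rle_trans; [apply Rmin_r | apply Rmin_r]).
assert (E1 : circle_int G (s0 - h) = 0).
{ apply kernel_inner.
  - eapply Rlt_trans; [apply exp_increasing | exact Hs]; lra.
  - intros s' Hs' E.
    assert (exp s' < exp s0)%R by (apply exp_increasing; lra); lra. }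
rewrite <- (kernel_strip (s0 + h) s); [|lra|exact Hs|].
- specialize (H (s0 - h)%R (s0 + h)%R ltac:(lra) ltac:(lra)).
  rewrite E1 in H.
  replace (circle_int G (s0 + h)) with (circle_int G (s0 + h) - 0) by ring.
  apply H; rewrite Rabs_right; lra.
- intros u Hu E.
  assert (exp s0 < exp u)%R by (apply exp_increasing; lra); lra.
Qed.

End Kernel.

(** The integral does not depend on the radius and tends to 0 as the radius grows. *)
Lemma circle_int_inv_pow (n : nat) (s : R) : circle_int (fun w => (/ cexp w) ^ S n) s = 0.
Proof.
assert (D : forall w, diff (fun w => (/ cexp w) ^ S n) w).
{ intros w; apply diff_pow, diff_inv; [apply diff_cexp | apply cexp_neq_0]. }
apply Cmod_eq_0, Rle_antisym; [|apply Cmod_ge_0].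
apply le_epsilon; intros e He; rewrite Rplus_0_l.
assert (P := PI_RGT_0).
assert (Q : (0 < e / (4 * PI))%R) by (apply Rdiv_lt_0_compat; lra).
set (s' := Rmax (Rmax s 0) (- ln (e / (4 * PI)))%R).
assert (S1 : (s <= s')%R) by (eapply Rle_trans; apply Rmax_l).
assert (S2 : (0 <= s')%R) by (eapply Rle_trans; [apply Rmax_r | apply Rmax_l]).
assert (S3 : (- ln (e / (4 * PI)) <= s')%R) by apply Rmax_r.
rewrite (circle_int_strip _ s s' S1).
- eapply Rle_trans; [apply (circle_int_bound _ _ (e / (4 * PI)))|].
  + intros; apply diff_cont, D.
  + intros t _; rewrite Cmod_pow, Cmod_inv, Cmod_cexp by apply cexp_neq_0; simpl Re.
    assert (L1 : (/ exp s' <= 1)%R).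
    { rewrite <- exp_Ropp, <- exp_0.
      destruct S2 as [L|E]; [left; apply exp_increasing; lra | rewrite <- E, Ropp_0; lra]. }
    assert (L2 : (/ exp s' <= e / (4 * PI))%R).
    { rewrite <- exp_Ropp, <- (exp_ln (e / (4 * PI))) by exact Q.
      destruct S3 as [L|E]; [left; apply exp_increasing; lra | rewrite <- E, Ropp_involutive; lra]. }
    assert (L0 : (0 <= / exp s')%R) by (left; apply Rinv_0_lt_compat, exp_pos).
    simpl; rewrite <- (Rmult_1_r (e / (4 * PI))).
    apply Rmult_le_compat; [exact L0 | apply pow_le; exact L0 | exact L2|].
    rewrite <- (pow1 n); apply pow_incr; lra.
  + right; field; lra.
- intros x; rewrite cexp_period; reflexivity.
- intros; apply D.
Qed.

Lemma circle_int_plus (G H : C -> C) (s : R) :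
  (forall t, (0 <= t <= 2 * PI)%R -> cont G (s, t)) ->
  (forall t, (0 <= t <= 2 * PI)%R -> cont H (s, t)) ->
  circle_int (fun w => G w + H w) s = circle_int G s + circle_int H s.
Proof.
intros HG HH; assert (P := two_PI_pos); unfold circle_int.
rewrite (CI_plus (fun t => G (s, t)) (fun t => H (s, t))); [reflexivity|lra| |];
 intros; apply contR_vertical; auto.
Qed.

Lemma circle_int_scal (c : C) (G : C -> C) (s : R) :
  (forall t, (0 <= t <= 2 * PI)%R -> cont G (s, t)) ->
  circle_int (fun w => c * G w) s = c * circle_int G s.
Proof.
intros HG; assert (P := two_PI_pos); unfold circle_int.
apply (CI_scal c (fun t => G (s, t))); [lra|]; intros; apply contR_vertical; auto.
Qed.

Lemma circle_int_ext (G H : C -> C) (s : R) :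
  (forall t, G (s, t) = H (s, t)) -> circle_int G s = circle_int H s.
Proof.
intros E; assert (P := two_PI_pos); apply CI_ext; [lra|]; intros; apply E.
Qed.

Lemma cont_csum (F : nat -> C -> C) (n : nat) (z : C) :
  (forall k, cont (F k) z) -> cont (fun w => csum (fun k => F k w) n) z.
Proof.
intros H; induction n as [|n IH]; simpl; [apply cont_const | apply cont_plus; auto].
Qed.

Lemma circle_int_csum (F : nat -> C -> C) (n : nat) (s : R) :
  (forall k t, (0 <= t <= 2 * PI)%R -> cont (F k) (s, t)) ->
  circle_int (fun w => csum (fun k => F k w) n) s = csum (fun k => circle_int (F k) s) n.
Proof.
intros H; induction n as [|n IH]; simpl.
- rewrite (circle_int_ext _ (fun _ => 0 * 1)) by (intros; ring).
  rewrite (circle_int_scal 0 (fun _ => 1)) by (intros; apply cont_const); ring.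
- rewrite (circle_int_plus (fun w => csum (fun k => F k w) n) (F n)), IH; auto.
  intros; apply cont_csum; auto.
Qed.

Lemma circle_int_one (s : R) : circle_int (fun _ => 1) s = RtoC (2 * PI).
Proof.
unfold circle_int.
transitivity (CI (fun t => 1 + 0 * RtoC t) 0 (2 * PI)).
- unfold CI; f_equal; apply RInt_ext; intros; simpl; ring.
- rewrite CI_affine; apply injective_projections; simpl; field.
Qed.

Lemma contR_bounded (g : R -> C) (a b : R) : (a <= b)%R ->
  (forall t, (a <= t <= b)%R -> contR g t) ->
  exists M, forall t, (a <= t <= b)%R -> (Cmod (g t) <= M)%R.
Proof.
intros Hab Hg.
destruct (continuity_ab_maj (fun t => Cmod (g t)) a b Hab) as [m [Hm _]].
- intros t Ht e He; destruct (Hg t Ht e He) as [d [Hd H]].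
  exists d; split; [exact Hd|]; intros s [_ Hs]; specialize (H s Hs).
  change (Rabs (Cmod (g s) - Cmod (g t)) < e)%R.
  eapply Rle_lt_trans; [|exact H].
  assert (T1 := Cmod_triangle (g t) (g s - g t)); assert (T2 := Cmod_triangle (g s) (- (g s - g t))).
  replace (g t + (g s - g t)) with (g s) in T1 by ring.
  replace (g s + - (g s - g t)) with (g t) in T2 by ring.
  rewrite Cmod_opp in T2; apply Rabs_le; lra.
- exists (Cmod (g m)); exact Hm.
Qed.

Lemma geom_csum (x : C) (N : nat) : x <> 1 ->
  csum (fun n => x ^ n) N = (1 - x ^ N) / (1 - x).
Proof.
intros Hx.
assert (D : 1 - x <> 0) by (apply Cminus_neq_0; congruence).
induction N as [|N IH]; simpl; [field; exact D | rewrite IH; field; exact D].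
Qed.

(** Cauchy's coefficient, the integral of f(z) / z^(n+1) over |z| = exp s divided by 2 pi i, after
    the substitution dz = i z dt. *)
Definition circle_coef (f : C -> C) (s : R) (n : nat) : C :=
  / RtoC (2 * PI) * circle_int (fun w => f (cexp w) * (/ cexp w) ^ n) s.

Lemma RtoC_neq_0 (x : R) : x <> 0%R -> RtoC x <> 0.
Proof. intros H E; apply H; exact (f_equal fst E). Qed.

Section CauchySeries.

Variables (f : C -> C) (rad s : R).
Hypothesis Hf : forall z, (Cmod z < rad)%R -> diff f z.
Hypothesis Hs : (exp s < rad)%R.

Lemma cont_inv_cexp_pow n w : cont (fun w => (/ cexp w) ^ n) w.
Proof. apply diff_cont, diff_pow, diff_inv; [apply diff_cexp | apply cexp_neq_0]. Qed.

Lemma cont_f_cexp t : cont (fun w => f (cexp w)) (s, t).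
Proof.
apply cont_comp; apply diff_cont; [apply diff_cexp|].
apply Hf; rewrite Cmod_cexp; exact Hs.
Qed.

Lemma circle_coef_bound M n :
  (forall z, Cmod z = exp s -> (Cmod (f z) <= M)%R) ->
  (Cmod (circle_coef f s n) * exp s ^ n <= 2 * M)%R.
Proof.
intros HM; assert (P := PI_RGT_0).
assert (E0 : (0 < exp s ^ n)%R) by (apply pow_lt, exp_pos).
unfold circle_coef; rewrite Cmod_mult, Cmod_inv, Cmod_R, Rabs_right
  by (try apply RtoC_neq_0; lra).
assert (B : (Cmod (circle_int (fun w => f (cexp w) * (/ cexp w) ^ n)%C s)
    <= 4 * PI * (M * / exp s ^ n))%R).
{ apply circle_int_bound.
  - intros t _; apply (cont_mult (fun w => f (cexp w))); [apply cont_f_cexp | apply cont_inv_cexp_pow].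
  - intros t _; rewrite Cmod_mult, Cmod_pow, Cmod_inv, Cmod_cexp by apply cexp_neq_0.
    simpl Re; rewrite pow_inv; apply Rmult_le_compat_r; [left; apply Rinv_0_lt_compat; exact E0|].
    apply HM; rewrite Cmod_cexp; reflexivity. }
apply Rle_trans with (/ (2 * PI) * (4 * PI * (M * / exp s ^ n)) * exp s ^ n)%R.
- apply Rmult_le_compat_r; [lra|]; apply Rmult_le_compat_l; [left; apply Rinv_0_lt_compat; lra | exact B].
- right; field; lra.
Qed.

(** With x = a/z and k the difference quotient of f at a, z k(z) = (f(z) - f(a)) / (1 - x). A finite
    geometric sum leaves the exact remainder x^(N+1) z k(z), so that no series is integrated
    termwise. The left side integrates to 0 by [circle_int_kernel], and of the powers of 1/z that
    multiply f(a) only the zeroth contributes. *)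
Lemma cauchy_series (a : C) : (Cmod a < exp s)%R ->
  csums (fun n => circle_coef f s n * a ^ n) (f a).
Proof.
intros Ha; assert (P := PI_RGT_0).
destruct (Hf a ltac:(lra)) as [k [Ek Hk]].
assert (Na : forall z, z <> a -> z - a <> 0) by (intros z; apply Cminus_neq_0).
assert (Kd : forall z, (Cmod z < rad)%R -> z <> a -> diff k z).
{ intros z Hz N.
  apply (diff_ext (fun w => (f w + (- f a)) * / (w + - a))).
  - exists (Cmod (z - a)); split; [apply Cmod_gt_0; auto|]; intros w Hw.
    assert (Nw : w <> a).
    { intros E; rewrite E in Hw.
      replace (a - z) with (- (z - a)) in Hw by ring; rewrite Cmod_opp in Hw; lra. }
    replace (f w + - f a) with (f w - f a) by ring; rewrite Ek.
    field; apply (Na w Nw).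
  - apply diff_mult; [apply diff_plus; [apply Hf; exact Hz | apply diff_const]|].
    apply diff_inv; [apply diff_plus; [apply diff_id | apply diff_const]|].
    apply (Na z N). }
assert (Kc : forall z, (Cmod z < rad)%R -> cont k z).
{ intros z Hz; destruct (Ceq_dec z a) as [->|N]; [exact Hk | apply diff_cont; auto]. }
assert (Z := circle_int_kernel k a rad Kc Kd s Hs ltac:(lra)).
set (G := fun w => cexp w * k (cexp w)) in *.
assert (Gc : forall t, cont G (s, t)) by (intros; apply (kernel_cont k rad Kc); exact Hs).
destruct (contR_bounded (fun t => G (s, t)) 0 (2 * PI)) as [M HM];
  [lra | intros; apply contR_vertical, Gc|].
assert (HM0 : (0 <= M)%R).
{ eapply Rle_trans; [apply Cmod_ge_0 | apply (HM 0%R); lra]. }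
set (q := (Cmod a / exp s)%R).
assert (Pe := exp_pos s).
assert (Hq : (0 <= q < 1)%R).
{ split; [apply Rmult_le_pos; [apply Cmod_ge_0 | left; apply Rinv_0_lt_compat; exact Pe]|].
  apply Rmult_lt_reg_r with (exp s); [exact Pe|]; unfold q; field_simplify; lra. }
assert (R1 : forall N, csum (fun n => circle_coef f s n * a ^ n) (S N) - f a
   = - (/ RtoC (2 * PI)) * circle_int (fun w => a ^ S N * ((/ cexp w) ^ S N * G w)) s).
{ intros N.
  set (F := fun n w => (a ^ n * (f (cexp w) * (/ cexp w) ^ n))).
  set (F1 := fun n w => (- f a * a ^ n) * (/ cexp w) ^ n).
  set (Rm := fun w => a ^ S N * ((/ cexp w) ^ S N * G w)).
  assert (CF : forall n t, (0 <= t <= 2 * PI)%R -> cont (F n) (s, t)).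
  { intros n t _; apply cont_mult; [apply cont_const|].
    apply (cont_mult (fun w => f (cexp w))); [apply cont_f_cexp | apply cont_inv_cexp_pow]. }
  assert (CF1 : forall n t, (0 <= t <= 2 * PI)%R -> cont (F1 n) (s, t)).
  { intros n t _; apply cont_mult; [apply cont_const | apply cont_inv_cexp_pow]. }
  assert (CR : forall t, (0 <= t <= 2 * PI)%R -> cont Rm (s, t)).
  { intros t _; apply cont_mult; [apply cont_const|].
    apply cont_mult; [apply cont_inv_cexp_pow | apply Gc]. }
  assert (D : circle_int G s = csum (fun n => circle_int (F n) s) (S N)
       + csum (fun n => circle_int (F1 n) s) (S N) + circle_int Rm s).
  { rewrite <- !circle_int_csum by auto.
    rewrite <- (circle_int_plus (fun w => csum (fun n => F n w) (S N)) (fun w => csum (fun n => F1 n w) (S N)))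
      by (intros; apply cont_csum; auto).
    rewrite <- (circle_int_plus (fun w => csum (fun n => F n w) (S N) + csum (fun n => F1 n w) (S N)) Rm);
      [|intros; apply cont_plus; apply cont_csum; auto | exact CR].
    apply circle_int_ext; intros t.
    set (z := cexp (s, t)).
    assert (Hz : z <> 0) by apply cexp_neq_0.
    assert (Hza : z <> a).
    { intros E; assert (T : Cmod z = exp s) by apply Cmod_cexp; rewrite E in T; lra. }
    assert (Hza' := Na z Hza).
    set (x := a * / z).
    assert (Hx : x <> 1).
    { intros E; apply Hza; replace a with (x * z) by (unfold x; field; exact Hz).
      rewrite E; ring. }
    assert (S1 : forall m, csum (fun n => F n (s, t)) m + csum (fun n => F1 n (s, t)) m
               = (f z - f a) * csum (fun n => x ^ n) m).
    { intros m; rewrite <- csum_plus, <- csum_scal; apply csum_ext; intros n _.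
      unfold F, F1, x; fold z; rewrite Cpow_mult_l; ring. }
    rewrite S1, geom_csum by exact Hx.
    unfold Rm, G; fold z; rewrite Ek.
    replace (a ^ S N * ((/ z) ^ S N * (z * k z))) with (x ^ S N * (z * k z))
      by (unfold x; rewrite Cpow_mult_l; ring).
    unfold x; field; split; auto. }
  fold G in Z; rewrite Z in D.
  assert (D1 : csum (fun n => circle_int (F1 n) s) (S N) = - f a * RtoC (2 * PI)).
  { clear - Z; induction N as [|N IH].
    - simpl; unfold F1; rewrite circle_int_scal by (intros; apply cont_inv_cexp_pow).
      rewrite (circle_int_ext _ (fun _ => 1)) by (intros; simpl; ring).
      rewrite circle_int_one; simpl; ring.
    - change (csum (fun n => circle_int (F1 n) s) (S N) + circle_int (F1 (S N)) s = - f a * RtoC (2 * PI)).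
      rewrite IH; unfold F1 at 1; rewrite circle_int_scal by (intros; apply cont_inv_cexp_pow).
      rewrite circle_int_inv_pow; ring. }
  assert (D2 : csum (fun n => circle_int (F n) s) (S N)
          = RtoC (2 * PI) * csum (fun n => circle_coef f s n * a ^ n) (S N)).
  { rewrite <- csum_scal; apply csum_ext; intros n _; unfold F, circle_coef.
    rewrite (circle_int_scal (a ^ n) (fun w => f (cexp w) * (/ cexp w) ^ n)).
    - field; apply RtoC_neq_0; lra.
    - intros t _; apply (cont_mult (fun w => f (cexp w))); [apply cont_f_cexp | apply cont_inv_cexp_pow]. }
  rewrite D1, D2 in D; fold Rm.
  set (T := csum (fun n => circle_coef f s n * a ^ n) (S N)) in *.
  assert (Hp : RtoC (2 * PI) <> 0) by (apply RtoC_neq_0; lra).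
  replace (circle_int Rm s) with (0 - (RtoC (2 * PI) * T + - f a * RtoC (2 * PI)))
    by (rewrite D; ring).
  field; exact Hp. }
assert (R2 : forall N, (Cmod (csum (fun n => circle_coef f s n * a ^ n)%C (S N) - f a)
     <= 2 * M * q ^ S N)%R).
{ intros N; rewrite R1, Cmod_mult, Cmod_opp, Cmod_inv, Cmod_R, Rabs_right
   by (try apply RtoC_neq_0; lra).
  apply Rle_trans with (/ (2 * PI) * (4 * PI * (q ^ S N * M)))%R; [|right; field; lra].
  apply Rmult_le_compat_l; [left; apply Rinv_0_lt_compat; lra|].
  apply circle_int_bound.
  - intros t _; apply cont_mult; [apply cont_const|].
    apply cont_mult; [apply cont_inv_cexp_pow | apply Gc].
  - intros t Ht; rewrite !Cmod_mult, !Cmod_pow, Cmod_inv, Cmod_cexp by apply cexp_neq_0.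
    simpl Re; rewrite <- Rmult_assoc, <- Rpow_mult_distr.
    apply Rmult_le_compat_l; [apply pow_le; apply Hq | apply HM; exact Ht]. }
intros e He.
destruct (geom_small q (2 * M) e Hq ltac:(lra) He) as [N HN].
exists (S N); intros n Hn; destruct n as [|n]; [lia|].
eapply Rle_lt_trans; [apply R2 | apply HN; lia].
Qed.

End CauchySeries.

(** * Complex series and power series *)

Lemma csums_plus (a b : nat -> C) (l m : C) :
  csums a l -> csums b m -> csums (fun n => a n + b n) (l + m).
Proof.
intros Ha Hb e He.
destruct (Ha (e / 2)%R) as [N HN]; [lra|]; destruct (Hb (e / 2)%R) as [N' HN']; [lra|].
exists (N + N')%nat; intros n Hn; rewrite csum_plus.
replace (csum a n + csum b n - (l + m)) with ((csum a n - l) + (csum b n - m)) by ring.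
eapply Rle_lt_trans; [apply Cmod_triangle|].
specialize (HN n ltac:(lia)); specialize (HN' n ltac:(lia)); lra.
Qed.

Lemma csums_scal (c : C) (a : nat -> C) (l : C) :
  csums a l -> csums (fun n => c * a n) (c * l).
Proof.
intros Ha e He.
assert (P := Cmod_ge_0 c).
destruct (Ha (e / (Cmod c + 1))%R) as [N HN]; [apply Rdiv_lt_0_compat; lra|].
exists N; intros n Hn; rewrite csum_scal.
replace (c * csum a n - c * l) with (c * (csum a n - l)) by ring.
rewrite Cmod_mult; specialize (HN n Hn).
apply Rle_lt_trans with (Cmod c * (e / (Cmod c + 1)))%R.
- apply Rmult_le_compat_l; lra.
- apply Rmult_lt_reg_r with (Cmod c + 1)%R; [lra|]; field_simplify; lra.
Qed.

Lemma csums_minus (a b : nat -> C) (l m : C) :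
  csums a l -> csums b m -> csums (fun n => a n - b n) (l - m).
Proof.
intros Ha Hb; assert (H := csums_plus _ _ _ _ Ha (csums_scal (-1) b m Hb)).
replace (l - m) with (l + -1 * m) by ring.
revert H; apply csums_ext; intros; ring.
Qed.

Lemma csum_finite (a : nat -> C) (N n : nat) : (N <= n)%nat ->
  (forall k, (N <= k)%nat -> a k = 0) -> csum a n = csum a N.
Proof.
intros Hn H; induction Hn as [|n Hn IH]; [reflexivity|]; simpl.
rewrite IH, H by exact Hn; ring.
Qed.

Lemma csums_finite (a : nat -> C) (N : nat) :
  (forall k, (N <= k)%nat -> a k = 0) -> csums a (csum a N).
Proof.
intros H e He; exists N; intros n Hn; rewrite (csum_finite a N n Hn H).
rewrite Cmod_diag; exact He.
Qed.

Lemma csums_bounded (a : nat -> C) (l : C) : csums a l ->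
  exists M, (0 < M)%R /\ forall n, (Cmod (a n) <= M)%R.
Proof.
intros H; destruct (H 1%R Rlt_0_1) as [N HN].
assert (F : exists M, (0 < M)%R /\ forall n, (n < N)%nat -> (Cmod (a n) <= M)%R).
{ clear HN; induction N as [|N [M [HM IH]]]; [exists 1%R; split; [lra | intros; lia]|].
  exists (M + Cmod (a N))%R; assert (P := Cmod_ge_0 (a N)); split; [lra|]; intros n Hn.
  destruct (Nat.eq_dec n N) as [->|]; [lra|]; specialize (IH n ltac:(lia)); lra. }
destruct F as [M [HM F]].
exists (M + 2)%R; split; [lra|]; intros n; destruct (Nat.lt_ge_cases n N) as [L|L].
- specialize (F n L); lra.
- assert (T := Cmod_triangle_minus (csum a (S n)) l (csum a n)).
  replace (csum a (S n) - csum a n) with (a n) in T by (simpl; ring).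
  rewrite (Cmod_minus_sym l) in T.
  assert (T1 := HN n L); assert (T2 := HN (S n) ltac:(lia)); lra.
Qed.

Lemma geom_tail (a : nat -> C) (K p : R) (n m : nat) : (0 <= p < 1)%R ->
  (forall k, (Cmod (a k) <= K * p ^ k)%R) ->
  (Cmod (csum a (n + m) - csum a n) <= K / (1 - p) * (p ^ n - p ^ (n + m)))%R.
Proof.
intros Hp H; induction m as [|m IH].
- rewrite Nat.add_0_r, Cmod_diag; lra.
- rewrite Nat.add_succ_r; simpl csum.
  replace (csum a (n + m) + a (n + m)%nat - csum a n)
    with ((csum a (n + m) - csum a n) + a (n + m)%nat) by ring.
  eapply Rle_trans; [apply Cmod_triangle|].
  eapply Rle_trans; [apply Rplus_le_compat; [exact IH | apply H]|].
  right; simpl; field; lra.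
Qed.

Lemma geom_csums (a : nat -> C) (K p : R) : (0 <= p < 1)%R ->
  (forall k, (Cmod (a k) <= K * p ^ k)%R) ->
  exists l, csums a l /\ forall n, (Cmod (csum a n - l) <= K / (1 - p) * p ^ n)%R.
Proof.
intros Hp H.
assert (HK : (0 <= K)%R).
{ specialize (H 0%nat); simpl in H; assert (P := Cmod_ge_0 (a 0%nat)); lra. }
assert (HK1 : (0 <= K / (1 - p))%R)
  by (apply Rmult_le_pos; [exact HK | left; apply Rinv_0_lt_compat; lra]).
assert (E : @ex_series C_AbsRing C_CompleteNormedModule a).
{ apply (@ex_series_le C_AbsRing C_CompleteNormedModule a (fun k => K * p ^ k)%R).
  - intros k; exact (H k).
  - apply (ex_series_scal (V := R_NormedModule) K); apply ex_series_geom.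
    rewrite Rabs_right; lra. }
destruct E as [l Hl]; exists l.
assert (Hl' : csums a l) by (apply csums_series; exact Hl).
split; [exact Hl'|]; intros n.
apply le_epsilon; intros e He; destruct (Hl' e He) as [N HN].
specialize (HN (n + N)%nat ltac:(lia)).
eapply Rle_trans; [apply (Cmod_triangle_minus _ (csum a (n + N)))|].
rewrite Cmod_minus_sym; assert (T := geom_tail a K p n N Hp H).
assert (0 <= p ^ (n + N))%R by (apply pow_le; lra).
nra.
Qed.

(** Bernoulli's inequality (1 + h)^n >= 1 + n h, with h such that p (1 + h) <= rho. Dividing by p +
    1 rather than by p in the choice of h admits p = 0. *)
Lemma linear_geom (p rho : R) : (0 <= p)%R -> (p < rho)%R ->
  exists K, (0 < K)%R /\ forall n : nat, (INR n * p ^ n <= K * rho ^ n)%R.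
Proof.
intros Hp Hr; set (h := ((rho - p) / (p + 1))%R).
assert (Hh : (0 < h)%R) by (apply Rdiv_lt_0_compat; lra).
exists (/ h)%R; split; [apply Rinv_0_lt_compat; exact Hh|]; intros n.
assert (B : (p * (1 + h) <= rho)%R).
{ replace (p * (1 + h))%R with (p + (rho - p) * (p / (p + 1)))%R by (unfold h; field; lra).
  assert (p / (p + 1) <= 1)%R
    by (apply Rmult_le_reg_r with (p + 1)%R; [lra|]; field_simplify; lra).
  nra. }
assert (B1 : (1 + INR n * h <= (1 + h) ^ n)%R) by (apply poly; exact Hh).
assert (B2 : (p ^ n * (1 + h) ^ n <= rho ^ n)%R).
{ rewrite <- Rpow_mult_distr; apply pow_incr; split; [nra | exact B]. }
assert (P : (0 <= p ^ n)%R) by (apply pow_le; exact Hp).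
apply Rmult_le_reg_r with h; [exact Hh|].
replace (/ h * rho ^ n * h)%R with (rho ^ n)%R by (field; lra).
apply Rle_trans with (p ^ n * (1 + INR n * h))%R; [nra|].
eapply Rle_trans; [apply Rmult_le_compat_l; [exact P | exact B1] | exact B2].
Qed.

Lemma csum_Cmod_le (a : nat -> C) (n : nat) (M : R) :
  (forall k, (k < n)%nat -> (Cmod (a k) <= M)%R) -> (Cmod (csum a n) <= INR n * M)%R.
Proof.
induction n as [|n IH]; intros H; [simpl; rewrite Cmod_0; lra|].
rewrite S_INR; simpl csum; eapply Rle_trans; [apply Cmod_triangle|].
specialize (IH (fun k Hk => H k (Nat.lt_lt_succ_r _ _ Hk))); specialize (H n ltac:(lia)); lra.
Qed.

Lemma csum_S_l (a : nat -> C) (n : nat) :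
  csum a (S n) = a 0%nat + csum (fun k => a (S k)) n.
Proof.
induction n as [|n IH]; [simpl; ring|].
change (csum a (S n) + a (S n) = a 0%nat + (csum (fun k => a (S k)) n + a (S n))).
rewrite IH; ring.
Qed.

Lemma csum_rev (a : nat -> nat -> C) (n : nat) :
  csum (fun i => a i (n - i)%nat) (S n) = csum (fun i => a (n - i)%nat i) (S n).
Proof.
assert (G : forall (b : nat -> C) m, csum b m = csum (fun k => b (m - S k)%nat) m).
{ intros b m; revert b; induction m as [|m IH]; intros b; [reflexivity|].
  rewrite (csum_S_l (fun k => b (S m - S k)%nat)).
  change (csum b m + b m = b (S m - 1)%nat + csum (fun k => b (m - S k)%nat) m).
  rewrite (IH b); replace (S m - 1)%nat with m by lia.
  ring. }
rewrite (G (fun i => a i (n - i)%nat)); apply csum_ext; intros k Hk.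
replace (S n - S k)%nat with (n - k)%nat by lia.
f_equal; lia.
Qed.

Lemma diag_csum (a : nat -> nat -> C) (N : nat) :
  csum (fun n => csum (fun i => a i (n - i)%nat) (S n)) N
  = csum (fun i => csum (a i) (N - i)) N.
Proof.
induction N as [|N IH]; [reflexivity|].
change (csum (fun n => csum (fun i => a i (n - i)%nat) (S n)) N
  + csum (fun i => a i (N - i)%nat) (S N) = csum (fun i => csum (a i) (S N - i)) (S N)).
rewrite IH.
transitivity (csum (fun i => csum (a i) (N - i) + a i (N - i)%nat) (S N)).
- rewrite csum_plus; simpl; rewrite Nat.sub_diag; simpl; ring.
- apply csum_ext; intros k Hk; replace (S N - k)%nat with (S (N - k)) by lia; reflexivity.
Qed.

(** The first n diagonals cut row i at n - i. Each of the n rows involved thereby loses a tail of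
    order p^i p^(n-i) = p^n, and n p^n tends to 0. *)
Lemma rows_diag (a : nat -> nat -> C) (K p : R) (r : nat -> C) : (0 <= p < 1)%R ->
  (forall i j, (Cmod (a i j) <= K * p ^ i * p ^ j)%R) ->
  (forall i, csums (a i) (r i)) ->
  exists l, csums r l /\ csums (fun n => csum (fun i => a i (n - i)%nat) (S n)) l.
Proof.
intros Hp H Hr.
assert (HK : (0 <= K)%R).
{ specialize (H 0%nat 0%nat); simpl in H; assert (P := Cmod_ge_0 (a 0%nat 0%nat)); lra. }
set (K1 := (K / (1 - p))%R).
assert (HK1 : (0 <= K1)%R)
  by (apply Rmult_le_pos; [exact HK | left; apply Rinv_0_lt_compat; lra]).
assert (T : forall i n, (Cmod (csum (a i) n - r i) <= K1 * p ^ i * p ^ n)%R).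
{ intros i n; destruct (geom_csums (a i) (K * p ^ i) p Hp (H i)) as [l [H1 H2]].
  rewrite (csums_unique _ _ _ (Hr i) H1); eapply Rle_trans; [apply H2|].
  unfold K1; right; field; lra. }
destruct (geom_csums r K1 p Hp) as [l [Hl _]].
{ intros i; specialize (T i 0%nat); simpl in T.
  replace (0 - r i) with (- r i) in T by ring; rewrite Cmod_opp in T; lra. }
exists l; split; [exact Hl|]; intros e He.
destruct (linear_geom p ((p + 1) / 2)) as [K2 [HK2 L]]; [lra|lra|].
destruct (Hl (e / 2)%R) as [N1 HN1]; [lra|].
destruct (geom_small ((p + 1) / 2) (K1 * K2) (e / 2)) as [N2 HN2]; [lra|nra|lra|].
exists (N1 + N2)%nat; intros n Hn.
rewrite diag_csum.
eapply Rle_lt_trans; [apply (Cmod_triangle_minus _ (csum r n))|].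
specialize (HN1 n ltac:(lia)); specialize (HN2 n ltac:(lia)).
assert (E : csum (fun i => csum (a i) (n - i)) n - csum r n
   = csum (fun i => csum (a i) (n - i) - r i) n).
{ rewrite (csum_ext (fun i => csum (a i) (n - i) - r i) (fun i => csum (a i) (n - i) + (-1) * r i))
    by (intros; ring).
  rewrite csum_plus, csum_scal; ring. }
rewrite E.
assert (B : (Cmod (csum (fun i => csum (a i) (n - i) - r i)%C n) <= INR n * (K1 * p ^ n))%R).
{ apply csum_Cmod_le; intros k Hk; eapply Rle_trans; [apply T|].
  rewrite Rmult_assoc, <- pow_add; replace (k + (n - k))%nat with n by lia; lra. }
specialize (L n).
nra.
Qed.

(** Row sums and column sums are both compared with the sum along diagonals, which is symmetric in
    the two indices. *)
Lemma double_series (a : nat -> nat -> C) (K p : R) (r c : nat -> C) : (0 <= p < 1)%R ->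
  (forall i j, (Cmod (a i j) <= K * p ^ i * p ^ j)%R) ->
  (forall i, csums (a i) (r i)) -> (forall j, csums (fun i => a i j) (c j)) ->
  exists l, csums r l /\ csums c l.
Proof.
intros Hp H Hr Hc.
destruct (rows_diag a K p r Hp H Hr) as [l [H1 H2]].
destruct (rows_diag (fun j i => a i j) K p c Hp) as [l' [H3 H4]]; [|exact Hc|].
{ intros i j; specialize (H j i); lra. }
exists l; split; [exact H1|]; replace l with l'; [exact H3|].
apply (csums_unique (fun n => csum (fun i => a i (n - i)%nat) (S n))); [|exact H2].
revert H4; apply csums_ext; intros n; symmetry; apply (csum_rev a).
Qed.

Lemma cauchy_product (a b : nat -> C) (K p : R) (l m : C) : (0 <= p < 1)%R ->
  (forall n, (Cmod (a n) <= K * p ^ n)%R) -> (forall n, (Cmod (b n) <= K * p ^ n)%R) ->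
  csums a l -> csums b m ->
  csums (fun n => csum (fun i => a i * b (n - i)%nat) (S n)) (l * m).
Proof.
intros Hp Ha Hb Hl Hm.
destruct (rows_diag (fun i j => a i * b j) (K * K) p (fun i => a i * m) Hp) as [s [H1 H2]].
- intros i j; rewrite Cmod_mult.
  replace (K * K * p ^ i * p ^ j)%R with ((K * p ^ i) * (K * p ^ j))%R by ring.
  apply Rmult_le_compat; try apply Cmod_ge_0; auto.
- intros i; apply csums_scal; exact Hm.
- replace (l * m) with s; [exact H2|].
  apply (csums_unique _ _ _ H1).
  replace (l * m) with (m * l) by ring.
  generalize (csums_scal m a l Hl); apply csums_ext; intros; ring.
Qed.

(** * Power series *)

Definition powser (a : nat -> C) (w : C) (l : C) : Prop := csums (fun n => a n * w ^ n) l.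

Lemma powser_coef_bound (a : nat -> C) (g : C -> C) (rad s : R) : (0 < s < rad)%R ->
  (forall w, (Cmod w < rad)%R -> powser a w (g w)) ->
  exists M, (0 < M)%R /\ forall n, (Cmod (a n) * s ^ n <= M)%R.
Proof.
intros Hs H.
assert (E : Cmod (RtoC s) = s) by (rewrite Cmod_R, Rabs_right; lra).
destruct (csums_bounded _ _ (H (RtoC s) ltac:(lra))) as [M [HM B]].
exists M; split; [exact HM|]; intros n; specialize (B n).
rewrite Cmod_mult, Cmod_pow, E in B; exact B.
Qed.

Lemma geom_bound_of_coef (a : nat -> C) (M s : R) (w : C) : (0 < s)%R ->
  (forall n, (Cmod (a n) * s ^ n <= M)%R) ->
  forall n, (Cmod (a n * w ^ n) <= M * (Cmod w / s) ^ n)%R.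
Proof.
intros Hs H n; rewrite Cmod_mult, Cmod_pow.
replace (Cmod (a n) * Cmod w ^ n)%R with (Cmod (a n) * s ^ n * (Cmod w / s) ^ n)%R.
- apply Rmult_le_compat_r; [|apply H].
  apply pow_le, Rmult_le_pos; [apply Cmod_ge_0 | left; apply Rinv_0_lt_compat; exact Hs].
- unfold Rdiv; rewrite Rpow_mult_distr, pow_inv; field; apply pow_nonzero; lra.
Qed.

Lemma powser_unique (a b : nat -> C) (g : C -> C) (rad : R) : (0 < rad)%R ->
  (forall w, (Cmod w < rad)%R -> powser a w (g w)) ->
  (forall w, (Cmod w < rad)%R -> powser b w (g w)) -> forall n, a n = b n.
Proof.
intros Hr Ha Hb.
set (d := fun n => a n - b n).
assert (Hd : forall w, (Cmod w < rad)%R -> powser d w 0).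
{ intros w Hw; replace (RtoC 0) with (g w - g w) by ring.
  generalize (csums_minus _ _ _ _ (Ha w Hw) (Hb w Hw)); apply csums_ext.
  intros n; unfold d; ring. }
set (s := (rad / 2)%R).
assert (Hs : (0 < s < rad)%R) by (unfold s; lra).
destruct (powser_coef_bound d (fun _ => 0) rad s Hs Hd) as [M [HM B]].
assert (Z : forall n, d n = 0).
{ intros n; induction n as [n IH] using (well_founded_induction Nat.lt_wf_0).
  apply Cmod_eq_0_eps; intros e He.
  assert (Ps : (0 < s ^ S n)%R) by (apply pow_lt; lra).
  (* When all earlier coefficients vanish, |d n| t^n is at most the tail bound 2 M (t/s)^(n+1).
     Division by t^n leaves 2 M t / s^(n+1), which this t makes at most e; t <= s/2 bounds 1 / (1 -
     t/s) by 2. *)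
  set (t := Rmin (s / 2) (e * s ^ S n / (2 * M))%R).
  assert (Ht : (0 < t)%R).
  { apply Rmin_glb_lt; [lra|]; apply Rdiv_lt_0_compat; [nra | lra]. }
  assert (Ht1 : (t <= s / 2)%R) by apply Rmin_l.
  assert (Ht2 : (t <= e * s ^ S n / (2 * M))%R) by apply Rmin_r.
  assert (Et : Cmod (RtoC t) = t) by (rewrite Cmod_R, Rabs_right; lra).
  assert (Hp : (0 <= t / s <= / 2)%R).
  { split; [apply Rmult_le_pos; [lra | left; apply Rinv_0_lt_compat; lra]|].
    apply Rmult_le_reg_r with s; [lra|]; field_simplify; lra. }
  destruct (geom_csums (fun k => d k * RtoC t ^ k) M (t / s) ltac:(lra)) as [l [H1 H2]].
  { intros k; rewrite <- Et at 2; apply geom_bound_of_coef; [lra | exact B]. }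
  rewrite (csums_unique _ _ _ H1 (Hd (RtoC t) ltac:(lra))) in H2.
  specialize (H2 (S n)); simpl csum in H2.
  rewrite (csum_ext _ (fun _ => 0 * 0)), csum_scal in H2
    by (intros k Hk; rewrite (IH k Hk); ring).
  replace (0 * csum (fun _ => 0) n + d n * RtoC t ^ n - 0) with (d n * RtoC t ^ n) in H2 by ring.
  rewrite Cmod_mult, Cmod_pow, Et in H2.
  assert (Pt : (0 < t ^ n)%R) by (apply pow_lt; exact Ht).
  apply Rmult_le_reg_r with (t ^ n)%R; [exact Pt|].
  eapply Rle_trans; [exact H2|].
  apply Rle_trans with (2 * M * (t / s) ^ S n)%R.
  - apply Rmult_le_compat_r; [apply pow_le; lra|].
    unfold Rdiv; rewrite (Rmult_comm 2 M); apply Rmult_le_compat_l; [lra|].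
    rewrite <- (Rinv_inv 2); apply Rinv_le_contravar; lra.
  - unfold Rdiv; rewrite Rpow_mult_distr, pow_inv.
    replace (t ^ S n)%R with (t * t ^ n)%R by reflexivity.
    apply Rle_trans with (2 * M * ((e * s ^ S n / (2 * M)) * t ^ n * / s ^ S n))%R.
    + apply Rmult_le_compat_l; [lra|]; apply Rmult_le_compat_r; [left; apply Rinv_0_lt_compat; exact Ps|].
      apply Rmult_le_compat_r; lra.
    + right; field; split; lra. }
intros n; specialize (Z n); unfold d in Z.
replace (a n) with (a n - b n + b n) by ring; rewrite Z; ring.
Qed.

(** The Cauchy coefficients for different radii agree by uniqueness, so that one sequence serves the
    whole disc and satisfies Cauchy's estimate on each of its circles. The factor 2 is inherited
    from [CI_bound]. *)
Lemma disc_powser (f : C -> C) (rad : R) : (0 < rad)%R ->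
  (forall z, (Cmod z < rad)%R -> diff f z) ->
  exists a : nat -> C, (forall z, (Cmod z < rad)%R -> powser a z (f z)) /\
    forall r M, (0 < r < rad)%R -> (forall z, Cmod z = r -> (Cmod (f z) <= M)%R) ->
      forall n, (Cmod (a n) * r ^ n <= 2 * M)%R.
Proof.
intros Hr Hf.
assert (Q : forall r, (0 < r < rad)%R -> exp (ln r) = r) by (intros; apply exp_ln; lra).
assert (S1 : forall r, (0 < r < rad)%R ->
   forall z, (Cmod z < r)%R -> powser (circle_coef f (ln r)) z (f z)).
{ intros r H z Hz; apply (cauchy_series f rad); rewrite ?Q; auto; lra. }
set (r0 := (rad / 2)%R).
assert (H0 : (0 < r0 < rad)%R) by (unfold r0; lra).
assert (U : forall r, (0 < r < rad)%R -> forall n, circle_coef f (ln r) n = circle_coef f (ln r0) n).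
{ intros r H; apply (powser_unique _ _ f (Rmin r r0)); [apply Rmin_glb_lt; lra| |];
   intros w Hw; apply S1; auto; eapply Rlt_le_trans; try exact Hw; [apply Rmin_l | apply Rmin_r]. }
exists (circle_coef f (ln r0)); split.
- intros z Hz; set (r := ((Cmod z + rad) / 2)%R).
  assert (P := Cmod_ge_0 z).
  assert (H : (0 < r < rad)%R) by (unfold r; lra).
  generalize (S1 r H z ltac:(unfold r; lra)); apply csums_ext; intros n.
  rewrite (U r H); reflexivity.
- intros r M H HM n; rewrite <- (U r H).
  assert (B := circle_coef_bound f rad (ln r) Hf); rewrite (Q r H) in B.
  apply B; [lra | exact HM].
Qed.

Lemma csums_shift (a : nat -> C) (l : C) : csums a l -> csums (fun n => a (S n)) (l - a 0%nat).
Proof.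
intros H e He; destruct (H e He) as [N HN]; exists N; intros n Hn.
specialize (HN (S n) ltac:(lia)); rewrite csum_S_l in HN.
replace (csum (fun k => a (S k)) n - (l - a 0%nat)) with (a 0%nat + csum (fun k => a (S k)) n - l)
  by ring; exact HN.
Qed.

(** The derivative n z^(n-1) in a recursive form that avoids the predecessor of n. *)
Fixpoint dpow (z : C) (n : nat) : C :=
  match n with O => 0 | S m => z * dpow z m + z ^ m end.

Lemma dpow_bound (z : C) (s : R) (n : nat) : (Cmod z <= s)%R ->
  (Cmod (dpow z n) * s <= INR n * s ^ n)%R.
Proof.
intros Hz; assert (P := Cmod_ge_0 z); induction n as [|n IH]; [simpl; rewrite Cmod_0; lra|].
rewrite S_INR; simpl dpow; simpl pow.
assert (T := Cmod_triangle (z * dpow z n) (z ^ n)).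
rewrite Cmod_mult, Cmod_pow in T.
assert (Q := Cmod_ge_0 (dpow z n)).
assert (Pw : (Cmod z ^ n <= s ^ n)%R) by (apply pow_incr; lra).
apply Rle_trans with ((Cmod z * Cmod (dpow z n) + Cmod z ^ n) * s)%R;
  [apply Rmult_le_compat_r; lra|].
assert (Cmod z * (Cmod (dpow z n) * s) <= s * (INR n * s ^ n))%R
  by (apply Rmult_le_compat; nra).
nra.
Qed.

(** The remainder of order two is at most n^2 s^(n-2) |w - z|^2; the factor s^2 on the left keeps
    the exponent n - 2 out. Summed against the coefficients it gives differentiability of a power
    series. *)
Lemma taylor_pow_bound (z w : C) (s : R) (n : nat) : (0 < s)%R -> (Cmod z <= s)%R -> (Cmod w <= s)%R ->
  (Cmod (w ^ n - z ^ n - dpow z n * (w - z)) * s ^ 2 <= INR n ^ 2 * s ^ n * Cmod (w - z) ^ 2)%R.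
Proof.
intros Hs Hz Hw; induction n as [|n IH].
- simpl; replace (1 - 1 - 0 * (w - z)) with (RtoC 0) by ring; rewrite Cmod_0; lra.
- simpl dpow; rewrite S_INR.
  replace (w ^ S n - z ^ S n - (z * dpow z n + z ^ n) * (w - z))
    with (w * (w ^ n - z ^ n - dpow z n * (w - z)) + dpow z n * (w - z) ^ 2)
    by (simpl; ring).
  set (X := w ^ n - z ^ n - dpow z n * (w - z)) in *.
  assert (T := Cmod_triangle (w * X) (dpow z n * (w - z) ^ 2)).
  rewrite !Cmod_mult, Cmod_pow in T.
  set (h := Cmod (w - z)) in *.
  assert (Ph : (0 <= h ^ 2)%R) by apply pow2_ge_0.
  assert (Ps : (0 < s ^ n)%R) by (apply pow_lt; exact Hs).
  assert (D := dpow_bound z s n Hz).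
  assert (PX := Cmod_ge_0 X); assert (PD := Cmod_ge_0 (dpow z n)); assert (Pw := Cmod_ge_0 w).
  assert (Pn := pos_INR n).
  apply Rle_trans with ((Cmod w * Cmod X + Cmod (dpow z n) * h ^ 2) * s ^ 2)%R;
    [apply Rmult_le_compat_r; [apply pow2_ge_0 | exact T]|].
  assert (A1 : (Cmod w * (Cmod X * s ^ 2) <= s * (INR n ^ 2 * s ^ n * h ^ 2))%R).
  { apply Rmult_le_compat; try assumption; apply Rmult_le_pos; [exact PX | apply pow2_ge_0]. }
  assert (A2 : (Cmod (dpow z n) * s * (h ^ 2 * s) <= INR n * s ^ n * (h ^ 2 * s))%R).
  { apply Rmult_le_compat_r; [|exact D]; apply Rmult_le_pos; lra. }
  assert (A3 : (0 <= s ^ n * (h ^ 2 * s))%R) by (apply Rmult_le_pos; [lra | apply Rmult_le_pos; lra]).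
  assert (A4 : (0 <= (INR n + 1) * (s ^ n * (h ^ 2 * s)))%R) by (apply Rmult_le_pos; lra).
  change (s ^ S n)%R with (s * s ^ n)%R; lra.
Qed.

Lemma square_geom (p rho : R) : (0 <= p)%R -> (p < rho)%R ->
  exists K, (0 < K)%R /\ forall n : nat, (INR n ^ 2 * p ^ n <= K * rho ^ n)%R.
Proof.
intros Hp Hr.
destruct (linear_geom p ((p + rho) / 2)) as [K1 [H1 L1]]; [lra|lra|].
destruct (linear_geom ((p + rho) / 2) rho) as [K2 [H2 L2]]; [lra|lra|].
exists (K1 * K2)%R; split; [nra|]; intros n; specialize (L1 n); specialize (L2 n).
assert (P := pos_INR n).
apply Rle_trans with (INR n * (K1 * ((p + rho) / 2) ^ n))%R; [nra|].
apply Rle_trans with (K1 * (K2 * rho ^ n))%R; [nra | lra].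
Qed.

Lemma powser_diff (a : nat -> C) (g : C -> C) (rad : R) :
  (forall w, (Cmod w < rad)%R -> powser a w (g w)) ->
  forall z, (Cmod z < rad)%R -> diff g z.
Proof.
intros Ha z Hz; assert (Pz := Cmod_ge_0 z).
(* The points z and w stay within s, while the coefficients are bounded at the larger radius s'; the
   ratio s/s' < 1 absorbs the factor n^2. *)
set (s := ((Cmod z + rad) / 2)%R); set (s' := ((s + rad) / 2)%R).
assert (Hs : (Cmod z < s < rad)%R) by (unfold s; lra).
assert (Hs' : (0 < s < s' /\ s' < rad)%R) by (unfold s'; lra).
destruct (powser_coef_bound a g rad s' ltac:(lra) Ha) as [M [HM B]].
set (p := (s / s')%R).
assert (Hp : (0 < p < 1)%R).
{ unfold p; split; [apply Rdiv_lt_0_compat; lra|].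
  apply Rmult_lt_reg_r with s'; [lra|]; field_simplify; lra. }
destruct (square_geom p ((p + 1) / 2)) as [K [HK L]]; [lra|lra|].
set (rho := ((p + 1) / 2)%R) in *.
assert (Hrho : (0 <= rho < 1)%R) by (unfold rho; lra).
assert (Bn : forall n, (Cmod (a n) * (INR n ^ 2 * s ^ n) <= M * K * rho ^ n)%R).
{ intros n; replace (s ^ n)%R with (s' ^ n * p ^ n)%R
    by (rewrite <- Rpow_mult_distr; f_equal; unfold p; field; lra).
  replace (Cmod (a n) * (INR n ^ 2 * (s' ^ n * p ^ n)))%R
    with (Cmod (a n) * s' ^ n * (INR n ^ 2 * p ^ n))%R by ring.
  rewrite (Rmult_assoc M); apply Rmult_le_compat; auto.
  - apply Rmult_le_pos; [apply Cmod_ge_0 | apply pow_le; lra].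
  - apply Rmult_le_pos; [apply pow2_ge_0 | apply pow_le; lra]. }
destruct (geom_csums (fun n => a n * dpow z n) (M * K / s) rho Hrho) as [l [Hl _]].
{ intros n; rewrite Cmod_mult; assert (D := dpow_bound z s n ltac:(lra)).
  apply Rmult_le_reg_r with s; [lra|].
  replace (M * K / s * rho ^ n * s)%R with (M * K * rho ^ n)%R by (field; lra).
  eapply Rle_trans; [|apply Bn]; rewrite Rmult_assoc.
  apply Rmult_le_compat_l; [apply Cmod_ge_0|].
  eapply Rle_trans; [exact D|]; apply Rmult_le_compat_r; [apply pow_le; lra|].
  destruct n as [|n]; [simpl; lra|].
  assert (1 <= INR (S n))%R by (rewrite S_INR; assert (T := pos_INR n); lra); nra. }
set (K2 := (M * K / s ^ 2 / (1 - rho))%R).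
assert (Q : forall w, (Cmod w < s)%R -> (Cmod (g w - g z - l * (w - z)) <= K2 * Cmod (w - z) ^ 2)%R).
{ intros w Hw.
  assert (S0 : csums (fun n => a n * (w ^ n - z ^ n - dpow z n * (w - z))) (g w - g z - (w - z) * l)).
  { generalize (csums_minus _ _ _ _ (csums_minus _ _ _ _ (Ha w ltac:(lra)) (Ha z ltac:(lra)))
       (csums_scal (w - z) _ _ Hl)).
    apply csums_ext; intros; ring. }
  destruct (geom_csums (fun n => a n * (w ^ n - z ^ n - dpow z n * (w - z)))
     (M * K / s ^ 2 * Cmod (w - z) ^ 2) rho Hrho) as [l' [Hl' T]].
  { intros n; rewrite Cmod_mult; assert (D := taylor_pow_bound z w s n ltac:(lra) ltac:(lra) ltac:(lra)).
    assert (Ps2 : (0 < s ^ 2)%R) by (apply pow_lt; lra).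
    apply Rmult_le_reg_r with (s ^ 2)%R; [exact Ps2|].
    replace (M * K / s ^ 2 * Cmod (w - z) ^ 2 * rho ^ n * s ^ 2)%R
      with (M * K * rho ^ n * Cmod (w - z) ^ 2)%R by (field; lra).
    rewrite Rmult_assoc.
    apply Rle_trans with (Cmod (a n) * (INR n ^ 2 * s ^ n * Cmod (w - z) ^ 2))%R.
    - apply Rmult_le_compat_l; [apply Cmod_ge_0 | exact D].
    - replace (Cmod (a n) * (INR n ^ 2 * s ^ n * Cmod (w - z) ^ 2))%R
        with (Cmod (a n) * (INR n ^ 2 * s ^ n) * Cmod (w - z) ^ 2)%R by ring.
      apply Rmult_le_compat_r; [apply pow2_ge_0 | apply Bn]. }
  rewrite (csums_unique _ _ _ Hl' S0) in T; specialize (T 0%nat); simpl csum in T.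
  replace (0 - (g w - g z - (w - z) * l)) with (- (g w - g z - l * (w - z))) in T by ring.
  rewrite Cmod_opp in T; eapply Rle_trans; [exact T|].
  right; unfold K2; simpl; field; lra. }
assert (HK2 : (0 < K2)%R).
{ unfold K2; apply Rdiv_lt_0_compat; [|lra]; apply Rdiv_lt_0_compat; [nra | apply pow_lt; lra]. }
apply (diff_intro g z l); intros e He.
exists (Rmin (s - Cmod z) (e / K2))%R; split.
{ apply Rmin_glb_lt; [lra|]; apply Rdiv_lt_0_compat; lra. }
intros w Hw.
assert (W1 : (Cmod (w - z) < s - Cmod z)%R) by (eapply Rlt_le_trans; [exact Hw | apply Rmin_l]).
assert (W2 : (Cmod (w - z) < e / K2)%R) by (eapply Rlt_le_trans; [exact Hw | apply Rmin_r]).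
eapply Rle_trans; [apply Q|].
- assert (T := Cmod_triangle (w - z) z); replace (w - z + z) with w in T by ring; lra.
- assert (P := Cmod_ge_0 (w - z)).
  replace e with (K2 * (e / K2))%R by (field; lra).
  simpl; rewrite Rmult_1_r, <- Rmult_assoc; apply Rmult_le_compat_r; [exact P|].
  apply Rmult_le_compat_l; lra.
Qed.

Lemma pow_n_Cpow (w : C) (n : nat) : @pow_n C_Ring w n = w ^ n.
Proof. induction n as [|n IH]; [reflexivity|]; simpl; rewrite IH; reflexivity. Qed.

Lemma powser_is_pseries (a : nat -> C) (w l : C) :
  powser a w l <-> @is_pseries C_AbsRing C_NormedModule a w l.
Proof.
assert (E : forall n, @scal C_AbsRing C_NormedModule (@pow_n C_Ring w n) (a n) = a n * w ^ n).
{ intros n; transitivity (@pow_n C_Ring w n * a n); [reflexivity|].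
  replace (@pow_n C_Ring w n) with (w ^ n) by (symmetry; apply pow_n_Cpow); apply Cmult_comm. }
unfold is_pseries; rewrite <- csums_series.
split; apply csums_ext; intros n; rewrite E; reflexivity.
Qed.

Lemma taylor_coef_eq (g : C -> C) (a : nat -> C) (rad : R) : (0 < rad)%R ->
  (forall w, (Cmod w < rad)%R -> powser a w (g w)) -> forall n, taylor_coef g n = a n.
Proof.
intros Hr Ha.
assert (E : exists r : R, (0 < r)%R /\ forall w : C, (Cmod w < r)%R ->
         @is_pseries C_AbsRing C_NormedModule (taylor_coef g) w (g w)).
{ apply (epsilon_spec (inhabits (fun _ : nat => RtoC 0))
    (fun a => exists r : R, (0 < r)%R /\ forall w : C, (Cmod w < r)%R ->
         @is_pseries C_AbsRing C_NormedModule a w (g w))).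
  exists a, rad; split; [exact Hr|]; intros w Hw; apply powser_is_pseries; auto. }
destruct E as [r [H0 H]].
apply (powser_unique _ _ g (Rmin r rad)); [apply Rmin_glb_lt; assumption| |].
- intros w Hw; apply powser_is_pseries, H; eapply Rlt_le_trans; [exact Hw | apply Rmin_l].
- intros w Hw; apply Ha; eapply Rlt_le_trans; [exact Hw | apply Rmin_r].
Qed.

(** * The Askey-Wilson operator on orbits *)

Lemma joukowski_inj (z w : C) : z <> 0 -> w <> 0 -> joukowski z = joukowski w ->
  w = z \/ w = / z.
Proof.
intros Hz Hw E; unfold joukowski in E.
assert (H : (w - z) * (w - / z) = 0).
{ assert (E2 : z + / z = w + / w).
  { replace (z + / z) with (2 * ((z + / z) / 2)) by (field; exact Hz).
    rewrite E; field; exact Hw. }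
  replace ((w - z) * (w - / z)) with (w * (w - (z + / z)) + 1) by (field; exact Hz).
  rewrite E2; field; exact Hw. }
destruct (Ceq_dec (w - z) 0) as [E1|N].
- left; replace w with (w - z + z) by ring; rewrite E1; ring.
- right; assert (E1 : w - / z = 0).
  { replace (w - / z) with (/ (w - z) * ((w - z) * (w - / z))) by (field; auto).
    rewrite H; ring. }
  replace w with (w - / z + / z) by ring; rewrite E1; ring.
Qed.

Lemma expitheta_joukowski (z : C) : z <> 0 ->
  expitheta (joukowski z) = z \/ expitheta (joukowski z) = / z.
Proof.
intros Hz; destruct (expitheta_spec (joukowski z)) as [H1 H2].
apply joukowski_inj; auto.
Qed.

Lemma Cinv_neq_0 (z : C) : z <> 0 -> / z <> 0.
Proof.
intros Hz E; assert (H : z * / z = 1) by (field; exact Hz).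
rewrite E, Cmult_0_r in H; apply (f_equal fst) in H; simpl in H; lra.
Qed.

Lemma Rpower_half_sqr (q : R) : (0 < q)%R -> (Rpower q (1/2) * Rpower q (1/2) = q)%R.
Proof.
intros Hq; rewrite <- Rpower_plus; replace (1/2 + 1/2)%R with 1%R by field.
apply Rpower_1; exact Hq.
Qed.

Lemma Rpower_half_lt (q : R) : (0 < q < 1)%R -> (0 < Rpower q (1/2) < 1)%R.
Proof.
intros Hq; assert (P : (0 < Rpower q (1/2))%R) by apply exp_pos.
assert (E := Rpower_half_sqr q ltac:(lra)); split; [exact P|]; nra.
Qed.

(** [expitheta] returns either z or 1/z; passing from one to the other changes the sign of numerator
    and denominator alike. The condition on z*z excludes x = 1, -1, where [AW] is a limit. *)
Lemma AW_joukowski (q : R) (f : C -> C) (z : C) : (0 < q < 1)%R -> z <> 0 -> z * z <> 1 ->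
  AW q f (joukowski z) =
  2 / (RtoC (Rpower q (1/2) - / Rpower q (1/2)) * (z - / z))
  * (f (joukowski (RtoC (Rpower q (1/2)) * z)) - f (joukowski (/ RtoC (Rpower q (1/2)) * z))).
Proof.
intros Hq Hz Hz1.
assert (Hp := Rpower_half_lt q Hq).
set (p := Rpower q (1/2)) in *.
assert (HP : RtoC p <> 0) by (apply RtoC_neq_0; lra).
assert (Em : RtoC (Rpower q (-1/2)) = / RtoC p).
{ replace (-1/2)%R with (- (1/2))%R by field; rewrite Rpower_Ropp; fold p.
  apply RtoC_inv; lra. }
assert (Em' : Rpower q (-1/2) = (/ p)%R).
{ replace (-1/2)%R with (- (1/2))%R by field; apply Rpower_Ropp. }
assert (HD : RtoC (p - / p) <> 0).
{ apply RtoC_neq_0; intros E; assert (H : (p * p = 1)%R); [|nra].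
  replace (p * p)%R with (p * (p - / p) + 1)%R by (field; lra); rewrite E; ring. }
assert (Hs : z - / z <> 0).
{ intros E; apply Hz1; replace (z * z) with (z * (z - / z) + 1) by (field; exact Hz).
  rewrite E; ring. }
assert (Hi : Ci <> 0) by (intros E; apply (f_equal snd) in E; simpl in E; lra).
assert (S2 : 2 * Ci <> 0).
{ apply Cmult_neq_0; [apply RtoC_neq_0; lra | exact Hi]. }
assert (Hst : sintheta (expitheta (joukowski z)) <> 0).
{ unfold sintheta; intros E.
  assert (E1 : expitheta (joukowski z) - / expitheta (joukowski z) = 0).
  { replace (expitheta (joukowski z) - / expitheta (joukowski z)) with
     (2 * Ci * ((expitheta (joukowski z) - / expitheta (joukowski z)) / (2 * Ci)));
     [rewrite E; ring|]. generalize (expitheta (joukowski z) - / expitheta (joukowski z)).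
    intros c; field; exact Hi. }
  destruct (expitheta_joukowski z Hz) as [E2|E2]; rewrite E2 in E1.
  - auto.
  - apply Hs; replace (z - / z) with (- (/ z - / / z)) by (field; exact Hz); rewrite E1; ring. }
unfold AW; destruct (Ceq_dec (sintheta (expitheta (joukowski z))) 0) as [E|_]; [contradiction|].
unfold AW_quotient; rewrite Em, Em'; fold p.
assert (H1 : z * z - 1 <> 0) by (intros E; apply Hz1, Ceq_minus, E).
assert (H2 : 1 - z * z <> 0) by (intros E; apply Hz1; symmetry; apply Ceq_minus, E).
unfold breve.
destruct (expitheta_joukowski z Hz) as [E2|E2]; rewrite E2; unfold sintheta.
- field; repeat split; auto.
- replace (joukowski (RtoC p * / z)) with (joukowski (/ RtoC p * z))
    by (unfold joukowski; field; auto).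
  replace (joukowski (/ RtoC p * / z)) with (joukowski (RtoC p * z))
    by (unfold joukowski; field; auto).
  generalize (f (joukowski (RtoC p * z))) (f (joukowski (/ RtoC p * z))); intros u v.
  field; repeat split; auto.
Qed.

(** On such a set no iterate of [AW] meets the points x = 1, -1, so that every iterate is a finite
    combination of values of f on the set and commutes with pointwise convergent series. *)
Definition orbit_closed (q : R) (S : C -> Prop) : Prop :=
  forall z, S z -> z <> 0 /\ z * z <> 1 /\
    S (RtoC (Rpower q (1/2)) * z) /\ S (/ RtoC (Rpower q (1/2)) * z).

Section Orbit.

Variables (q : R) (S : C -> Prop).
Hypotheses (Hq : (0 < q < 1)%R) (HS : orbit_closed q S).

Lemma AW_iter_S n f : AW_iter q (Datatypes.S n) f = AW q (AW_iter q n f).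
Proof. reflexivity. Qed.

Lemma AW_ext_orbit f g : (forall z, S z -> f (joukowski z) = g (joukowski z)) ->
  forall z, S z -> AW q f (joukowski z) = AW q g (joukowski z).
Proof.
intros E z Hz; destruct (HS z Hz) as [H1 [H2 [H3 H4]]].
rewrite !AW_joukowski, !E by assumption; reflexivity.
Qed.

Lemma AW_scal_orbit c f z : S z ->
  AW q (fun x => c * f x) (joukowski z) = c * AW q f (joukowski z).
Proof.
intros Hz; destruct (HS z Hz) as [H1 [H2 [H3 H4]]].
rewrite !AW_joukowski by assumption; ring.
Qed.

Lemma AW_iter_scal_orbit n c f z : S z ->
  AW_iter q n (fun x => c * f x) (joukowski z) = c * AW_iter q n f (joukowski z).
Proof.
revert z; induction n as [|n IH]; intros z Hz; [reflexivity|].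
rewrite !AW_iter_S, <- AW_scal_orbit by exact Hz.
apply AW_ext_orbit; [exact IH | exact Hz].
Qed.

Lemma AW_iter_csums_orbit (a : nat -> C -> C) (f : C -> C) n :
  (forall z, S z -> csums (fun k => a k (joukowski z)) (f (joukowski z))) ->
  forall z, S z -> csums (fun k => AW_iter q n (a k) (joukowski z)) (AW_iter q n f (joukowski z)).
Proof.
intros H; induction n as [|n IH]; intros z Hz; [apply H; exact Hz|].
rewrite AW_iter_S.
destruct (HS z Hz) as [H1 [H2 [H3 H4]]].
rewrite AW_joukowski by assumption.
generalize (csums_scal (2 / (RtoC (Rpower q (1 / 2) - / Rpower q (1 / 2)) * (z - / z)))
  _ _ (csums_minus _ _ _ _ (IH _ H3) (IH _ H4))).
apply csums_ext; intros k; rewrite AW_iter_S, AW_joukowski by assumption; reflexivity.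
Qed.

End Orbit.

(** * The polynomials rho_n and their q-derivatives *)

Lemma qpoch_S_l (a : C) (Q : R) (n : nat) :
  qpoch a Q (S n) = (1 - a) * qpoch (a * RtoC Q) Q n.
Proof.
induction n as [|n IH]; [simpl; ring|].
change (qpoch a Q (S n) * (1 - a * RtoC (Q ^ S n))
  = (1 - a) * (qpoch (a * RtoC Q) Q n * (1 - a * RtoC Q * RtoC (Q ^ n)))).
rewrite IH; replace (RtoC (Q ^ S n)) with (RtoC Q * RtoC (Q ^ n)) by (rewrite <- RtoC_mult; reflexivity).
ring.
Qed.

Fixpoint rho_poly (q : R) (x : C) (n : nat) : C :=
  match n with
  | O => 1
  | S O => 2 * x
  | S (S m) => (4 * x ^ 2 + RtoC (q ^ m + / q ^ m - 2)) * rho_poly q x m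
  end.

Lemma two_step_ind (P : nat -> Prop) : P 0%nat -> P 1%nat ->
  (forall n, P n -> P (S (S n))) -> forall n, P n.
Proof.
intros H0 H1 H n; assert (P n /\ P (S n)) as [H2 _]; [|exact H2].
induction n as [|n [IH1 IH2]]; split; auto.
Qed.

(** [rho] for an explicit z in place of [expitheta x], with the real power q^(2-n) written as a
    quotient of integer powers for the sake of [field]. *)
Definition rho_z (q : R) (n : nat) (z : C) : C :=
  match n with
  | O => 1
  | S m => (1 + z ^ 2) * qpoch (- (RtoC (q ^ 2 / q ^ n) * z ^ 2)) (q ^ 2) m / z ^ n
  end.

Lemma Cpow_neq_0 (z : C) (n : nat) : z <> 0 -> z ^ n <> 0.
Proof.
intros Hz; induction n as [|n IH]; simpl; [apply RtoC_neq_0; lra | apply Cmult_neq_0; auto].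
Qed.

(** From n to n + 2 the q-product gains one factor at each end, and z^(-2) (1 + q^n z^2) (1 + q^(-n)
    z^2) = 4 x^2 + q^n + q^(-n) - 2. *)
Lemma rho_z_poly (q : R) (z : C) (n : nat) : (0 < q)%R -> z <> 0 ->
  rho_z q n z = rho_poly q (joukowski z) n.
Proof.
intros Hq Hz; assert (Hq0 : RtoC q <> 0) by (apply RtoC_neq_0; lra).
induction n as [| |n IH] using two_step_ind.
- reflexivity.
- simpl; unfold joukowski; field; exact Hz.
- change (rho_poly q (joukowski z) (S (S n))) with
   ((4 * joukowski z ^ 2 + RtoC (q ^ n + / q ^ n - 2)) * rho_poly q (joukowski z) n).
  rewrite <- IH.
  assert (Hqn : (0 < q ^ n)%R) by (apply pow_lt; exact Hq).
  assert (Hqn0 : RtoC (q ^ n) <> 0) by (apply RtoC_neq_0; lra).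
  assert (Hzn := Cpow_neq_0 z n Hz).
  assert (E0 : RtoC (q ^ 2 / q ^ S (S n)) = / RtoC (q ^ n)).
  { rewrite <- RtoC_inv by lra; f_equal; simpl; field; lra. }
  assert (E1 : RtoC (q ^ n + / q ^ n - 2) = RtoC (q ^ n) + / RtoC (q ^ n) - 2).
  { rewrite RtoC_minus, RtoC_plus, RtoC_inv by lra; reflexivity. }
  unfold rho_z; rewrite E0, E1; unfold joukowski.
  destruct n as [|m].
  + simpl qpoch; simpl pow; simpl Cpow; field; auto.
  + rewrite qpoch_S_l.
    change (qpoch (- (/ RtoC (q ^ S m) * z ^ 2) * RtoC (q ^ 2)) (q ^ 2) (S m)) with
     (qpoch (- (/ RtoC (q ^ S m) * z ^ 2) * RtoC (q ^ 2)) (q ^ 2) m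
      * (1 - (- (/ RtoC (q ^ S m) * z ^ 2) * RtoC (q ^ 2)) * RtoC ((q ^ 2) ^ m))).
    replace (- (/ RtoC (q ^ S m) * z ^ 2) * RtoC (q ^ 2))
      with (- (RtoC (q ^ 2 / q ^ S m) * z ^ 2))
      by (unfold Rdiv; rewrite RtoC_mult, RtoC_inv by (apply pow_nonzero; lra); field; auto).
    generalize (qpoch (- (RtoC (q ^ 2 / q ^ S m) * z ^ 2)) (q ^ 2) m); intros X.
    replace (RtoC (q ^ 2 / q ^ S m)) with (RtoC q / RtoC (q ^ m)).
    2:{ unfold Rdiv; rewrite RtoC_mult, RtoC_inv by (apply pow_nonzero; lra); simpl pow.
        rewrite !RtoC_mult; field; split; auto; apply RtoC_neq_0.
        apply pow_nonzero; lra. }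
    replace (RtoC ((q ^ 2) ^ m)) with (RtoC (q ^ m) * RtoC (q ^ m))
      by (rewrite <- pow_mult, <- RtoC_mult, <- pow_add; do 2 f_equal; lia).
    replace (RtoC (q ^ S m)) with (RtoC q * RtoC (q ^ m)) by (rewrite <- RtoC_mult; reflexivity).
    assert (Hm : RtoC (q ^ m) <> 0) by (apply RtoC_neq_0, pow_nonzero; lra).
    assert (Hzm := Cpow_neq_0 z m Hz).
    simpl Cpow; field; auto.
Qed.

Lemma rho_rho_poly (q : R) (n : nat) (x : C) : (0 < q)%R -> rho q n x = rho_poly q x n.
Proof.
intros Hq; destruct (expitheta_spec x) as [H1 H2].
rewrite <- H2 at 2; rewrite <- rho_z_poly by assumption.
destruct n as [|m]; [reflexivity|].
unfold rho, rho_z.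
replace (Rpower q (2 - INR (S m))) with (q ^ 2 / q ^ S m)%R; [reflexivity|].
unfold Rminus; rewrite Rpower_plus, Rpower_Ropp, Rpower_pow by exact Hq.
replace 2%R with (INR 2) by (simpl; ring); rewrite Rpower_pow by exact Hq; reflexivity.
Qed.

Lemma rho_joukowski (q : R) (n : nat) (z : C) : (0 < q)%R -> z <> 0 ->
  rho q n (joukowski z) = rho_z q n z.
Proof. intros Hq Hz; rewrite rho_rho_poly, rho_z_poly by assumption; reflexivity. Qed.

Lemma qpoch_S_r (a : C) (Q : R) (n : nat) :
  qpoch a Q (S n) = qpoch a Q n * (1 - a * RtoC (Q ^ n)).
Proof. reflexivity. Qed.

Fixpoint qfact (q : R) (n : nat) : R :=
  match n with O => 1%R | S m => (qfact q m * (1 - q ^ S m))%R end.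

Lemma qpoch_qfact (q : R) (n : nat) : qpoch (RtoC q) q n = RtoC (qfact q n).
Proof.
induction n as [|n IH]; [reflexivity|].
simpl qpoch; simpl qfact; rewrite IH, RtoC_mult, RtoC_minus, RtoC_mult; reflexivity.
Qed.

Lemma pow_lt_1 (q : R) (n : nat) : (0 < q < 1)%R -> (0 < q ^ S n < 1)%R.
Proof.
intros Hq; induction n as [|n IH]; [simpl; lra|].
change (0 < q * q ^ S n < 1)%R; nra.
Qed.

Lemma qfact_pos (q : R) (n : nat) : (0 < q < 1)%R -> (0 < qfact q n)%R.
Proof.
intros Hq; induction n as [|n IH]; [simpl; lra|].
assert (H := pow_lt_1 q n Hq).
change (0 < qfact q n * (1 - q ^ S n))%R; nra.
Qed.

Definition qexp_coef (q : R) (n : nat) : R := (Rpower q (INR n ^ 2 / 4) / qfact q n)%R.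

Lemma qexp_coef_S (q : R) (n : nat) : (0 < q < 1)%R ->
  qexp_coef q (S n) = (qexp_coef q n * (Rpower q (1/4) * Rpower q (1/2) ^ n) / (1 - q ^ S n))%R.
Proof.
intros Hq; unfold qexp_coef; rewrite S_INR.
replace ((INR n + 1) ^ 2 / 4)%R with (INR n ^ 2 / 4 + (1 / 4 + INR n * (1 / 2)))%R by field.
rewrite !Rpower_plus.
replace (Rpower q (INR n * (1 / 2))) with (Rpower q (1 / 2) ^ n)%R.
2:{ rewrite <- Rpower_pow by apply exp_pos; rewrite Rpower_mult; f_equal; ring. }
assert (H := pow_lt_1 q n Hq); assert (F := qfact_pos q n Hq).
change (qfact q (S n)) with (qfact q n * (1 - q ^ S n))%R.
field; lra.
Qed.

Lemma qexp_coef_pos (q : R) (n : nat) : (0 < q < 1)%R -> (0 < qexp_coef q n)%R.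
Proof. intros Hq; apply Rdiv_lt_0_compat; [apply exp_pos | apply qfact_pos; exact Hq]. Qed.

Lemma half_pow_sqr (q : R) (n : nat) : (0 < q)%R ->
  (Rpower q (1/2) ^ n * Rpower q (1/2) ^ n = q ^ n)%R.
Proof. intros Hq; rewrite <- Rpow_mult_distr, Rpower_half_sqr by exact Hq; reflexivity. Qed.

(** The shifts of z by q^(1/2) and q^(-1/2) turn the q-product of rho_(n+1) into that of rho_n times
    one extra factor, at the right and at the left end respectively. The common product X can then
    be factored out of the difference. *)
Lemma AW_rho (q : R) (n : nat) (z : C) : (0 < q < 1)%R -> z <> 0 -> z * z <> 1 ->
  AW q (rho q (S n)) (joukowski z) =
  RtoC (2 * (1 - q ^ S n) / (Rpower q (1/2) ^ n * (1 - q))) * rho q n (joukowski z).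
Proof.
intros Hq Hz Hz1.
assert (Hp := Rpower_half_lt q Hq).
assert (Ep := Rpower_half_sqr q ltac:(lra)).
rewrite AW_joukowski by assumption.
set (p := Rpower q (1/2)) in *.
assert (HP : RtoC p <> 0) by (apply RtoC_neq_0; lra).
rewrite !rho_joukowski by
  (lra || exact Hz || (apply Cmult_neq_0; [|exact Hz]; first [exact HP | apply Cinv_neq_0; exact HP])).
assert (Hz2 : z * z - 1 <> 0) by (intros E; apply Hz1, Ceq_minus, E).
assert (HP2 : RtoC p * RtoC p - 1 <> 0).
{ rewrite <- RtoC_mult, <- RtoC_minus; apply RtoC_neq_0; nra. }
assert (HP3 : 1 - RtoC p * RtoC p <> 0).
{ rewrite <- RtoC_mult, <- RtoC_minus; apply RtoC_neq_0; nra. }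
rewrite RtoC_minus, RtoC_inv by lra.
rewrite <- Ep.
destruct n as [|m].
- simpl; replace (RtoC (2 * (1 - p * p * 1) / (1 * (1 - p * p)))) with (RtoC 2)
    by (f_equal; field; nra).
  field; auto.
- set (u := (p ^ m)%R).
  assert (Hu : (0 < u)%R) by (apply pow_lt; lra).
  assert (HU : RtoC u <> 0) by (apply RtoC_neq_0; lra).
  assert (Em : (forall k, (p * p) ^ k = p ^ k * p ^ k)%R) by (intros; apply Rpow_mult_distr).
  unfold rho_z.
  set (X := qpoch (- (RtoC ((p * p) ^ 2 / (p * p) ^ S m) * z ^ 2)) ((p * p) ^ 2) m).
  assert (E1 : qpoch (- (RtoC ((p * p) ^ 2 / (p * p) ^ S (S m)) * (RtoC p * z) ^ 2)) ((p * p) ^ 2) (S m)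
     = X * (1 + RtoC (p * p * u * u) * z ^ 2)).
  { rewrite qpoch_S_r.
    replace (RtoC ((p * p) ^ 2 / (p * p) ^ S (S m)) * (RtoC p * z) ^ 2)
      with (RtoC ((p * p) ^ 2 / (p * p) ^ S m) * z ^ 2).
    2:{ replace ((RtoC p * z) ^ 2) with (RtoC (p * p) * z ^ 2) by (rewrite RtoC_mult; simpl Cpow; ring).
        rewrite Cmult_assoc, <- RtoC_mult; do 2 f_equal; simpl; field.
        repeat split; try (apply pow_nonzero); nra. }
    fold X; f_equal.
    replace (- (RtoC ((p * p) ^ 2 / (p * p) ^ S m) * z ^ 2) * RtoC (((p * p) ^ 2) ^ m))
     with (- (RtoC ((p * p) ^ 2 / (p * p) ^ S m * ((p * p) ^ 2) ^ m) * z ^ 2))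
     by (rewrite RtoC_mult; ring).
    replace ((p * p) ^ 2 / (p * p) ^ S m * ((p * p) ^ 2) ^ m)%R with (p * p * u * u)%R; [ring|].
    rewrite <- (pow_mult (p * p)), Nat.mul_comm, (pow_mult (p * p) m 2).
    change ((p * p) ^ S m)%R with (p * p * (p * p) ^ m)%R; rewrite (Em m); fold u.
    field; lra. }
  assert (E2 : qpoch (- (RtoC ((p * p) ^ 2 / (p * p) ^ S (S m)) * (/ RtoC p * z) ^ 2)) ((p * p) ^ 2) (S m)
     = (1 + RtoC (/ (p * p * u * u)) * z ^ 2) * X).
  { rewrite qpoch_S_l.
    assert (E3 : RtoC ((p * p) ^ 2 / (p * p) ^ S (S m)) * (/ RtoC p * z) ^ 2
      = RtoC (/ (p * p * u * u)) * z ^ 2).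
    { replace ((/ RtoC p * z) ^ 2) with (RtoC (/ (p * p)) * z ^ 2)
        by (rewrite RtoC_inv, RtoC_mult by nra; simpl Cpow; field; auto).
      rewrite Cmult_assoc, <- RtoC_mult; do 2 f_equal.
      change ((p * p) ^ S (S m))%R with (p * p * (p * p * (p * p) ^ m))%R; rewrite (Em m); fold u.
      simpl; field; lra. }
    rewrite E3; f_equal; [ring|].
    unfold X; f_equal.
    replace (- (RtoC (/ (p * p * u * u)) * z ^ 2) * RtoC ((p * p) ^ 2))
      with (- (RtoC (/ (p * p * u * u) * (p * p) ^ 2) * z ^ 2)) by (rewrite RtoC_mult; ring).
    do 3 f_equal.
    change ((p * p) ^ S m)%R with (p * p * (p * p) ^ m)%R; rewrite (Em m); fold u; field; lra. }
  rewrite E1, E2.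
  change ((p * p) ^ S (S m))%R with (p * p * (p * p * (p * p) ^ m))%R; rewrite (Em m); fold u.
  change (p ^ S m)%R with (p * u)%R.
  assert (H4 : RtoC (1 - p * p) <> 0) by (apply RtoC_neq_0; nra).
  unfold Rdiv; rewrite !RtoC_mult, !RtoC_inv by (repeat apply Rmult_integral_contrapositive_currified; nra).
  rewrite !RtoC_mult, !RtoC_minus, !RtoC_mult.
  assert (Hzm := Cpow_neq_0 z m Hz).
  change ((RtoC p * z) ^ S (S m)) with (RtoC p * z * (RtoC p * z * (RtoC p * z) ^ m)).
  change ((/ RtoC p * z) ^ S (S m)) with (/ RtoC p * z * (/ RtoC p * z * (/ RtoC p * z) ^ m)).
  change (z ^ S m) with (z * z ^ m).
  rewrite !Cpow_mult_l.
  replace ((/ RtoC p) ^ m) with (/ RtoC u)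
    by (rewrite <- !RtoC_inv, <- RtoC_pow, pow_inv by lra; reflexivity).
  replace (RtoC p ^ m) with (RtoC u) by (unfold u; apply RtoC_pow).
  clearbody X u; clear E1 E2.
  simpl Cpow; field; repeat split; auto.
Qed.

(** * Appell families *)

Definition vfun (q : R) (n : nat) (x : C) : C := RtoC (qexp_coef q n) * rho q n x.

Definition phi (q : R) (n : nat) (z : C) : C :=
  qpoch (- Ci * z * RtoC (Rpower q ((1 - INR n) / 2))) q n
  * qpoch (- Ci * / z * RtoC (Rpower q ((1 - INR n) / 2))) q n.

(* The coefficient of alpha^n in the series that defines the q-exponential function. *)
Definition ufun (q : R) (n : nat) (x : C) : C :=
  (- Ci) ^ n * RtoC (qexp_coef q n) * phi q n (expitheta x).

Lemma phi_inv (q : R) (n : nat) (z : C) : z <> 0 -> phi q n (/ z) = phi q n z.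
Proof.
intros Hz; unfold phi; replace (/ / z) with z by (field; exact Hz); ring.
Qed.

Lemma phi_joukowski (q : R) (n : nat) (z : C) : z <> 0 ->
  phi q n (expitheta (joukowski z)) = phi q n z.
Proof.
intros Hz; destruct (expitheta_joukowski z Hz) as [E|E]; rewrite E;
  [reflexivity | apply phi_inv; exact Hz].
Qed.

Lemma phi_shift (q : R) (n : nat) : (0 < q)%R ->
  Rpower q ((1 - INR n) / 2) = (Rpower q (1/2) / Rpower q (1/2) ^ n)%R.
Proof.
intros Hq; rewrite <- Rpower_pow by apply exp_pos; rewrite Rpower_mult.
unfold Rdiv at 2; rewrite <- Rpower_Ropp, <- Rpower_plus; f_equal; field.
Qed.

(** The mechanism of [AW_rho], now with a product in z and one in 1/z that gain their extra factors
    at opposite ends. The factor i is compensated by (-i)^n in [ufun]. *)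
Lemma AW_phi (q : R) (n : nat) (z : C) : (0 < q < 1)%R -> z <> 0 -> z * z <> 1 ->
  AW q (fun x => phi q (S n) (expitheta x)) (joukowski z) =
  Ci * RtoC (2 * (1 - q ^ S n) / (Rpower q (1/2) ^ n * (1 - q))) * phi q n z.
Proof.
intros Hq Hz Hz1.
assert (Hp := Rpower_half_lt q Hq).
assert (Ep := Rpower_half_sqr q ltac:(lra)).
assert (HP0 : RtoC (Rpower q (1/2)) <> 0) by (apply RtoC_neq_0; lra).
rewrite AW_joukowski by assumption.
rewrite !phi_joukowski by
  ((apply Cmult_neq_0; [|exact Hz]; first [exact HP0 | apply Cinv_neq_0; exact HP0])).
unfold phi; rewrite !phi_shift by lra.
set (p := Rpower q (1/2)) in *.
assert (HP : RtoC p <> 0) by exact HP0.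
assert (Hz2 : z * z - 1 <> 0) by (intros E; apply Hz1, Ceq_minus, E).
set (u := (p ^ n)%R).
assert (Hu : (0 < u)%R) by (apply pow_lt; lra).
assert (HU : RtoC u <> 0) by (apply RtoC_neq_0; lra).
assert (Eq : (q ^ n = u * u)%R) by (unfold u; rewrite <- Rpow_mult_distr, Ep; reflexivity).
change (p ^ S n)%R with (p * u)%R.
assert (E1 : RtoC (p / (p * u)) = / RtoC u)
  by (rewrite <- RtoC_inv by lra; f_equal; field; lra).
assert (E2 : RtoC (p / u) = RtoC p / RtoC u) by (apply RtoC_div; lra).
assert (Eqp : RtoC q = RtoC p * RtoC p) by (rewrite <- RtoC_mult, Ep; reflexivity).
assert (Eqn : RtoC (q ^ n) = RtoC u * RtoC u) by (rewrite <- RtoC_mult, Eq; reflexivity).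
rewrite E1, E2.
set (X := qpoch (- Ci * z * (RtoC p / RtoC u)) q n).
set (Y := qpoch (- Ci * / z * (RtoC p / RtoC u)) q n).
replace (qpoch (- Ci * (RtoC p * z) * / RtoC u) q (S n))
  with (X * (1 + Ci * z * RtoC p * RtoC u)).
2:{ rewrite qpoch_S_r, Eqn.
    replace (- Ci * (RtoC p * z) * / RtoC u) with (- Ci * z * (RtoC p / RtoC u)) by (field; auto).
    fold X; field; auto. }
replace (qpoch (- Ci * / (RtoC p * z) * / RtoC u) q (S n))
  with ((1 + Ci * / z * / RtoC p * / RtoC u) * Y).
2:{ rewrite qpoch_S_l, Eqp; unfold Y.
    replace (- Ci * / (RtoC p * z) * / RtoC u * (RtoC p * RtoC p))
      with (- Ci * / z * (RtoC p / RtoC u)) by (field; auto).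
    f_equal; field; auto. }
replace (qpoch (- Ci * (/ RtoC p * z) * / RtoC u) q (S n))
  with ((1 + Ci * z * / RtoC p * / RtoC u) * X).
2:{ rewrite qpoch_S_l, Eqp; unfold X.
    replace (- Ci * (/ RtoC p * z) * / RtoC u * (RtoC p * RtoC p))
      with (- Ci * z * (RtoC p / RtoC u)) by (field; auto).
    f_equal; field; auto. }
replace (qpoch (- Ci * / (/ RtoC p * z) * / RtoC u) q (S n))
  with (Y * (1 + Ci * / z * RtoC p * RtoC u)).
2:{ rewrite qpoch_S_r, Eqn.
    replace (- Ci * / (/ RtoC p * z) * / RtoC u) with (- Ci * / z * (RtoC p / RtoC u)) by (field; auto).
    fold Y; field; auto. }
change (q ^ S n)%R with (q * q ^ n)%R; rewrite Eq.
assert (HP2 : RtoC p * RtoC p - 1 <> 0).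
{ rewrite <- RtoC_mult, <- RtoC_minus; apply RtoC_neq_0; nra. }
assert (HP3 : 1 - RtoC p * RtoC p <> 0).
{ rewrite <- RtoC_mult, <- RtoC_minus; apply RtoC_neq_0; nra. }
rewrite RtoC_div by (apply Rmult_integral_contrapositive_currified; lra).
rewrite !RtoC_mult, !RtoC_minus, RtoC_inv, !RtoC_mult, Eqp by lra.
clearbody X Y; field; repeat split; auto.
Qed.

Section Appell.

Variables (q : R) (S : C -> Prop).
Hypotheses (Hq : (0 < q < 1)%R) (HS : orbit_closed q S).

(** The rule of an Appell sequence with D_q in place of the derivative. The families [vfun] and
    [ufun] both obey it, which makes the expansion of the second in the first a convolution, see
    [ufun_expansion]. *)
Definition appell (F : nat -> C -> C) : Prop :=
  forall z, S z -> AW q (F 0%nat) (joukowski z) = 0 /\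
  forall n, AW q (F (Datatypes.S n)) (joukowski z) = RtoC (gamma q) * F n (joukowski z).

Lemma gamma_coef n : (qexp_coef q (Datatypes.S n)
    * (2 * (1 - q ^ Datatypes.S n) / (Rpower q (1/2) ^ n * (1 - q))))%R
  = (gamma q * qexp_coef q n)%R.
Proof.
rewrite qexp_coef_S by exact Hq; unfold gamma.
assert (H := pow_lt_1 q n Hq).
assert (P : (0 < Rpower q (1/2) ^ n)%R) by (apply pow_lt, exp_pos).
field; lra.
Qed.

Lemma AW_const (c z : C) : S z -> AW q (fun _ => c) (joukowski z) = 0.
Proof.
intros Hz; destruct (HS z Hz) as [H1 [H2 _]].
rewrite AW_joukowski by assumption; ring.
Qed.

Lemma appell_vfun : appell (vfun q).
Proof.
intros z Hz; destruct (HS z Hz) as [H1 [H2 _]]; split.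
- unfold vfun; simpl; apply (AW_const (RtoC (qexp_coef q 0) * 1)); exact Hz.
- intros n; unfold vfun; rewrite (AW_scal_orbit q S Hq HS) by exact Hz.
  rewrite AW_rho by assumption.
  rewrite !Cmult_assoc, <- !RtoC_mult; f_equal; f_equal; apply gamma_coef.
Qed.

Lemma appell_ufun : appell (ufun q).
Proof.
intros z Hz; destruct (HS z Hz) as [H1 [H2 _]]; split.
- unfold ufun, phi; simpl; apply (AW_const (1 * RtoC (qexp_coef q 0) * (1 * 1))); exact Hz.
- intros n; unfold ufun; rewrite (AW_scal_orbit q S Hq HS) by exact Hz.
  rewrite AW_phi, phi_joukowski by assumption.
  transitivity ((- Ci * Ci) * (- Ci) ^ n * (RtoC (qexp_coef q (Datatypes.S n)) *
     RtoC (2 * (1 - q ^ Datatypes.S n) / (Rpower q (1/2) ^ n * (1 - q)))) * phi q n z).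
  + simpl Cpow; ring.
  + rewrite <- RtoC_mult, gamma_coef, RtoC_mult.
    replace (- Ci * Ci) with (RtoC 1) by (apply injective_projections; simpl; ring); ring.
Qed.

Lemma AW_iter_appell F k : appell F -> forall n z, S z ->
  AW_iter q k (F n) (joukowski z)
  = if (k <=? n)%nat then RtoC (gamma q) ^ k * F (n - k)%nat (joukowski z) else 0.
Proof.
intros HF; induction k as [|k IH]; intros n z Hz.
- simpl; rewrite Nat.sub_0_r; ring.
- rewrite AW_iter_S.
  destruct (Nat.leb_spec (Datatypes.S k) n) as [L|L].
  + rewrite (AW_ext_orbit q S Hq HS _ (fun x => RtoC (gamma q) ^ k * F (n - k)%nat x)).
    * rewrite (AW_scal_orbit q S Hq HS) by exact Hz.
      replace (n - k)%nat with (Datatypes.S (n - Datatypes.S k)) by lia.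
      rewrite (proj2 (HF z Hz)); simpl Cpow; ring.
    * intros w Hw; rewrite IH by exact Hw.
      destruct (Nat.leb_spec k n); [reflexivity | lia].
    * exact Hz.
  + destruct (Nat.eq_dec n k) as [->|N].
    * rewrite (AW_ext_orbit q S Hq HS _ (fun x => RtoC (gamma q) ^ k * F 0%nat x)).
      -- rewrite (AW_scal_orbit q S Hq HS), (proj1 (HF z Hz)) by exact Hz; ring.
      -- intros w Hw; rewrite IH, Nat.leb_refl, Nat.sub_diag by exact Hw; reflexivity.
      -- exact Hz.
    * rewrite (AW_ext_orbit q S Hq HS _ (fun _ => 0)).
      -- apply AW_const; exact Hz.
      -- intros w Hw; rewrite IH by exact Hw.
         destruct (Nat.leb_spec k n); [lia | reflexivity].
      -- exact Hz.
Qed.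

Lemma gamma_pos : (0 < gamma q)%R.
Proof. apply Rdiv_lt_0_compat; [|lra]; apply Rmult_lt_0_compat; [lra | apply exp_pos]. Qed.

(** Up to gamma^n, the operator D_q^n shifts the coefficients of a series in the v_k by n places. It
    is used at 0, where only v_0 survives, and at eta. *)
Lemma AW_iter_vseries (b : nat -> C) f n :
  (forall z, S z -> csums (fun k => b k * vfun q k (joukowski z)) (f (joukowski z))) ->
  forall z, S z ->
  csums (fun k => b (n + k)%nat * vfun q k (joukowski z))
    (/ RtoC (gamma q) ^ n * AW_iter q n f (joukowski z)).
Proof.
intros H z Hz.
assert (Hg : RtoC (gamma q) ^ n <> 0) by (apply Cpow_neq_0, RtoC_neq_0; assert (T := gamma_pos); lra).
assert (A := AW_iter_csums_orbit q S Hq HS (fun k x => b k * vfun q k x) f n H z Hz).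
assert (A2 := csums_scal (/ RtoC (gamma q) ^ n) _ _ A).
assert (A3 : csums (fun k => if (n <=? k)%nat then b k * vfun q (k - n) (joukowski z) else 0)
   (/ RtoC (gamma q) ^ n * AW_iter q n f (joukowski z))).
{ revert A2; apply csums_ext; intros k.
  rewrite (AW_iter_scal_orbit q S Hq HS) by exact Hz.
  rewrite (AW_iter_appell (vfun q) n appell_vfun) by exact Hz.
  destruct (n <=? k)%nat; [field; exact Hg | ring]. }
clear A A2; revert A3; generalize (/ RtoC (gamma q) ^ n * AW_iter q n f (joukowski z)).
intros l A e He; destruct (A e He) as [N HN]; exists N; intros m Hm.
specialize (HN (n + m)%nat ltac:(lia)).
replace (csum (fun k => b (n + k)%nat * vfun q k (joukowski z)) m) with
  (csum (fun k => if (n <=? k)%nat then b k * vfun q (k - n) (joukowski z) else 0) (n + m));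
  [exact HN|].
clear; induction m as [|m IH].
- rewrite Nat.add_0_r; simpl.
  rewrite (csum_ext _ (fun _ => 0 * 0)), csum_scal; [ring|].
  intros k Hk; destruct (Nat.leb_spec n k); [lia | ring].
- rewrite Nat.add_succ_r; simpl; rewrite IH.
  destruct (Nat.leb_spec n (n + m)); [|lia].
  replace (n + m - n)%nat with m by lia; reflexivity.
Qed.

End Appell.

(** * Expansion of monomials *)

(* [- node q k] is the square of the zero that rho_(k+2) has in addition to those of rho_k. *)
Definition node (q : R) (k : nat) : R := ((q ^ k + / q ^ k - 2) / 4)%R.

(* The coefficient of rho_k in x^m, from x^2 rho_k = rho_(k+2) / 4 - node q k * rho_k. *)
Fixpoint mono_coef (q : R) (m k : nat) : R :=
  match m with
  | O => match k with O => 1%R | _ => 0%R end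
  | S O => match k with S O => (/ 2)%R | _ => 0%R end
  | S (S m') =>
      (match k with S (S k') => mono_coef q m' k' / 4 | _ => 0 end - node q k * mono_coef q m' k)%R
  end.

Lemma mono_coef_0 (q : R) (m : nat) : forall k, (m < k)%nat -> mono_coef q m k = 0%R.
Proof.
induction m as [| |m IH] using two_step_ind; intros k Hk.
- destruct k; [lia | reflexivity].
- destruct k as [|[|k]]; [lia | lia | reflexivity].
- destruct k as [|[|k]]; [lia | lia |].
  change (mono_coef q m k / 4 - node q (S (S k)) * mono_coef q m (S (S k)) = 0)%R.
  rewrite !IH by lia; field.
Qed.

Lemma rho_poly_SS (q : R) (x : C) (k : nat) :
  rho_poly q x (S (S k)) = 4 * (x ^ 2 + RtoC (node q k)) * rho_poly q x k.
Proof.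
change (rho_poly q x (S (S k))) with
  ((4 * x ^ 2 + RtoC (q ^ k + / q ^ k - 2)) * rho_poly q x k).
replace (q ^ k + / q ^ k - 2)%R with (4 * node q k)%R by (unfold node; lra).
rewrite RtoC_mult; ring.
Qed.

Lemma csum_minus (a b : nat -> C) (n : nat) :
  csum (fun k => a k - b k) n = csum a n - csum b n.
Proof. induction n as [|n IH]; simpl; [ring | rewrite IH; ring]. Qed.

Lemma mono_expansion (q : R) (x : C) (m : nat) : forall N, (m < N)%nat ->
  csum (fun k => RtoC (mono_coef q m k) * rho_poly q x k) N = x ^ m.
Proof.
induction m as [| |m IH] using two_step_ind; intros N HN.
- rewrite (csum_finite _ 1 N HN); [simpl; ring|].
  intros k Hk; rewrite mono_coef_0 by lia; ring.
- rewrite (csum_finite _ 2 N HN); [simpl|].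
  + replace (RtoC (/ 2)) with (/ 2) by (symmetry; apply RtoC_inv; lra); field.
  + intros k Hk; rewrite mono_coef_0 by lia; ring.
- rewrite (csum_finite _ (S (S (S m))) N HN)
    by (intros k Hk; rewrite mono_coef_0 by lia; ring).
  rewrite (csum_ext _ (fun k =>
     RtoC (match k with S (S k') => mono_coef q m k' / 4 | _ => 0 end)%R * rho_poly q x k
     - RtoC (node q k * mono_coef q m k) * rho_poly q x k)).
  2:{ intros k _; destruct k as [|[|k]];
      [change (mono_coef q (S (S m)) 0) with (0 - node q 0 * mono_coef q m 0)%R
      |change (mono_coef q (S (S m)) 1) with (0 - node q 1 * mono_coef q m 1)%R
      |change (mono_coef q (S (S m)) (S (S k))) with
        (mono_coef q m k / 4 - node q (S (S k)) * mono_coef q m (S (S k)))%R];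
      rewrite RtoC_minus; ring. }
  rewrite csum_minus.
  assert (F : csum (fun k => RtoC (match k with S (S k') => mono_coef q m k' / 4 | _ => 0 end)%R
         * rho_poly q x k) (S (S (S m)))
     = csum (fun k => x ^ 2 * (RtoC (mono_coef q m k) * rho_poly q x k)
              + RtoC (node q k * mono_coef q m k) * rho_poly q x k) (S m)).
  { rewrite csum_S_l, csum_S_l.
    rewrite (csum_ext _ (fun k => x ^ 2 * (RtoC (mono_coef q m k) * rho_poly q x k)
              + RtoC (node q k * mono_coef q m k) * rho_poly q x k)); [ring|].
    intros k _; rewrite rho_poly_SS, RtoC_div, RtoC_mult by lra; field. }
  rewrite F; change (x ^ S (S m)) with (x * (x * x ^ m)); rewrite <- (IH (S m)) by lia.
  rewrite csum_plus, csum_scal.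
  assert (E : csum (fun k => RtoC (node q k * mono_coef q m k) * rho_poly q x k) (S m)
    = csum (fun k => RtoC (node q k * mono_coef q m k) * rho_poly q x k) (S (S (S m)))).
  { symmetry; apply csum_finite; [lia|]; intros k Hk.
    rewrite mono_coef_0 by lia; rewrite Rmult_0_r; ring. }
  rewrite E; simpl Cpow; ring.
Qed.

Lemma node_bounds (q : R) (k : nat) : (0 < q < 1)%R -> (0 <= node q k <= / q ^ k / 4)%R.
Proof.
intros Hq; assert (P : (0 < q ^ k)%R) by (apply pow_lt; lra).
assert (P1 : (q ^ k <= 1)%R) by (rewrite <- (pow1 k); apply pow_incr; lra).
unfold node; split; [|lra].
assert (E : (q ^ k + / q ^ k - 2 = (1 - q ^ k) ^ 2 * / q ^ k)%R) by (field; lra).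
rewrite E; assert (0 <= (1 - q ^ k) ^ 2)%R by apply pow2_ge_0.
assert (0 < / q ^ k)%R by (apply Rinv_0_lt_compat; exact P).
nra.
Qed.

(** If |c(m,k)| <= r^m B_k is to be propagated by the recursion of [mono_coef], one needs B_(k-2) /
    4 + node_k B_k <= r^2 B_k. This is the solution with equality. *)
Fixpoint mono_bound (q r : R) (k : nat) : R :=
  match k with
  | O => 1%R
  | S O => (/ (2 * r))%R
  | S (S k') => (mono_bound q r k' / (4 * (r ^ 2 - node q k)))%R
  end.

Lemma mono_bound_pos (q r : R) (k : nat) : (0 < r)%R ->
  (forall j, (j <= k)%nat -> (node q j < r ^ 2)%R) -> (0 < mono_bound q r k)%R.
Proof.
intros Hr; induction k as [| |k IH] using two_step_ind; intros H.
- simpl; lra.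
- simpl; apply Rinv_0_lt_compat; lra.
- change (0 < mono_bound q r k / (4 * (r ^ 2 - node q (S (S k)))))%R.
  specialize (H (S (S k)) (Nat.le_refl _)) as H1.
  apply Rdiv_lt_0_compat; [apply IH; intros; apply H; lia | lra].
Qed.

(** The radius r may be any number beyond the nodes up to k. As the bound holds for all m at once, r
    can later be adapted to k. *)
Lemma mono_coef_bound (q r : R) (m : nat) : (0 < q < 1)%R -> (0 < r)%R ->
  forall k, (forall j, (j <= k)%nat -> (node q j < r ^ 2)%R) ->
  (Rabs (mono_coef q m k) <= r ^ m * mono_bound q r k)%R.
Proof.
intros Hq Hr; induction m as [| |m IH] using two_step_ind; intros k H;
  assert (P := mono_bound_pos q r k Hr H).
- destruct k; simpl; [rewrite Rabs_R1; lra | rewrite Rabs_R0].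
  change (0 <= 1 * mono_bound q r (S k))%R; lra.
- destruct k as [|[|k]].
  + simpl; rewrite Rabs_R0; lra.
  + simpl; rewrite Rabs_right by lra; right; field; lra.
  + change (Rabs 0 <= r ^ 1 * mono_bound q r (S (S k)))%R; rewrite Rabs_R0.
    simpl pow; nra.
- assert (Pm : (0 < r ^ m)%R) by (apply pow_lt; exact Hr).
  assert (N := node_bounds q k Hq); assert (N1 := H k (Nat.le_refl k)).
  assert (I := IH k H).
  assert (I2 : (node q k * Rabs (mono_coef q m k) <= node q k * (r ^ m * mono_bound q r k))%R)
    by (apply Rmult_le_compat_l; lra).
  change (r ^ S (S m))%R with (r * (r * r ^ m))%R.
  assert (Q : (0 < r ^ m * mono_bound q r k)%R) by (apply Rmult_lt_0_compat; assumption).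
  assert (G : forall u, (Rabs (u - node q k * mono_coef q m k)
     <= Rabs u + node q k * Rabs (mono_coef q m k))%R).
  { intros u; unfold Rminus; eapply Rle_trans; [apply Rabs_triang|].
    rewrite Rabs_Ropp, Rabs_mult, (Rabs_right (node q k)) by lra; lra. }
  destruct k as [|[|k]].
  + change (Rabs (0 - node q 0 * mono_coef q m 0) <= r * (r * r ^ m) * mono_bound q r 0)%R.
    eapply Rle_trans; [apply G|]; rewrite Rabs_R0; nra.
  + change (Rabs (0 - node q 1 * mono_coef q m 1) <= r * (r * r ^ m) * mono_bound q r 1)%R.
    eapply Rle_trans; [apply G|]; rewrite Rabs_R0; nra.
  + change (Rabs (mono_coef q m k / 4 - node q (S (S k)) * mono_coef q m (S (S k)))
      <= r * (r * r ^ m) * mono_bound q r (S (S k)))%R.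
    eapply Rle_trans; [apply G|].
    assert (I3 := IH k ltac:(intros; apply H; lia)).
    assert (E : (mono_bound q r k / 4 = mono_bound q r (S (S k)) * (r ^ 2 - node q (S (S k))))%R).
    { change (mono_bound q r (S (S k))) with (mono_bound q r k / (4 * (r ^ 2 - node q (S (S k)))))%R.
      field; lra. }
    unfold Rdiv; rewrite Rabs_mult, (Rabs_right (/ 4)) by lra.
    apply Rle_trans with (r ^ m * (mono_bound q r k / 4)
       + node q (S (S k)) * (r ^ m * mono_bound q r (S (S k))))%R; [lra|].
    rewrite E; right; simpl; ring.
Qed.

(** * The Newton series *)

Lemma exp_le_compat (x y : R) : (x <= y)%R -> (exp x <= exp y)%R.
Proof. intros [L | ->]; [left; apply exp_increasing; exact L | lra]. Qed.

Lemma exp_ge_1 (x : R) : (0 <= x)%R -> (1 <= exp x)%R.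
Proof. intros H; rewrite <- exp_0; apply exp_le_compat; exact H. Qed.

(* q^(-(k+1)/2) / 2, just beyond the zeros of rho_(k+2), whose moduli are less than q^(-k/2) / 2. *)
Definition mono_radius (q : R) (k : nat) : R := (/ (2 * Rpower q (1/2) ^ S k))%R.

Lemma mono_radius_sqr (q : R) (k : nat) : (0 < q)%R ->
  (mono_radius q k ^ 2 = / (4 * q ^ S k))%R.
Proof.
intros Hq; unfold mono_radius; rewrite <- (half_pow_sqr q (S k) Hq).
assert (P : (0 < Rpower q (1/2) ^ S k)%R) by (apply pow_lt, exp_pos).
set (u := (Rpower q (1/2) ^ S k)%R) in *; field; lra.
Qed.

Lemma pow_le_anti (q : R) (i j : nat) : (0 < q < 1)%R -> (i <= j)%nat -> (q ^ j <= q ^ i)%R.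
Proof.
intros Hq H; replace j with (i + (j - i))%nat by lia; rewrite pow_add.
assert (P : (0 < q ^ i)%R) by (apply pow_lt; lra).
assert (P1 : (q ^ (j - i) <= 1)%R) by (rewrite <- (pow1 (j - i)); apply pow_incr; lra).
nra.
Qed.

Lemma node_lt_radius (q : R) (k j : nat) : (0 < q < 1)%R -> (j <= k)%nat ->
  (node q j < mono_radius q k ^ 2)%R.
Proof.
intros Hq H; rewrite mono_radius_sqr by lra.
assert (N := node_bounds q j Hq).
assert (P := pow_le_anti q j k Hq H).
assert (Pk : (0 < q ^ k)%R) by (apply pow_lt; lra).
assert (Pj : (0 < q ^ j)%R) by (apply pow_lt; lra).
apply Rle_lt_trans with (/ (4 * q ^ j))%R.
- eapply Rle_trans; [apply N | right; field; lra].
- apply Rinv_lt_contravar.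
  + assert (0 < q ^ S k)%R by (apply pow_lt; lra); nra.
  + change (q ^ S k)%R with (q * q ^ k)%R; nra.
Qed.

Section RhoBound.

Variables (q : R) (x : C).
Hypothesis Hq : (0 < q < 1)%R.

Let p := Rpower q (1/2).
Let X := (Cmod x ^ 2)%R.
Let A := (4 * X / (1 - q))%R.
Let B := (q / ((1 - q) * (1 - q ^ 2)))%R.
(** Covers both starting values, 1 for rho_0 and 2 |x| for rho_1; in the latter case the power of q
    in the bound below equals q^(1/4). *)
Let D := (1 + 2 * Cmod x * Rpower q (-1/4))%R.

(* The exponents with A and B telescope: they absorb the factors 1 + 4 |x|^2 q^i and
   1 / (1 - q^(k-i-1)) of the product, respectively. *)
Lemma rho_mono_bound_aux (k j : nat) : (j <= k)%nat ->
  (Cmod (rho_poly q x j) * mono_bound q (mono_radius q k) j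
   <= D * (p ^ S k) ^ j * Rpower q (- (INR j ^ 2 / 4 - INR j / 2))
      * exp (A * (1 - q ^ j) + B * q ^ (k - j)))%R.
Proof.
assert (Hx : (0 <= Cmod x)%R) by apply Cmod_ge_0.
assert (HX : (0 <= X)%R) by apply pow2_ge_0.
assert (HA : (0 <= A)%R) by (apply Rmult_le_pos; [lra | left; apply Rinv_0_lt_compat; lra]).
assert (Hq2 : (0 < 1 - q ^ 2)%R) by (simpl; nra).
assert (HB : (0 < B)%R) by (apply Rdiv_lt_0_compat; [lra | nra]).
assert (Hpk : (0 < p ^ S k)%R) by (apply pow_lt, exp_pos).
assert (Hg : (0 < Rpower q (-1/4))%R) by apply exp_pos.
assert (HD : (1 <= D)%R) by (unfold D; nra).
assert (E0 : forall i, (0 <= A * (1 - q ^ i) + B * q ^ (k - i))%R).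
{ intros i; assert (q ^ i <= 1)%R by (rewrite <- (pow1 i); apply pow_incr; lra).
  assert (0 < q ^ (k - i))%R by (apply pow_lt; lra); nra. }
induction j as [| |j IH] using two_step_ind; intros Hj.
- simpl rho_poly; simpl mono_bound; rewrite Cmod_1; simpl INR.
  replace (- (0 ^ 2 / 4 - 0 / 2))%R with 0%R by field; rewrite Rpower_O by lra.
  assert (H := exp_ge_1 _ (E0 0%nat)); change ((p ^ S k) ^ 0)%R with 1%R.
  set (e := exp (A * (1 - q ^ 0) + B * q ^ (k - 0))) in *; nra.
- simpl rho_poly; simpl mono_bound; rewrite Cmod_mult, Cmod_R, Rabs_right by lra.
  simpl INR; replace (- (1 ^ 2 / 4 - 1 / 2))%R with (1/4)%R by field.
  assert (H := exp_ge_1 _ (E0 1%nat)).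
  unfold mono_radius; fold p.
  set (u := (p ^ S k)%R) in *.
  replace (/ (2 * / (2 * u)))%R with u by (field; lra).
  assert (G : (Rpower q (-1/4) * Rpower q (1/4) = 1)%R).
  { rewrite <- Rpower_plus; replace (-1/4 + 1/4)%R with 0%R by field; apply Rpower_O; lra. }
  assert (Hg' : (0 < Rpower q (1/4))%R) by apply exp_pos.
  assert (E1 : (2 * Cmod x <= D * Rpower q (1/4))%R).
  { unfold D; rewrite Rmult_plus_distr_r.
    replace (2 * Cmod x * Rpower q (-1 / 4) * Rpower q (1 / 4))%R with (2 * Cmod x)%R
      by (rewrite Rmult_assoc, G; ring). nra. }
  assert (P1 : (0 <= D * u ^ 1 * Rpower q (1/4))%R) by (simpl; apply Rmult_le_pos; nra).
  apply Rle_trans with (D * u ^ 1 * Rpower q (1/4))%R; [simpl; nra|].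
  set (V := (D * u ^ 1 * Rpower q (1/4))%R) in *; nra.
- specialize (IH ltac:(lia)).
  rewrite rho_poly_SS, !Cmod_mult, Cmod_R, Rabs_right by lra.
  change (mono_bound q (mono_radius q k) (S (S j))) with
   (mono_bound q (mono_radius q k) j / (4 * (mono_radius q k ^ 2 - node q (S (S j)))))%R.
  assert (HN := node_lt_radius q k (S (S j)) Hq Hj).
  set (d := (k - S (S j))%nat).
  assert (Ed : (k = d + S (S j))%nat) by (unfold d; lia).
  assert (Pj : (0 < q ^ j)%R) by (apply pow_lt; lra).
  assert (Pk : (0 < q ^ S k)%R) by (apply pow_lt; lra).
  assert (Pd : (0 < q ^ S d < 1)%R) by (apply pow_lt_1; exact Hq).
  assert (Pd' : (q ^ S d <= q)%R).
  { rewrite <- (pow_1 q) at 2; apply pow_le_anti; [exact Hq | lia]. }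
  assert (M1 : (Cmod (x ^ 2 + RtoC (node q j)) <= / q ^ j / 4 * exp (4 * X * q ^ j))%R).
  { eapply Rle_trans; [apply Cmod_triangle|].
    rewrite Cmod_pow, Cmod_R; fold X.
    assert (N := node_bounds q j Hq); rewrite Rabs_right by lra.
    assert (T := exp_ineq1_le (4 * X * q ^ j)).
    apply Rle_trans with (/ q ^ j / 4 * (1 + 4 * X * q ^ j))%R.
    - replace (/ q ^ j / 4 * (1 + 4 * X * q ^ j))%R with (X + / q ^ j / 4)%R by (field; lra); lra.
    - apply Rmult_le_compat_l; [|exact T].
      assert (0 < / q ^ j)%R by (apply Rinv_0_lt_compat; exact Pj); lra. }
  (* The node is at most the fraction y = q^(k-j-1) of the squared radius, and 1 / (1 - y) = 1 + y /
     (1 - y) <= exp (y / (1 - q)) because y <= q. *)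
  assert (M2 : (/ (mono_radius q k ^ 2 - node q (S (S j))) <= 4 * q ^ S k * exp (q ^ S d / (1 - q)))%R).
  { assert (N := node_bounds q (S (S j)) Hq).
    assert (Q : (/ (4 * q ^ S k) * (1 - q ^ S d) <= mono_radius q k ^ 2 - node q (S (S j)))%R).
    { rewrite mono_radius_sqr by lra.
      replace (/ (4 * q ^ S k) * (1 - q ^ S d))%R with (/ (4 * q ^ S k) - / q ^ S (S j) / 4)%R; [lra|].
      replace (S k) with (S d + S (S j))%nat by lia; rewrite pow_add; field.
      split; apply pow_nonzero; lra. }
    assert (Q0 : (0 < / (4 * q ^ S k) * (1 - q ^ S d))%R).
    { apply Rmult_lt_0_compat; [apply Rinv_0_lt_compat|]; lra. }
    eapply Rle_trans; [apply Rinv_le_contravar; [exact Q0 | exact Q]|].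
    replace (/ (/ (4 * q ^ S k) * (1 - q ^ S d)))%R with (4 * q ^ S k * (1 + q ^ S d / (1 - q ^ S d)))%R
      by (field; lra).
    apply Rmult_le_compat_l; [lra|].
    eapply Rle_trans; [|apply exp_ineq1_le].
    apply Rplus_le_compat_l; apply Rmult_le_compat_l; [lra|].
    apply Rinv_le_contravar; lra. }
  assert (Ppos : (0 < mono_bound q (mono_radius q k) j)%R).
  { apply mono_bound_pos.
    - apply Rinv_0_lt_compat; fold p; lra.
    - intros i Hi; apply node_lt_radius; [exact Hq | lia]. }
  set (c := Cmod (rho_poly q x j)) in *; set (T := mono_bound q (mono_radius q k) j) in *.
  assert (Pc : (0 <= c)%R) by apply Cmod_ge_0.
  set (W := (mono_radius q k ^ 2 - node q (S (S j)))%R) in *.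
  assert (PW : (0 < W)%R) by (unfold W; lra).
  set (Y := Cmod (x ^ 2 + RtoC (node q j))) in *.
  assert (PY : (0 <= Y)%R) by apply Cmod_ge_0.
  replace (4 * Y * c * (T / (4 * W)))%R with (Y * / W * (c * T))%R by (field; lra).
  assert (PiW : (0 < / W)%R) by (apply Rinv_0_lt_compat; exact PW).
  apply Rle_trans with ((/ q ^ j / 4 * exp (4 * X * q ^ j)) * (4 * q ^ S k * exp (q ^ S d / (1 - q)))
     * (D * (p ^ S k) ^ j * Rpower q (- (INR j ^ 2 / 4 - INR j / 2)) *
      exp (A * (1 - q ^ j) + B * q ^ (k - j))))%R.
  { apply Rmult_le_compat; [nra | nra | | exact IH].
    apply Rmult_le_compat; lra. }
  change ((p ^ S k) ^ S (S j))%R with (p ^ S k * (p ^ S k * (p ^ S k) ^ j))%R.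
  assert (EP : (p ^ S k * p ^ S k = q ^ S k)%R) by (apply half_pow_sqr; lra).
  assert (ER : Rpower q (- (INR (S (S j)) ^ 2 / 4 - INR (S (S j)) / 2))
     = (Rpower q (- (INR j ^ 2 / 4 - INR j / 2)) * / q ^ j)%R).
  { rewrite <- (Rpower_pow j q), <- Rpower_Ropp, <- Rpower_plus by lra.
    f_equal; rewrite !S_INR; field. }
  rewrite ER.
  replace (D * (p ^ S k * (p ^ S k * (p ^ S k) ^ j)))%R with (D * q ^ S k * (p ^ S k) ^ j)%R
    by (rewrite <- EP; ring).
  set (R0 := Rpower q (- (INR j ^ 2 / 4 - INR j / 2))).
  assert (PR : (0 < R0)%R) by apply exp_pos.
  assert (PPk : (0 < (p ^ S k) ^ j)%R) by (apply pow_lt; exact Hpk).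
  replace (/ q ^ j / 4 * exp (4 * X * q ^ j) * (4 * q ^ S k * exp (q ^ S d / (1 - q))) *
     (D * (p ^ S k) ^ j * R0 * exp (A * (1 - q ^ j) + B * q ^ (k - j))))%R
   with (D * q ^ S k * (p ^ S k) ^ j * (R0 * / q ^ j) *
     exp (4 * X * q ^ j + q ^ S d / (1 - q) + (A * (1 - q ^ j) + B * q ^ (k - j))))%R
   by (rewrite !exp_plus; field; lra).
  apply Rmult_le_compat_l.
  { assert (0 < / q ^ j)%R by (apply Rinv_0_lt_compat; exact Pj).
    apply Rmult_le_pos; [|nra]; apply Rmult_le_pos; [|lra]; apply Rmult_le_pos; lra. }
  apply exp_le_compat.
  replace (k - j)%nat with (S (S d)) by lia.
  fold d; replace (k - S (S j))%nat with d by lia.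
  assert (F1 : (4 * X * q ^ j + A * (1 - q ^ j) <= A * (1 - q ^ S (S j)))%R).
  { replace (4 * X)%R with (A * (1 - q))%R by (unfold A; field; lra).
    change (q ^ S (S j))%R with (q * (q * q ^ j))%R.
    assert (0 <= A * q ^ j)%R by (apply Rmult_le_pos; lra).
    set (T0 := (A * q ^ j)%R) in *.
    assert (q * (q * T0) <= q * T0)%R
      by (apply Rmult_le_compat_l; [lra|]; rewrite <- (Rmult_1_l T0) at 2; apply Rmult_le_compat_r; lra).
    replace (A * (1 - q) * q ^ j + A * (1 - q ^ j))%R with (A - q * T0)%R by (unfold T0; ring).
    replace (A * (1 - q * (q * q ^ j)))%R with (A - q * (q * T0))%R by (unfold T0; ring).
    lra. }
  assert (F2 : (q ^ S d / (1 - q) + B * q ^ S (S d) = B * q ^ d)%R).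
  { unfold B; simpl pow; field; split; [simpl in Hq2; nra | lra]. }
  lra.
Qed.

(** For j = k the factor (q^((k+1)/2))^k against q^(-(k^2/4 - k/2)) leaves q^(k^2/4 + k). The
    quadratic part offsets the growth of f, and the q^k is the room that remains for convergence. *)
Lemma rho_mono_bound : exists K, (0 < K)%R /\ forall k,
  (Cmod (rho_poly q x k) * mono_bound q (mono_radius q k) k
   <= K * Rpower q (INR k ^ 2 / 4 + INR k))%R.
Proof.
assert (Hx : (0 <= Cmod x)%R) by apply Cmod_ge_0.
assert (Hg : (0 < Rpower q (-1/4))%R) by apply exp_pos.
assert (HD : (1 <= D)%R) by (unfold D; nra).
exists (D * exp (A + B))%R; split.
{ apply Rmult_lt_0_compat; [lra | apply exp_pos]. }
intros k; eapply Rle_trans; [apply rho_mono_bound_aux; apply Nat.le_refl|].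
rewrite Nat.sub_diag.
assert (E : ((p ^ S k) ^ k * Rpower q (- (INR k ^ 2 / 4 - INR k / 2))
   = Rpower q (INR k ^ 2 / 4 + INR k))%R).
{ rewrite <- pow_mult; unfold p; rewrite <- Rpower_pow by apply exp_pos.
  rewrite Rpower_mult, <- Rpower_plus; f_equal; rewrite mult_INR, S_INR; field. }
rewrite (Rmult_assoc D), E.
rewrite Rmult_assoc, (Rmult_comm (Rpower _ _)), <- Rmult_assoc.
apply Rmult_le_compat_r; [left; apply exp_pos|].
apply Rmult_le_compat_l; [lra|].
apply exp_le_compat.
assert (HA : (0 <= A)%R).
{ apply Rmult_le_pos; [assert (0 <= X)%R by apply pow2_ge_0; lra | left; apply Rinv_0_lt_compat; lra]. }
assert (0 < q ^ k)%R by (apply pow_lt; lra).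
simpl pow at 2; nra.
Qed.

End RhoBound.

(** Unites the two alternatives of the growth hypothesis: the order is the critical one and the type
    lies strictly below its bound. A smaller order fits in with alpha = 0. *)
Definition subcritical (q : R) (f : C -> C) : Prop :=
  exists K alpha : R, (0 < K)%R /\ (alpha * ln (/ q) < 2 * ln 2)%R /\
    forall x : C, x <> 0 ->
      (Cmod (f x) <= K * exp (alpha * ln (Cmod x) + ln (Cmod x) ^ 2 / ln (/ q)))%R.

Lemma growth_subcritical (q : R) (f : C -> C) : (0 < q < 1)%R ->
  ((exists k alpha : R, (k < 2 * ln (/ q))%R /\ qexp_growth q f k alpha) \/
   (exists alpha : R, (alpha < 2 * ln 2 / ln (/ q))%R /\
                      qexp_growth q f (2 * ln (/ q)) alpha)) ->
  subcritical q f.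
Proof.
intros Hq H.
assert (EL : ln (/ q) = (- ln q)%R) by (apply ln_Rinv; lra).
assert (HL : (0 < ln (/ q))%R).
{ rewrite EL; assert (T := ln_increasing q 1 ltac:(lra) ltac:(lra)); rewrite ln_1 in T; lra. }
assert (HL2 : (ln q ^ 2 = ln (/ q) ^ 2)%R) by (rewrite EL; ring).
unfold subcritical; set (L := ln (/ q)) in *.
destruct H as [[k [alpha [Hk [K [HK HG]]]]]|[alpha [Ha [K [HK HG]]]]].
(* The gap between the coefficients of ln^2 |x|. Completing the square, it absorbs the power
   |x|^alpha at the price of the constant exp (alpha^2 / (4 del)). *)
- set (del := (/ L - k / (2 * L ^ 2))%R).
  assert (Hdel : (0 < del)%R).
  { unfold del; replace (/ L - k / (2 * L ^ 2))%R with ((2 * L - k) / (2 * L ^ 2))%R by (field; lra).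
    apply Rdiv_lt_0_compat; [lra | nra]. }
  exists (K * exp (alpha ^ 2 / (4 * del)))%R, 0%R; split; [|split].
  + apply Rmult_lt_0_compat; [lra | apply exp_pos].
  + rewrite Rmult_0_l; assert (T := ln_lt_2); lra.
  + intros x Hx; left; eapply Rlt_le_trans; [apply HG; exact Hx|].
    rewrite HL2; unfold Rpower; set (y := ln (Cmod x)).
    rewrite (Rmult_assoc K (exp (alpha * y))), (Rmult_assoc K (exp (alpha ^ 2 / (4 * del)))), <- !exp_plus.
    apply Rmult_le_compat_l; [lra|]; apply exp_le_compat.
    assert (S : (0 <= del * (y - alpha / (2 * del)) ^ 2)%R)
      by (apply Rmult_le_pos; [lra | apply pow2_ge_0]).
    replace (del * (y - alpha / (2 * del)) ^ 2)%R
      with (del * y ^ 2 - alpha * y + alpha ^ 2 / (4 * del))%R in S by (field; lra).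
    replace (k * y ^ 2 / (2 * L ^ 2))%R with (y ^ 2 / L - del * y ^ 2)%R by (unfold del; field; lra).
    lra.
- exists K, alpha; split; [exact HK|]; split.
  + apply Rmult_lt_reg_r with (/ L)%R; [apply Rinv_0_lt_compat; exact HL|].
    replace (alpha * L * / L)%R with alpha by (field; lra); exact Ha.
  + intros x Hx; left; eapply Rlt_le_trans; [apply HG; exact Hx|].
    rewrite HL2; unfold Rpower; rewrite Rmult_assoc, <- exp_plus; right.
    do 2 f_equal; field; lra.
Qed.

Theorem newton_series (q : R) (f : C -> C) : (0 < q < 1)%R -> (forall z, diff f z) -> subcritical q f ->
  exists b : nat -> C, forall x, csums (fun k => b k * vfun q k x) (f x).
Proof.
intros Hq Df [K [alpha [HK [Ha HG]]]].
assert (EL : ln (/ q) = (- ln q)%R) by (apply ln_Rinv; lra).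
assert (HL : (0 < ln (/ q))%R).
{ rewrite EL; assert (T := ln_increasing q 1 ltac:(lra) ltac:(lra)); rewrite ln_1 in T; lra. }
set (L := ln (/ q)) in *.
destruct (disc_powser f 1 Rlt_0_1 (fun z _ => Df z)) as [a [Ha1 _]].
(* As f is entire, [disc_powser] applies at every radius, and by uniqueness it always returns the
   coefficients found on the unit disc. *)
assert (Hext : forall R0, (0 < R0)%R -> (forall z, (Cmod z < R0)%R -> powser a z (f z)) /\
  forall M, (forall z, (Cmod z = R0 / 2)%R -> (Cmod (f z) <= M)%R) ->
      forall n, (Cmod (a n) * (R0 / 2) ^ n <= 2 * M)%R).
{ intros R0 HR; destruct (disc_powser f R0 HR (fun z _ => Df z)) as [a' [Ha' B]].
  assert (E : forall n, a' n = a n).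
  { apply (powser_unique _ _ f (Rmin R0 1)); [apply Rmin_glb_lt; lra| |];
    intros w Hw; [apply Ha' | apply Ha1]; eapply Rlt_le_trans; try exact Hw; [apply Rmin_l | apply Rmin_r]. }
  split.
  - intros z Hz; generalize (Ha' z Hz); apply csums_ext; intros n; rewrite E; reflexivity.
  - intros M HM n; rewrite <- E; apply B; [lra | exact HM]. }
assert (Hps : forall z, powser a z (f z)).
{ intros z; assert (P := Cmod_ge_0 z); apply (Hext (Cmod z + 1)%R); lra. }
assert (Hbd : forall r M, (0 < r)%R -> (forall z, (Cmod z = r)%R -> (Cmod (f z) <= M)%R) ->
      forall n, (Cmod (a n) * r ^ n <= 2 * M)%R).
{ intros r M Hr HM n; destruct (Hext (2 * r)%R ltac:(lra)) as [_ B].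
  replace (2 * r / 2)%R with r in B by field; apply B; exact HM. }
set (g := Rpower q (1/4)).
assert (Hg : (0 < g < 1)%R).
{ split; [apply exp_pos|]; unfold g, Rpower; apply Rlt_le_trans with (exp 0); [apply exp_increasing; lra | rewrite exp_0; lra]. }
set (M := fun k : nat => (2 * (K * exp (ln 2 ^ 2 / L - alpha * ln 2) * exp (9 / 16 * L))
   * exp ((INR k ^ 2 / 4 + 3 / 4 * INR k) * L))%R).
assert (Bam : forall k m, (Cmod (a m) * mono_radius q k ^ m <= M k * g ^ m)%R).
{ intros k m.
  (* Cauchy's estimate is applied at radius q^(-t) / 2 with t = k/2 + s. Decay in m requires this
     radius to exceed [mono_radius], that is s > 1/2; decay in k requires s < 1, because of the q^k
     in [rho_mono_bound]. The choice s = 3/4 gives the ratio q^(1/4) for both. *)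
  set (t := (INR k / 2 + 3 / 4)%R).
  assert (Ht : (0 < t)%R) by (unfold t; assert (T := pos_INR k); lra).
  set (y := (t * L - ln 2)%R).
  assert (Er : (mono_radius q k = exp y * g)%R).
  { unfold mono_radius; rewrite <- Rpower_pow by apply exp_pos.
    unfold y, g, Rpower; rewrite ln_exp, Rinv_mult, <- exp_Ropp, <- exp_plus.
    replace (/ 2)%R with (exp (- ln 2)) by (rewrite exp_Ropp, exp_ln by lra; reflexivity).
    rewrite <- exp_plus; f_equal; unfold t; rewrite S_INR.
    replace (ln q) with (- L)%R by lra; field. }
  rewrite Er, Rpow_mult_distr, <- Rmult_assoc.
  apply Rmult_le_compat_r; [apply pow_le; lra|].
  eapply Rle_trans; [apply (Hbd (exp y) (K * exp (alpha * y + y ^ 2 / L))%R (exp_pos y))|].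
  - intros z Hz; assert (Nz : z <> 0) by (apply Cmod_gt_0; rewrite Hz; apply exp_pos).
    generalize (HG z Nz); rewrite Hz, ln_exp; auto.
  - unfold M; rewrite Rmult_assoc, !Rmult_assoc, <- !exp_plus.
    apply Rmult_le_compat_l; [lra|]; apply Rmult_le_compat_l; [lra|].
    apply exp_le_compat.
    (* Substituting y = t L - ln 2 turns the condition on the type into negativity of the
       coefficient of t. *)
    replace (alpha * y + y ^ 2 / L)%R
      with (t ^ 2 * L + t * (alpha * L - 2 * ln 2) + (ln 2 ^ 2 / L - alpha * ln 2))%R
      by (unfold y; field; lra).
    replace (t ^ 2)%R with (INR k ^ 2 / 4 + 3 / 4 * INR k + 9 / 16)%R by (unfold t; field).
    nra. }
assert (Bmk : forall m k, (Cmod (a m * RtoC (mono_coef q m k))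
     <= M k * mono_bound q (mono_radius q k) k * g ^ m)%R).
{ intros m k; rewrite Cmod_mult, Cmod_R.
  assert (Pr : (0 < mono_radius q k)%R).
  { apply Rinv_0_lt_compat; assert (0 < Rpower q (1/2) ^ S k)%R by (apply pow_lt, exp_pos); lra. }
  assert (HN : forall j, (j <= k)%nat -> (node q j < mono_radius q k ^ 2)%R)
    by (intros; apply node_lt_radius; assumption).
  assert (C1 := mono_coef_bound q (mono_radius q k) m Hq Pr k HN).
  assert (P := mono_bound_pos q (mono_radius q k) k Pr HN).
  assert (Pa := Cmod_ge_0 (a m)).
  apply Rle_trans with (Cmod (a m) * (mono_radius q k ^ m * mono_bound q (mono_radius q k) k))%R;
    [apply Rmult_le_compat_l; assumption|].
  specialize (Bam k m); nra. }
assert (HB : forall k, exists B, csums (fun m => a m * RtoC (mono_coef q m k)) B).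
{ intros k; destruct (geom_csums (fun m => a m * RtoC (mono_coef q m k)) _ g ltac:(lra)
    (fun m => Bmk m k)) as [B [HB _]]; exists B; exact HB. }
set (B := fun k => proj1_sig (constructive_indefinite_description _ (HB k))).
assert (HB' : forall k, csums (fun m => a m * RtoC (mono_coef q m k)) (B k))
  by (intros k; exact (proj2_sig (constructive_indefinite_description _ (HB k)))).
exists (fun k => B k / RtoC (qexp_coef q k)); intros x.
destruct (rho_mono_bound q x Hq) as [D [HD BD]].
destruct (double_series (fun m k => a m * RtoC (mono_coef q m k) * rho_poly q x k)
   (2 * (K * exp (ln 2 ^ 2 / L - alpha * ln 2) * exp (9 / 16 * L)) * D)%R g
   (fun m => a m * x ^ m) (fun k => B k * rho_poly q x k)) as [l [H1 H2]].
- lra.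
- intros m k; rewrite Cmod_mult.
  assert (Pg : (0 < g ^ m)%R) by (apply pow_lt; lra).
  assert (PM : (0 < M k)%R).
  { unfold M; repeat apply Rmult_lt_0_compat; try apply exp_pos; lra. }
  apply Rle_trans with (M k * mono_bound q (mono_radius q k) k * g ^ m * Cmod (rho_poly q x k))%R.
  { apply Rmult_le_compat_r; [apply Cmod_ge_0 | apply Bmk]. }
  apply Rle_trans with (M k * g ^ m * (D * Rpower q (INR k ^ 2 / 4 + INR k)))%R.
  { specialize (BD k); assert (0 < M k * g ^ m)%R by nra; nra. }
  right; unfold M.
  replace (g ^ k)%R with (exp ((- 1 / 4 * INR k) * L)).
  2:{ rewrite <- Rpower_pow by (unfold g; apply exp_pos); unfold g, Rpower; rewrite ln_exp.
      f_equal; replace (ln q) with (- L)%R by lra; field. }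
  replace (exp (- 1 / 4 * INR k * L)) with
    (exp ((INR k ^ 2 / 4 + 3 / 4 * INR k) * L) * Rpower q (INR k ^ 2 / 4 + INR k))%R; [ring|].
  unfold Rpower; rewrite <- exp_plus; f_equal; replace (ln q) with (- L)%R by lra; field.
- intros m; rewrite <- (mono_expansion q x m (S m)) by lia.
  rewrite <- csum_scal.
  rewrite (csum_ext (fun k => a m * (RtoC (mono_coef q m k) * rho_poly q x k))
    (fun k => a m * RtoC (mono_coef q m k) * rho_poly q x k)) by (intros; ring).
  apply csums_finite; intros k Hk; rewrite mono_coef_0 by lia; ring.
- intros k; replace (B k * rho_poly q x k) with (rho_poly q x k * B k) by ring.
  generalize (csums_scal (rho_poly q x k) _ _ (HB' k)); apply csums_ext; intros; ring.
- replace (f x) with l by (apply (csums_unique _ _ _ H1); apply Hps).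
  revert H2; apply csums_ext; intros k.
  unfold vfun; rewrite rho_rho_poly by lra.
  assert (N : RtoC (qexp_coef q k) <> 0)
    by (apply RtoC_neq_0; assert (T := qexp_coef_pos q k Hq); lra).
  field; exact N.
Qed.

(** * Expansion in the functions rho_k *)

(** A set on which [orbit_closed] holds and which contains z = i, the point over x = 0. *)
Definition imag_axis (z : C) : Prop := Re z = 0%R /\ z <> 0.

Lemma imag_axis_closed (q : R) : (0 < q < 1)%R -> orbit_closed q imag_axis.
Proof.
intros Hq z [H1 H2].
assert (Hp := Rpower_half_lt q Hq).
assert (HP : RtoC (Rpower q (1/2)) <> 0) by (apply RtoC_neq_0; lra).
split; [exact H2|]; split; [|split; split].
- intros E; apply (f_equal fst) in E; simpl in E; unfold Re in H1; rewrite H1 in E.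
  assert (0 <= snd z * snd z)%R by nra; lra.
- simpl; unfold Re in H1; rewrite H1; ring.
- apply Cmult_neq_0; assumption.
- rewrite <- RtoC_inv by lra; simpl; unfold Re in H1; rewrite H1; ring.
- apply Cmult_neq_0; [apply Cinv_neq_0|]; assumption.
Qed.

Lemma Ci_neq_0 : Ci <> 0.
Proof. intros E; apply (f_equal snd) in E; simpl in E; lra. Qed.

Lemma imag_axis_Ci : imag_axis Ci.
Proof. split; [reflexivity | exact Ci_neq_0]. Qed.

Lemma joukowski_Ci : joukowski Ci = 0.
Proof. unfold joukowski; apply injective_projections; simpl; field. Qed.

Lemma rho_poly_0 (q : R) (n : nat) : rho_poly q 0 (S n) = 0.
Proof.
induction n as [| |n IH] using two_step_ind.
- simpl; ring.
- simpl; replace (1 + / 1 - 2)%R with 0%R by field; ring.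
- rewrite rho_poly_SS, IH; ring.
Qed.

Lemma vfun_0_l (q : R) (x : C) : (0 < q < 1)%R -> vfun q 0 x = 1.
Proof.
intros Hq; unfold vfun, qexp_coef; simpl.
replace (0 * (0 * 1) / 4)%R with 0%R by field; rewrite Rpower_O by lra.
replace (1 / 1)%R with 1%R by field; ring.
Qed.

Lemma vfun_0_r (q : R) (n : nat) : (0 < q < 1)%R -> vfun q (S n) 0 = 0.
Proof. intros Hq; unfold vfun; rewrite rho_rho_poly, rho_poly_0 by lra; ring. Qed.

Lemma rho_series (q : R) (f : C -> C) : (0 < q < 1)%R ->
  (forall z, diff f z) -> subcritical q f ->
  forall x, csums (fun k => / RtoC (gamma q) ^ k * AW_iter q k f 0 * vfun q k x) (f x).
Proof.
intros Hq Hf Hs x.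
destruct (newton_series q f Hq Hf Hs) as [b Hb].
generalize (Hb x); apply csums_ext; intros n; f_equal.
assert (H := AW_iter_vseries q imag_axis Hq (imag_axis_closed q Hq) b f n
   (fun z _ => Hb (joukowski z)) Ci imag_axis_Ci).
rewrite joukowski_Ci in H.
assert (F : csums (fun k => b (n + k)%nat * vfun q k 0)
   (csum (fun k => b (n + k)%nat * vfun q k 0) 1)).
{ apply csums_finite; intros k Hk; destruct k as [|k]; [lia|].
  rewrite vfun_0_r by exact Hq; ring. }
rewrite <- (csums_unique _ _ _ F H); simpl csum; rewrite vfun_0_l, Nat.add_0_r by exact Hq; ring.
Qed.

(** Polynomials as products of linear factors. In this form the q-products of the series that
    defines the q-exponential function are seen to be entire in x and of polynomial growth, so that
    [rho_series] applies to them. *)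
Fixpoint linprod (a b : nat -> C) (n : nat) (x : C) : C :=
  match n with O => 1 | S m => linprod a b m x * (a m + b m * x) end.

Lemma linprod_diff a b n x : diff (linprod a b n) x.
Proof.
induction n as [|n IH]; [apply diff_const|].
apply diff_mult; [exact IH|].
apply diff_plus; [apply diff_const|].
apply diff_mult; [apply diff_const | apply diff_id].
Qed.

Lemma linprod_bound a b n : exists K, (0 < K)%R /\ forall x,
  (Cmod (linprod a b n x) <= K * (1 + Cmod x) ^ n)%R.
Proof.
induction n as [|n [K [HK IH]]].
- exists 1%R; split; [lra|]; intros x; simpl; rewrite Cmod_1; lra.
- exists (K * (Cmod (a n) + Cmod (b n) + 1))%R.
  assert (P1 := Cmod_ge_0 (a n)); assert (P2 := Cmod_ge_0 (b n)).
  split; [nra|]; intros x; simpl linprod; rewrite Cmod_mult.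
  assert (P := Cmod_ge_0 x).
  assert (T := Cmod_triangle (a n) (b n * x)); rewrite Cmod_mult in T.
  specialize (IH x).
  assert (Q : (0 < (1 + Cmod x) ^ n)%R) by (apply pow_lt; lra).
  apply Rle_trans with ((K * (1 + Cmod x) ^ n) * ((Cmod (a n) + Cmod (b n) + 1) * (1 + Cmod x)))%R.
  + apply Rmult_le_compat; try apply Cmod_ge_0; [exact IH | nra].
  + right; simpl; ring.
Qed.

Lemma ln_inv_pos (q : R) : (0 < q < 1)%R -> (0 < ln (/ q))%R.
Proof.
intros Hq; rewrite ln_Rinv by lra.
assert (T := ln_increasing q 1 ltac:(lra) ltac:(lra)); rewrite ln_1 in T; lra.
Qed.

Lemma poly_growth_subcritical (q : R) (f : C -> C) (K : R) (n : nat) : (0 < q < 1)%R -> (0 < K)%R ->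
  (forall x, (Cmod (f x) <= K * (1 + Cmod x) ^ n)%R) -> subcritical q f.
Proof.
intros Hq HK H; assert (HL := ln_inv_pos q Hq).
unfold subcritical; set (L := ln (/ q)) in *.
exists (K * exp (INR n * ln 2 + INR n ^ 2 * L / 4))%R, 0%R; split; [|split].
- apply Rmult_lt_0_compat; [exact HK | apply exp_pos].
- rewrite Rmult_0_l; assert (T := ln_lt_2); lra.
- intros x Hx; eapply Rle_trans; [apply H|].
  rewrite Rmult_assoc; apply Rmult_le_compat_l; [lra|].
  assert (P : (0 < Cmod x)%R) by (apply Cmod_gt_0; exact Hx).
  rewrite <- exp_plus; set (y := ln (Cmod x)).
  assert (Pn := pos_INR n).
  assert (E : forall r, (0 < r)%R -> (r ^ n = exp (INR n * ln r))%R).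
  { intros r Hr; rewrite <- Rpower_pow by exact Hr; reflexivity. }
  assert (S2 : (0 <= y ^ 2 / L)%R).
  { apply Rmult_le_pos; [apply pow2_ge_0 | left; apply Rinv_0_lt_compat; exact HL]. }
  assert (S3 : (0 <= INR n ^ 2 * L / 4)%R).
  { assert (0 <= INR n ^ 2)%R by apply pow2_ge_0; nra. }
  destruct (Rle_or_lt 1 (Cmod x)) as [G|G].
  + apply Rle_trans with ((2 * Cmod x) ^ n)%R; [apply pow_incr; lra|].
    rewrite E, ln_mult by lra; fold y; apply exp_le_compat.
    assert (S : (0 <= (y - INR n * L / 2) ^ 2 / L)%R).
    { apply Rmult_le_pos; [apply pow2_ge_0 | left; apply Rinv_0_lt_compat; exact HL]. }
    replace ((y - INR n * L / 2) ^ 2 / L)%R with (y ^ 2 / L - INR n * y + INR n ^ 2 * L / 4)%R in S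
      by (field; lra).
    lra.
  + apply Rle_trans with (2 ^ n)%R; [apply pow_incr; lra|].
    rewrite E by lra; apply exp_le_compat; lra.
Qed.

(** The factors of equal index in the products for z and 1/z combine: (1 + i t z) (1 + i t / z) = 1
    - t^2 + 2 i t x. *)
Lemma phi_linprod (q : R) (n : nat) (x : C) :
  phi q n (expitheta x) =
  linprod (fun j => RtoC (1 - (Rpower q ((1 - INR n) / 2) * q ^ j) ^ 2))
          (fun j => 2 * Ci * RtoC (Rpower q ((1 - INR n) / 2) * q ^ j)) n x.
Proof.
destruct (expitheta_spec x) as [Hz Ex].
unfold phi; set (z := expitheta x) in *.
set (c := Rpower q ((1 - INR n) / 2)).
set (a := fun j => RtoC (1 - (c * q ^ j) ^ 2)); set (b := fun j => 2 * Ci * RtoC (c * q ^ j)).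
assert (H : forall m, qpoch (- Ci * z * RtoC c) q m * qpoch (- Ci * / z * RtoC c) q m
  = linprod a b m x); [|apply H].
induction m as [|m IH]; [simpl; ring|].
change (linprod a b (S m) x) with (linprod a b m x * (a m + b m * x)).
rewrite <- IH, !qpoch_S_r; clear IH.
set (X := qpoch (- Ci * z * RtoC c) q m); set (Y := qpoch (- Ci * / z * RtoC c) q m).
assert (E : forall t : C, (1 + Ci * z * t) * (1 + Ci * / z * t) = 1 - t * t + 2 * Ci * t * x).
{ intros t; rewrite <- Ex; unfold joukowski.
  replace (1 - t * t) with (1 + Ci * Ci * (t * t))
    by (replace (Ci * Ci) with (RtoC (-1)) by (apply injective_projections; simpl; ring); ring).
  field; exact Hz. }
specialize (E (RtoC (c * q ^ m))).
unfold a, b; replace (RtoC (1 - (c * q ^ m) ^ 2)) with (1 - RtoC (c * q ^ m) * RtoC (c * q ^ m))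
  by (rewrite <- RtoC_mult, <- RtoC_minus; f_equal; simpl; ring).
rewrite <- E, RtoC_mult; ring.
Qed.

(** [rho_series] for the polynomial u_n, with D_q^k u_n = gamma^k u_(n-k). As a convolution it says
    that the generating function of the u_n(x) is that of the v_n(x) times that of the numbers
    u_n(0). *)
Lemma ufun_expansion (q : R) (n : nat) (x : C) : (0 < q < 1)%R ->
  ufun q n x = csum (fun k => vfun q k x * ufun q (n - k) 0) (S n).
Proof.
intros Hq.
set (a := fun j => RtoC (1 - (Rpower q ((1 - INR n) / 2) * q ^ j) ^ 2)).
set (b := fun j => 2 * Ci * RtoC (Rpower q ((1 - INR n) / 2) * q ^ j)).
set (c := (- Ci) ^ n * RtoC (qexp_coef q n)).
assert (E : forall y, c * linprod a b n y = ufun q n y)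
  by (intros y; unfold ufun; rewrite phi_linprod; reflexivity).
assert (D : forall z, diff (ufun q n) z).
{ intros z; apply (diff_ext (fun y => c * linprod a b n y)).
  - exists 1%R; split; [lra | intros; apply E].
  - apply diff_mult; [apply diff_const | apply linprod_diff]. }
destruct (linprod_bound a b n) as [K [HK B]].
assert (G : subcritical q (ufun q n)).
{ apply (poly_growth_subcritical q _ ((Cmod c + 1) * K) n Hq).
  - assert (T := Cmod_ge_0 c); nra.
  - intros y; rewrite <- E, Cmod_mult, Rmult_assoc; apply Rmult_le_compat; try apply Cmod_ge_0.
    + lra.
    + apply B. }
apply (csums_unique _ _ _ (rho_series q _ Hq D G x)).
assert (Hg : forall k, RtoC (gamma q) ^ k <> 0)
  by (intros k; apply Cpow_neq_0, RtoC_neq_0; assert (T := gamma_pos q Hq); lra).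
assert (I : forall k, AW_iter q k (ufun q n) 0
    = if (k <=? n)%nat then RtoC (gamma q) ^ k * ufun q (n - k) 0 else 0).
{ intros k; assert (T := AW_iter_appell q imag_axis Hq (imag_axis_closed q Hq) (ufun q) k
      (appell_ufun q imag_axis Hq (imag_axis_closed q Hq)) n Ci imag_axis_Ci).
  rewrite joukowski_Ci in T; exact T. }
rewrite (csum_ext _ (fun k => / RtoC (gamma q) ^ k * AW_iter q k (ufun q n) 0 * vfun q k x)).
2:{ intros k Hk; rewrite I; destruct (Nat.leb_spec k n); [field; apply Hg | lia]. }
apply csums_finite; intros k Hk; rewrite I.
destruct (Nat.leb_spec k n); [lia | ring].
Qed.

Lemma qexp_coef_SS (q : R) (n : nat) : (0 < q < 1)%R ->
  qexp_coef q (S (S n)) = (qexp_coef q n * q ^ S n / ((1 - q ^ S n) * (1 - q ^ S (S n))))%R.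
Proof.
intros Hq; rewrite !qexp_coef_S by exact Hq.
assert (H1 := pow_lt_1 q n Hq); assert (H2 := pow_lt_1 q (S n) Hq).
assert (E := half_pow_sqr q (S n) ltac:(lra)).
assert (E4 : (Rpower q (1/4) * Rpower q (1/4) = Rpower q (1/2))%R)
  by (rewrite <- Rpower_plus; f_equal; field).
change (Rpower q (1/2) ^ S n)%R with (Rpower q (1/2) * Rpower q (1/2) ^ n)%R in *.
set (g := Rpower q (1/4)) in *; set (p := Rpower q (1/2)) in *.
set (t := (q ^ S n)%R) in *; set (t2 := (q ^ S (S n))%R) in *.
assert (T : (t = g * p ^ n * (g * (p * p ^ n)))%R) by (rewrite <- E, <- E4; ring).
transitivity (qexp_coef q n * (g * p ^ n * (g * (p * p ^ n))) / ((1 - t) * (1 - t2)))%R;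
  [field; lra | rewrite <- T; reflexivity].
Qed.

(** At z = i the two products merge into (q^(1-n);q^2)_n, which gains one factor at each end when n
    grows by 2. It follows that u_(2m)(0) = (q;q^2)_m / (q^2;q^2)_m. *)
Lemma ufun_0_SS (q : R) (n : nat) : (0 < q < 1)%R ->
  ufun q (S (S n)) 0 = RtoC ((1 - q ^ S n) / (1 - q ^ S (S n))) * ufun q n 0.
Proof.
intros Hq.
assert (H1 := pow_lt_1 q n Hq); assert (H2 := pow_lt_1 q (S n) Hq).
unfold ufun; rewrite <- joukowski_Ci, !phi_joukowski by exact Ci_neq_0.
assert (Hphi : forall m, phi q m Ci = qpoch (RtoC (q / q ^ m)) (q ^ 2) m).
{ intros m; unfold phi; rewrite phi_shift by lra.
  set (c := (Rpower q (1/2) / Rpower q (1/2) ^ m)%R).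
  replace (- Ci * Ci * RtoC c) with (RtoC c) by (apply injective_projections; simpl; ring).
  replace (- Ci * / Ci * RtoC c) with (- RtoC c) by (field; exact Ci_neq_0).
  replace (q / q ^ m)%R with (c * c)%R.
  2:{ transitivity (Rpower q (1/2) * Rpower q (1/2) / (Rpower q (1/2) ^ m * Rpower q (1/2) ^ m))%R.
      - unfold c; field; apply pow_nonzero; assert (T := Rpower_half_lt q Hq); lra.
      - rewrite half_pow_sqr, Rpower_half_sqr by lra; reflexivity. }
  generalize m; intros j; induction j as [|j IH]; [simpl; ring|].
  rewrite !qpoch_S_r, <- IH, <- pow_mult, Nat.mul_comm, pow_mult.
  replace (RtoC ((q ^ j) ^ 2)) with (RtoC (q ^ j) * RtoC (q ^ j))
    by (rewrite <- RtoC_mult; f_equal; simpl; ring).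
  rewrite RtoC_mult; ring. }
rewrite !Hphi, qpoch_S_l, qpoch_S_r.
assert (Pn : (0 < q ^ n)%R) by (apply pow_lt; lra).
replace (RtoC (q / q ^ S (S n)) * RtoC (q ^ 2)) with (RtoC (q / q ^ n))
  by (rewrite <- RtoC_mult; f_equal; simpl; field; lra).
set (X := qpoch (RtoC (q / q ^ n)) (q ^ 2) n).
rewrite <- RtoC_mult.
replace (q / q ^ n * (q ^ 2) ^ n)%R with (q ^ S n)%R
  by (rewrite <- pow_mult, Nat.mul_comm, pow_mult; simpl; field; lra).
replace (q / q ^ S (S n))%R with (/ q ^ S n)%R by (simpl; field; lra).
rewrite qexp_coef_SS by exact Hq.
set (t := (q ^ S n)%R) in *; set (t2 := (q ^ S (S n))%R) in *; set (e := qexp_coef q n).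
change ((- Ci) ^ S (S n)) with (- Ci * (- Ci * (- Ci) ^ n)).
transitivity ((- Ci * - Ci) * (- Ci) ^ n * X * RtoC (e * t / ((1 - t) * (1 - t2)) * (1 - / t) * (1 - t))).
- rewrite !RtoC_mult, !RtoC_minus; ring.
- replace (- Ci * - Ci) with (RtoC (-1)) by (apply injective_projections; simpl; ring).
  replace (e * t / ((1 - t) * (1 - t2)) * (1 - / t) * (1 - t))%R with (-1 * ((1 - t) / (1 - t2)) * e)%R
    by (field; lra).
  rewrite !RtoC_mult; transitivity (RtoC (-1) * RtoC (-1) * (- Ci) ^ n * X * RtoC ((1 - t) / (1 - t2)) * RtoC e);
    [ring|].
  rewrite <- (RtoC_mult (-1) (-1)); replace (-1 * -1)%R with 1%R by ring; ring.
Qed.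

Lemma ufun_0_0 (q : R) : (0 < q < 1)%R -> ufun q 0 0 = 1.
Proof.
intros Hq; unfold ufun, phi, qexp_coef; simpl.
replace (0 * (0 * 1) / 4)%R with 0%R by field; rewrite Rpower_O by lra.
replace (1 / 1)%R with 1%R by field; ring.
Qed.

Lemma ufun_1_0 (q : R) : (0 < q < 1)%R -> ufun q 1 0 = 0.
Proof.
intros Hq; unfold ufun; rewrite <- joukowski_Ci, phi_joukowski by exact Ci_neq_0.
unfold phi; simpl INR; replace ((1 - 1) / 2)%R with 0%R by field; rewrite Rpower_O by lra.
simpl qpoch.
replace (1 - - Ci * Ci * 1 * 1) with (RtoC 0) by (apply injective_projections; simpl; ring); rewrite joukowski_Ci; ring.
Qed.

Lemma ufun_0_bound (q : R) (n : nat) : (0 < q < 1)%R -> (Cmod (ufun q n 0) <= 1)%R.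
Proof.
intros Hq; induction n as [| |n IH] using two_step_ind.
- rewrite ufun_0_0, Cmod_1 by exact Hq; lra.
- rewrite ufun_1_0, Cmod_0 by exact Hq; lra.
- rewrite ufun_0_SS, Cmod_mult, Cmod_R by exact Hq.
  assert (H1 := pow_lt_1 q n Hq); assert (H2 := pow_lt_1 q (S n) Hq).
  assert (H3 : (q ^ S (S n) <= q ^ S n)%R) by (apply pow_le_anti; [exact Hq | lia]).
  assert (B : (0 <= (1 - q ^ S n) / (1 - q ^ S (S n)) <= 1)%R).
  { split; [apply Rmult_le_pos; [lra | left; apply Rinv_0_lt_compat; lra]|].
    apply Rmult_le_reg_r with (1 - q ^ S (S n))%R; [lra|].
    unfold Rdiv; rewrite Rmult_assoc, Rinv_l by lra; lra. }
  rewrite Rabs_right by lra; assert (P := Cmod_ge_0 (ufun q n 0)); nra.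
Qed.

Lemma eventually_decreasing_bounded (r : nat -> R) (N : nat) :
  (forall n, (N <= n)%nat -> (r (S (S n)) <= r n)%R) -> exists K, forall n, (r n <= K)%R.
Proof.
intros H.
assert (F : forall M, exists K, forall n, (n < M)%nat -> (r n <= K)%R).
{ induction M as [|M [K IH]]; [exists 0%R; intros; lia|].
  exists (Rmax K (r M)); intros n Hn; destruct (Nat.eq_dec n M) as [->|E]; [apply Rmax_r|].
  eapply Rle_trans; [apply IH; lia | apply Rmax_l]. }
destruct (F (S (S N))) as [K HK]; exists K; intros n.
induction n as [n IH] using (well_founded_induction Nat.lt_wf_0).
destruct (Nat.lt_ge_cases n (S (S N))) as [L|L]; [apply HK; exact L|].
destruct n as [|[|n]]; [lia|lia|].
eapply Rle_trans; [apply H; lia | apply IH; lia].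
Qed.

(** The ratio |v_(n+2) / v_n| is bounded by an expression that tends to q < 1, so each parity class
    is eventually decreasing. *)
Lemma vfun_bounded (q : R) (x : C) : (0 < q < 1)%R ->
  exists K, (0 < K)%R /\ forall n, (Cmod (vfun q n x) <= K)%R.
Proof.
intros Hq; set (X := (4 * Cmod x ^ 2)%R).
assert (HX : (0 <= X)%R) by (assert (T := pow2_ge_0 (Cmod x)); unfold X; lra).
(* With t = q^(n+1) the ratio is at most (q + X t) / ((1 - t) (1 - q t)), and (1 - t) (1 - q t) >= 1
   - 2 t; so (X + 2) t <= 1 - q is enough. *)
destruct (geom_small q (X + 2) (1 - q)) as [N HN]; [lra|lra|lra|].
destruct (eventually_decreasing_bounded (fun n => Cmod (vfun q n x)) N) as [K HK].
- intros n Hn.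
  assert (H1 := pow_lt_1 q n Hq); assert (H2 := pow_lt_1 q (S n) Hq).
  assert (H3 : (q ^ S (S n) <= q ^ S n)%R) by (apply pow_le_anti; [exact Hq | lia]).
  assert (HN' := HN (S n) ltac:(lia)).
  assert (P : (0 < q ^ n)%R) by (apply pow_lt; lra).
  unfold vfun; rewrite !rho_rho_poly, rho_poly_SS, qexp_coef_SS by lra.
  rewrite !Cmod_mult, !Cmod_R, (Rabs_right 4) by lra.
  assert (Pe := qexp_coef_pos q n Hq); set (e := qexp_coef q n) in *.
  set (c := Cmod (rho_poly q x n)); assert (Pc : (0 <= c)%R) by apply Cmod_ge_0.
  set (t := (q ^ S n)%R) in *; set (t2 := (q ^ S (S n))%R) in *.
  assert (Nb := node_bounds q n Hq).
  assert (Y : (4 * Cmod (x ^ 2 + RtoC (node q n)) * t <= q + X * t)%R).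
  { assert (T := Cmod_triangle (x ^ 2) (RtoC (node q n))).
    rewrite Cmod_pow, Cmod_R, Rabs_right in T by lra.
    apply Rle_trans with ((X + / q ^ n) * t)%R; [apply Rmult_le_compat_r; unfold X; lra|].
    right; unfold t; simpl; field; lra. }
  assert (Q : (0 < (1 - t) * (1 - t2))%R) by (apply Rmult_lt_0_compat; lra).
  rewrite Rabs_right by (apply Rle_ge, Rmult_le_pos; [nra | left; apply Rinv_0_lt_compat; exact Q]).
  rewrite (Rabs_right e) by lra.
  set (Z := Cmod (x ^ 2 + RtoC (node q n))) in *.
  replace (e * t / ((1 - t) * (1 - t2)) * (4 * Z * c))%R
    with ((e * c) * (4 * Z * t / ((1 - t) * (1 - t2))))%R by (field; lra).
  rewrite <- (Rmult_1_r (e * c)) at 2; apply Rmult_le_compat_l; [nra|].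
  apply Rmult_le_reg_r with ((1 - t) * (1 - t2))%R; [exact Q|].
  unfold Rdiv; rewrite Rmult_assoc, Rinv_l by lra.
  nra.
- exists (K + 1)%R; split; [|intros n; specialize (HK n); simpl in HK; lra].
  specialize (HK 0%nat); simpl in HK; assert (T := Cmod_ge_0 (vfun q 0 x)); lra.
Qed.

(** * The q-exponential function *)

Lemma clim_const (c : C) : clim (fun _ => c) c.
Proof.
intros e He; exists 0%nat; intros; rewrite Cmod_diag; exact He.
Qed.

Lemma clim_ext (u v : nat -> C) (l : C) : (forall n, u n = v n) -> clim u l -> clim v l.
Proof. intros E H e He; destruct (H e He) as [N HN]; exists N; intros; rewrite <- E; auto. Qed.

Lemma clim_mult (u v : nat -> C) (l m : C) : clim u l -> clim v m ->
  clim (fun n => u n * v n) (l * m).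
Proof.
intros Hu Hv.
assert (B : exists M, (0 < M)%R /\ exists N, forall n, (N <= n)%nat -> (Cmod (v n) <= M)%R).
{ destruct (Hv 1%R Rlt_0_1) as [N HN]; exists (Cmod m + 1)%R; assert (T := Cmod_ge_0 m).
  split; [lra|]; exists N; intros n Hn; specialize (HN n Hn).
  assert (T1 := Cmod_triangle (v n - m) m); replace (v n - m + m) with (v n) in T1 by ring; lra. }
destruct B as [M [HM [N0 B]]]; intros e He.
assert (Pl := Cmod_ge_0 l).
destruct (Hu (e / (2 * M))%R) as [N1 H1]; [apply Rdiv_lt_0_compat; lra|].
destruct (Hv (e / (2 * (Cmod l + 1)))%R) as [N2 H2]; [apply Rdiv_lt_0_compat; lra|].
exists (N0 + N1 + N2)%nat; intros n Hn.
replace (u n * v n - l * m) with ((u n - l) * v n + l * (v n - m)) by ring.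
eapply Rle_lt_trans; [apply Cmod_triangle|]; rewrite !Cmod_mult.
specialize (B n ltac:(lia)); specialize (H1 n ltac:(lia)); specialize (H2 n ltac:(lia)).
assert (A1 : (Cmod (u n - l) * Cmod (v n) <= e / (2 * M) * M)%R)
  by (apply Rmult_le_compat; try apply Cmod_ge_0; lra).
replace (e / (2 * M) * M)%R with (e / 2)%R in A1 by (field; lra).
assert (A2 : ((Cmod l + 1) * Cmod (v n - m) < (Cmod l + 1) * (e / (2 * (Cmod l + 1))))%R)
  by (apply Rmult_lt_compat_l; lra).
replace ((Cmod l + 1) * (e / (2 * (Cmod l + 1))))%R with (e / 2)%R in A2 by (field; lra).
assert (T := Cmod_ge_0 (v n - m)); nra.
Qed.

Lemma clim_CLim_seq (u : nat -> C) (l : C) : clim u l -> CLim_seq u = l.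
Proof.
intros H.
assert (L : forall p : C -> R, (forall z w : C, p (z - w)%C = (p z - p w)%R) ->
   (forall z, Rabs (p z) <= Cmod z)%R -> Lim_seq (fun n => p (u n)) = p l).
{ intros p Hp Hpm; apply is_lim_seq_unique, is_lim_seq_spec; intros e.
  destruct (H e (cond_pos e)) as [N HN]; exists N; intros n Hn.
  rewrite <- Hp; eapply Rle_lt_trans; [apply Hpm | apply HN; exact Hn]. }
unfold CLim_seq.
rewrite (L Re (fun _ _ => eq_refl) re_le_Cmod), (L Im (fun _ _ => eq_refl) im_le_Cmod).
symmetry; apply surjective_pairing.
Qed.

Lemma csums_CSeries (a : nat -> C) (l : C) : csums a l -> CSeries a = l.
Proof.
intros H; rewrite <- (clim_CLim_seq (fun n => csum a (S n)) l).
- assert (E : forall p : C -> R, (forall z w : C, p (z + w)%C = (p z + p w)%R) -> p 0 = 0%R ->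
    Series (fun n => p (a n)) = real (Lim_seq (fun n => p (csum a (S n))))).
  { intros p Hp H0; unfold Series; f_equal; apply Lim_seq_ext; intros n.
    induction n as [|n IH].
    - rewrite sum_O; simpl; rewrite Hp, H0; ring.
    - rewrite sum_Sn, IH; change (csum a (S (S n))) with (csum a (S n) + a (S n)).
      rewrite Hp; reflexivity. }
  unfold CSeries, CLim_seq.
  rewrite (E Re (fun _ _ => eq_refl) eq_refl), (E Im (fun _ _ => eq_refl) eq_refl); reflexivity.
- intros e He; destruct (H e He) as [N HN]; exists N; intros n Hn; apply HN; lia.
Qed.

(** * Power series with bounded coefficients and their dilations *)

Lemma bounded_csums (b : nat -> C) (K : R) (w : C) : (forall n, (Cmod (b n) <= K)%R) ->
  (Cmod w < 1)%R -> exists l, powser b w l /\ (Cmod (l - b 0%nat) <= K / (1 - Cmod w) * Cmod w)%R.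
Proof.
intros HK Hw; assert (P := Cmod_ge_0 w).
destruct (geom_csums (fun n => b n * w ^ n) K (Cmod w)) as [l [Hl T]]; [lra| |].
- intros k; rewrite Cmod_mult, Cmod_pow; apply Rmult_le_compat_r; [apply pow_le; lra | apply HK].
- exists l; split; [exact Hl|]; specialize (T 1%nat); simpl in T.
  replace (0 + b 0%nat * 1 - l) with (- (l - b 0%nat)) in T by ring.
  rewrite Cmod_opp, Rmult_1_r in T; exact T.
Qed.

Lemma Cmod_scaled (Q : R) (n : nat) (w : C) : (0 < Q < 1)%R ->
  Cmod (RtoC (Q ^ n) * w) = (Q ^ n * Cmod w)%R.
Proof.
intros HQ; rewrite Cmod_mult, Cmod_R, Rabs_right; [reflexivity|].
apply Rle_ge, pow_le; lra.
Qed.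

Lemma Cmod_scaled_lt (Q : R) (n : nat) (w : C) : (0 < Q < 1)%R -> (Cmod w < 1)%R ->
  (Cmod (RtoC (Q ^ n) * w) < 1)%R.
Proof.
intros HQ Hw; rewrite Cmod_scaled by exact HQ.
assert (P := Cmod_ge_0 w).
assert (P1 : (Q ^ n <= 1)%R) by (rewrite <- (pow1 n); apply pow_incr; lra).
assert (P2 : (0 < Q ^ n)%R) by (apply pow_lt; lra).
nra.
Qed.

Lemma Cmod_scaled_lt_1 (Q : R) (w : C) : (0 < Q < 1)%R -> (Cmod w < 1)%R ->
  (Cmod (RtoC Q * w) < 1)%R.
Proof.
intros HQ Hw; assert (T := Cmod_scaled_lt Q 1 w HQ Hw); rewrite pow_1 in T; exact T.
Qed.

Lemma scaled_S (Q : R) (n : nat) (w : C) : RtoC (Q ^ S n) * w = RtoC Q * (RtoC (Q ^ n) * w).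
Proof. change (Q ^ S n)%R with (Q * Q ^ n)%R; rewrite RtoC_mult; ring. Qed.

(** Iterating a functional equation between g(w) and g(Q w) leads to a finite product times g(Q^n
    w); this limit completes the passage to infinite products. *)
Lemma bounded_dilation (b : nat -> C) (K Q : R) (g : C -> C) (w : C) : (0 < Q < 1)%R ->
  (forall n, (Cmod (b n) <= K)%R) -> (forall v, (Cmod v < 1)%R -> powser b v (g v)) ->
  (Cmod w < 1)%R -> clim (fun n => g (RtoC (Q ^ n) * w)) (b 0%nat).
Proof.
intros HQ HK Hg Hw e He; assert (P := Cmod_ge_0 w).
assert (PK : (0 <= K)%R) by (assert (T := Cmod_ge_0 (b 0%nat)); specialize (HK 0%nat); lra).
set (D := (K / (1 - Cmod w))%R).
assert (HD : (0 <= D)%R) by (apply Rmult_le_pos; [lra | left; apply Rinv_0_lt_compat; lra]).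
destruct (geom_small Q D e) as [N HN]; [lra|exact HD|exact He|].
exists N; intros n Hn; specialize (HN n Hn).
assert (Pn : (0 < Q ^ n)%R) by (apply pow_lt; lra).
assert (Hlt := Cmod_scaled_lt Q n w HQ Hw).
assert (Hle : (Cmod (RtoC (Q ^ n) * w) <= Cmod w)%R).
{ rewrite Cmod_scaled by exact HQ.
  assert (P1 : (Q ^ n <= 1)%R) by (rewrite <- (pow1 n); apply pow_incr; lra). nra. }
destruct (bounded_csums b K _ HK Hlt) as [l [Hl T]].
rewrite (csums_unique _ _ _ (Hg _ Hlt) Hl).
eapply Rle_lt_trans; [exact T|].
apply Rle_lt_trans with (D * Q ^ n)%R; [|exact HN].
apply Rmult_le_compat; [| apply Cmod_ge_0 | |].
- apply Rmult_le_pos; [lra | left; apply Rinv_0_lt_compat; lra].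
- apply Rmult_le_compat_l; [lra|]; apply Rinv_le_contravar; lra.
- rewrite Cmod_scaled by exact HQ; nra.
Qed.

(** The factor 1 - Q^n cancels the last factor in the denominator of q-hypergeometric coefficients,
    so recursions for coefficients become functional equations. *)
Lemma powser_dilation (b : nat -> C) (Q : R) (w l m : C) :
  powser b w l -> powser b (RtoC Q * w) m ->
  powser (fun n => RtoC (1 - Q ^ n) * b n) w (l - m).
Proof.
intros H1 H2; generalize (csums_minus _ _ _ _ H1 H2); apply csums_ext; intros n.
rewrite Cpow_mult_l, <- RtoC_pow, RtoC_minus; ring.
Qed.

Lemma bounded_powser_fun (b : nat -> C) (K : R) : (forall n, (Cmod (b n) <= K)%R) ->
  exists g : C -> C, forall v, (Cmod v < 1)%R -> powser b v (g v).
Proof.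
intros HK.
assert (H : forall v, exists l, (Cmod v < 1)%R -> powser b v l).
{ intros v; destruct (Rlt_dec (Cmod v) 1) as [L|L].
  - destruct (bounded_csums b K v HK L) as [l [Hl _]]; exists l; auto.
  - exists 0; intros; contradiction. }
exists (fun v => proj1_sig (constructive_indefinite_description _ (H v))); intros v.
exact (proj2_sig (constructive_indefinite_description _ (H v))).
Qed.

Lemma inv_qfact_bounded (Q : R) : (0 < Q < 1)%R ->
  exists K, forall n, (Cmod (/ RtoC (qfact Q n)) <= K)%R.
Proof.
intros HQ; set (B := (Q / (1 - Q) ^ 2)%R).
assert (HB : (0 < B)%R) by (apply Rdiv_lt_0_compat; [lra | apply pow_lt; lra]).
exists (exp B); intros n.
assert (Pn := qfact_pos Q n HQ).
rewrite <- RtoC_inv, Cmod_R, Rabs_right by (try apply Rle_ge; try left; try apply Rinv_0_lt_compat; lra).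
(* A bound that survives induction: B is chosen so that B (Q^n - Q^(n+1)) = Q^(n+1) / (1 - Q), the
   exponent contributed by the factor 1 / (1 - Q^(n+1)). *)
apply Rle_trans with (exp (B * (1 - Q ^ n))).
- induction n as [|n IH].
  + simpl; rewrite Rinv_1; apply exp_ge_1; nra.
  + assert (F := qfact_pos Q n HQ); specialize (IH F).
    assert (H := pow_lt_1 Q n HQ).
    change (qfact Q (S n)) with (qfact Q n * (1 - Q ^ S n))%R.
    rewrite Rinv_mult.
    assert (H1 : (/ (1 - Q ^ S n) <= exp (Q ^ S n / (1 - Q)))%R).
    { eapply Rle_trans; [|apply exp_ineq1_le].
      replace (/ (1 - Q ^ S n))%R with (1 + Q ^ S n * / (1 - Q ^ S n))%R by (field; lra).
      apply Rplus_le_compat_l, Rmult_le_compat_l; [lra|].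
      apply Rinv_le_contravar; [lra|].
      assert (Q ^ S n <= Q)%R; [|lra].
      rewrite <- (pow_1 Q) at 2; apply pow_le_anti; [exact HQ | lia]. }
    apply Rle_trans with (exp (B * (1 - Q ^ n)) * exp (Q ^ S n / (1 - Q)))%R.
    * apply Rmult_le_compat; try (left; apply Rinv_0_lt_compat); lra.
    * rewrite <- exp_plus; apply exp_le_compat; right; unfold B; simpl; field; lra.
- apply exp_le_compat; assert (0 < Q ^ n)%R by (apply pow_lt; lra); nra.
Qed.

(* Euler: (z;Q)_N sum z^m/(Q;Q)_m telescopes to the same series at Q^N z, which tends to 1. *)
Lemma qpoch_converges (z : C) (Q : R) : (0 < Q < 1)%R -> (Cmod z < 1)%R ->
  exists l : C, l <> 0 /\ clim (qpoch z Q) l.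
Proof.
intros HQ Hz.
destruct (inv_qfact_bounded Q HQ) as [K HK].
destruct (bounded_powser_fun _ K HK) as [g Hg].
assert (FE : forall v, (Cmod v < 1)%R -> (1 - v) * g v = g (RtoC Q * v)).
{ intros v Hv.
  assert (Hv' : (Cmod (RtoC Q * v) < 1)%R).
  { apply Cmod_scaled_lt_1; assumption. }
  assert (E1 := powser_dilation _ Q v _ _ (Hg v Hv) (Hg _ Hv')).
  apply csums_shift in E1.
  assert (E2 := csums_scal v _ _ (Hg v Hv)).
  assert (E3 : v * g v = g v - g (RtoC Q * v)).
  { apply (csums_unique _ _ _ E2); revert E1.
    replace (g v - g (RtoC Q * v) - RtoC (1 - Q ^ 0) * / RtoC (qfact Q 0) * v ^ 0)
      with (g v - g (RtoC Q * v)) by (rewrite (Rminus_diag_eq 1 (Q ^ 0)) by reflexivity; ring).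
    apply csums_ext; intros n.
    assert (F := qfact_pos Q n HQ); assert (H := pow_lt_1 Q n HQ).
    change (qfact Q (S n)) with (qfact Q n * (1 - Q ^ S n))%R.
    change (v ^ S n) with (v * v ^ n).
    assert (N1 : RtoC (qfact Q n) <> 0) by (apply RtoC_neq_0; lra).
    assert (N2 : RtoC (1 - Q ^ S n) <> 0) by (apply RtoC_neq_0; lra).
    rewrite RtoC_mult; field; auto. }
  replace ((1 - v) * g v) with (g v - v * g v) by ring; rewrite E3; ring. }
assert (T : forall N, qpoch z Q N * g z = g (RtoC (Q ^ N) * z)).
{ induction N as [|N IH].
  - simpl; replace (1 * z) with z by ring; ring.
  - rewrite qpoch_S_r.
    rewrite (scaled_S Q N z).
    rewrite <- FE by (apply Cmod_scaled_lt; assumption).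
    rewrite <- IH; ring. }
assert (L := bounded_dilation _ K Q g z HQ HK Hg Hz); simpl in L.
replace (/ 1) with (RtoC 1) in L by field.
assert (G0 : g z <> 0).
{ intros E; apply (clim_ext _ (fun _ => 0)) in L.
  - assert (B := clim_unique _ _ _ L (clim_const 0)).
    apply (f_equal fst) in B; simpl in B; lra.
  - intros n; rewrite <- T, E; ring. }
exists (/ g z); split; [apply Cinv_neq_0; exact G0|].
apply (clim_ext (fun n => g (RtoC (Q ^ n) * z) * / g z)).
- intros n; rewrite <- T; field; exact G0.
- assert (M := clim_mult _ _ _ _ L (clim_const (/ g z))); rewrite Cmult_1_l in M; exact M.
Qed.

Lemma qpoch_inf_eq (z : C) (Q : R) : (0 < Q < 1)%R -> (Cmod z < 1)%R ->
  qpoch_inf z Q <> 0 /\ clim (qpoch z Q) (qpoch_inf z Q).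
Proof.
intros HQ Hz; destruct (qpoch_converges z Q HQ Hz) as [l [Hl H]].
unfold qpoch_inf; rewrite (clim_CLim_seq _ _ H); auto.
Qed.

(** The q-binomial theorem in base q^2, obtained by iterating (1 - v^2) g(v) = (1 - q v^2) g(q v).
    It shows that the prefactor in the definition of the q-exponential function is 1/c. *)
Lemma ufun_0_sum (q : R) (alpha c : C) : (0 < q < 1)%R -> (Cmod alpha < 1)%R ->
  powser (fun n => ufun q n 0) alpha c ->
  qpoch_inf (alpha ^ 2) (q ^ 2) * c = qpoch_inf (RtoC q * alpha ^ 2) (q ^ 2).
Proof.
intros Hq Ha Hc.
assert (HK := fun n => ufun_0_bound q n Hq).
destruct (bounded_powser_fun _ 1 HK) as [g Hg].
assert (Ec : c = g alpha) by (apply (csums_unique _ _ _ Hc), Hg; exact Ha).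
assert (FE : forall v, (Cmod v < 1)%R -> (1 - v ^ 2) * g v = (1 - RtoC q * v ^ 2) * g (RtoC q * v)).
{ intros v Hv.
  assert (Hv' : (Cmod (RtoC q * v) < 1)%R).
  { apply Cmod_scaled_lt_1; assumption. }
  assert (E1 := powser_dilation _ q v _ _ (Hg v Hv) (Hg _ Hv')).
  apply csums_shift, csums_shift in E1.
  rewrite ufun_1_0, (Rminus_diag_eq 1 (q ^ 0)) in E1 by (exact Hq || reflexivity).
  assert (E2 := csums_scal (v ^ 2) _ _ (csums_minus _ _ _ _ (Hg v Hv)
     (csums_scal (RtoC q) _ _ (Hg _ Hv')))).
  assert (E3 : v ^ 2 * (g v - RtoC q * g (RtoC q * v)) = g v - g (RtoC q * v)).
  { apply (csums_unique _ _ _ E2); revert E1.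
    match goal with |- csums _ ?X -> _ => replace X with (g v - g (RtoC q * v)) by ring end.
    apply csums_ext; intros n.
    rewrite ufun_0_SS by exact Hq.
    assert (H := pow_lt_1 q n Hq); assert (H2 := pow_lt_1 q (S n) Hq).
    assert (N2 : RtoC (1 - q ^ S (S n)) <> 0) by (apply RtoC_neq_0; lra).
    rewrite RtoC_div, Cpow_mult_l, <- RtoC_pow by lra.
    change (v ^ S (S n)) with (v * (v * v ^ n)).
    replace (RtoC (1 - q ^ S n)) with (1 - RtoC q * RtoC (q ^ n))
      by (rewrite <- RtoC_mult, <- RtoC_minus; reflexivity).
    simpl Cpow; field; exact N2. }
  replace ((1 - v ^ 2) * g v) with (g v - v ^ 2 * (g v - RtoC q * g (RtoC q * v)) - v ^ 2 * RtoC q * g (RtoC q * v))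
    by ring.
  rewrite E3; ring. }
assert (T : forall N, qpoch (alpha ^ 2) (q ^ 2) N * g alpha
    = qpoch (RtoC q * alpha ^ 2) (q ^ 2) N * g (RtoC (q ^ N) * alpha)).
{ induction N as [|N IH].
  - simpl qpoch; simpl pow; replace (RtoC 1 * alpha) with alpha by ring; ring.
  - rewrite !qpoch_S_r.
    rewrite (scaled_S q N alpha).
    assert (F := FE (RtoC (q ^ N) * alpha) ltac:(apply Cmod_scaled_lt; assumption)).
    replace (RtoC ((q ^ 2) ^ N)) with (RtoC (q ^ N) * RtoC (q ^ N))
      by (rewrite <- RtoC_mult, <- pow_mult, <- pow_add; do 2 f_equal; lia).
    replace ((RtoC (q ^ N) * alpha) ^ 2) with (alpha ^ 2 * (RtoC (q ^ N) * RtoC (q ^ N))) in F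
      by (simpl Cpow; ring).
    transitivity ((1 - alpha ^ 2 * (RtoC (q ^ N) * RtoC (q ^ N))) *
       (qpoch (alpha ^ 2) (q ^ 2) N * g alpha)); [ring|].
    rewrite IH.
    transitivity (qpoch (RtoC q * alpha ^ 2) (q ^ 2) N *
       ((1 - alpha ^ 2 * (RtoC (q ^ N) * RtoC (q ^ N))) * g (RtoC (q ^ N) * alpha))); [ring|].
    rewrite F; ring. }
assert (P := Cmod_ge_0 alpha).
assert (Hq2 : (0 < q ^ 2 < 1)%R) by (apply (pow_lt_1 q 1 Hq)).
assert (Ha2 : (Cmod (alpha ^ 2) < 1)%R) by (rewrite Cmod_pow; simpl; nra).
assert (Hqa2 : (Cmod (RtoC q * alpha ^ 2) < 1)%R).
{ apply Cmod_scaled_lt_1; assumption. }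
destruct (qpoch_inf_eq (alpha ^ 2) (q ^ 2) Hq2 Ha2) as [_ L1].
destruct (qpoch_inf_eq (RtoC q * alpha ^ 2) (q ^ 2) Hq2 Hqa2) as [_ L2].
assert (L3 := bounded_dilation _ 1 q g alpha Hq HK Hg Ha); simpl in L3.
rewrite ufun_0_0 in L3 by exact Hq.
rewrite Ec; apply (clim_unique _ _ _ (clim_mult _ _ _ _ L1 (clim_const (g alpha)))).
generalize (clim_mult _ _ _ _ L2 L3).
replace (qpoch_inf (RtoC q * alpha ^ 2) (q ^ 2) * 1) with (qpoch_inf (RtoC q * alpha ^ 2) (q ^ 2)) by ring.
apply clim_ext; intros n; symmetry; apply T.
Qed.

(** By [ufun_expansion] the defining series is the Cauchy product of the series of the v_n(x) with
    that of the u_n(0), and the prefactor cancels the latter. *)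
Lemma qexp_powser (q : R) (x alpha : C) : (0 < q < 1)%R -> (Cmod alpha < 1)%R ->
  powser (fun n => vfun q n x) alpha (qexp q x alpha).
Proof.
intros Hq Ha; assert (P := Cmod_ge_0 alpha).
destruct (vfun_bounded q x Hq) as [K [HK B]].
assert (Bu := fun n => ufun_0_bound q n Hq).
destruct (bounded_csums _ K alpha B Ha) as [V [HV _]].
destruct (bounded_csums _ 1 alpha Bu Ha) as [c [Hc _]].
assert (Bnd : forall b, (forall n, (Cmod (b n) <= K + 1)%R) ->
    forall n, (Cmod (b n * alpha ^ n) <= (K + 1) * Cmod alpha ^ n)%R).
{ intros b Hb n; rewrite Cmod_mult, Cmod_pow; apply Rmult_le_compat_r; [apply pow_le; exact P | apply Hb]. }
assert (Pr := cauchy_product _ _ (K + 1) (Cmod alpha) _ _ (conj P Ha)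
   (Bnd (fun n => vfun q n x) ltac:(intros n; specialize (B n); simpl in B; lra))
   (Bnd (fun n => ufun q n 0) ltac:(intros n; specialize (Bu n); simpl in Bu; lra)) HV Hc).
assert (HU : csums (fun n => ufun q n x * alpha ^ n) (V * c)).
{ revert Pr; apply csums_ext; intros n.
  rewrite (ufun_expansion q n x Hq), (Cmult_comm _ (alpha ^ n)), <- csum_scal.
  apply csum_ext; intros k Hk.
  replace (alpha ^ n) with (alpha ^ k * alpha ^ (n - k)); [ring|].
  rewrite <- Cpow_add_r; f_equal; lia. }
replace (qexp q x alpha) with V; [exact HV|].
unfold qexp; destruct (Rlt_dec (Cmod alpha) 1) as [_|N]; [|contradiction].
unfold qexp_series.
rewrite (csums_CSeries _ (V * c)).
2:{ revert HU; apply csums_ext; intros n.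
    unfold ufun, phi, qexp_coef.
    assert (F := qfact_pos q n Hq).
    rewrite qpoch_qfact, RtoC_div, Cpow_mult_l by lra.
    field; apply RtoC_neq_0; lra. }
assert (Hq2 : (0 < q ^ 2 < 1)%R) by (apply (pow_lt_1 q 1 Hq)).
assert (Ha2 : (Cmod (alpha ^ 2) < 1)%R) by (rewrite Cmod_pow; simpl; nra).
assert (Hqa2 : (Cmod (RtoC q * alpha ^ 2) < 1)%R).
{ apply Cmod_scaled_lt_1; assumption. }
destruct (qpoch_inf_eq (RtoC q * alpha ^ 2) (q ^ 2) Hq2 Hqa2) as [N2 _].
rewrite <- (ufun_0_sum q alpha c Hq Ha Hc) in N2 |- *.
assert (N3 : qpoch_inf (alpha ^ 2) (q ^ 2) <> 0) by (intros E; apply N2; rewrite E; ring).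
assert (N4 : c <> 0) by (intros E; apply N2; rewrite E; ring).
field; auto.
Qed.

(** * The q-exponential function at eta *)

(** These are (-q^(-1/2);q)_n q^(n/2) / (q;q)_n, the Taylor coefficients of (-w;q)_oo / (q^(1/2)
    w;q)_oo. *)
Fixpoint eta_coef (q : R) (n : nat) : R :=
  match n with
  | O => 1%R
  | S m => (eta_coef q m * (Rpower q (1/2) + q ^ m) / (1 - q ^ S m))%R
  end.

(** At eta the quadratic factor is q^(1/2) + q^(-1/2) + q^n + q^(-n), and q^(n+1) times it splits as
    (q^(1/2) + q^n) (q^(1/2) + q^(n+1)), which accounts for two steps of [eta_coef]. *)
Lemma vfun_eta (q : R) (n : nat) : (0 < q < 1)%R ->
  vfun q n (RtoC (eta q)) = RtoC (eta_coef q n).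
Proof.
intros Hq.
set (g := Rpower q (1/4)).
assert (Pg : (0 < g)%R) by apply exp_pos.
assert (Eg : (g * g = Rpower q (1/2))%R) by (unfold g; rewrite <- Rpower_plus; f_equal; field).
assert (Ep := Rpower_half_sqr q ltac:(lra)).
assert (Eeta : eta q = ((g + / g) / 2)%R).
{ unfold eta; replace (-1/4)%R with (- (1/4))%R by field; rewrite Rpower_Ropp; reflexivity. }
induction n as [| |n IH] using two_step_ind.
- apply vfun_0_l; exact Hq.
- unfold vfun; rewrite rho_rho_poly by lra.
  change (RtoC (qexp_coef q 1) * (2 * RtoC (eta q)) = RtoC (eta_coef q 1)).
  rewrite <- !RtoC_mult; f_equal.
  rewrite qexp_coef_S by exact Hq; unfold qexp_coef; simpl; rewrite <- Eg, Eeta; fold g.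
  replace (0 * (0 * 1) / 4)%R with 0%R by field; rewrite Rpower_O by lra; field; lra.
- assert (H1 := pow_lt_1 q n Hq); assert (H2 := pow_lt_1 q (S n) Hq).
  unfold vfun in *; rewrite rho_rho_poly in * by lra.
  change (rho_poly q (RtoC (eta q)) (S (S n))) with
    ((4 * RtoC (eta q) ^ 2 + RtoC (q ^ n + / q ^ n - 2)) * rho_poly q (RtoC (eta q)) n).
  rewrite qexp_coef_SS by exact Hq.
  set (t := (q ^ S n)%R) in *; set (t2 := (q ^ S (S n))%R) in *.
  assert (Pn : (0 < q ^ n)%R) by (apply pow_lt; lra).
  transitivity (RtoC (t / ((1 - t) * (1 - t2)) * (4 * eta q ^ 2 + (q ^ n + / q ^ n - 2)))
     * (RtoC (qexp_coef q n) * rho_poly q (RtoC (eta q)) n)).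
  + replace (qexp_coef q n * t / ((1 - t) * (1 - t2)))%R
      with (qexp_coef q n * (t / ((1 - t) * (1 - t2))))%R by (field; lra).
    rewrite !RtoC_mult, RtoC_plus, RtoC_mult, RtoC_pow; ring.
  + rewrite IH, <- RtoC_mult; f_equal.
    change (eta_coef q (S (S n))) with
      (eta_coef q n * (Rpower q (1/2) + q ^ n) / (1 - t) * (Rpower q (1/2) + t) / (1 - t2))%R.
    rewrite Eeta, <- Eg.
    assert (Et : t = (g * g * (g * g) * q ^ n)%R) by (rewrite !Eg, Ep; reflexivity).
    transitivity (t * (4 * ((g + / g) / 2) ^ 2 + (q ^ n + / q ^ n - 2))
       * (eta_coef q n / ((1 - t) * (1 - t2))))%R; [field; lra|].
    transitivity ((g * g + q ^ n) * (g * g + t) * (eta_coef q n / ((1 - t) * (1 - t2))))%R;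
      [|field; lra].
    f_equal; rewrite Et; field; lra.
Qed.

Definition hfun (q : R) (w : C) : C := qexp q (RtoC (eta q)) w.

Lemma hfun_eq (q : R) (w : C) : (0 < q < 1)%R -> (Cmod w < 1)%R ->
  (1 - RtoC (Rpower q (1/2)) * w) * hfun q w = (1 + w) * hfun q (RtoC q * w).
Proof.
intros Hq Hw.
assert (Hw' : (Cmod (RtoC q * w) < 1)%R).
{ apply Cmod_scaled_lt_1; assumption. }
assert (P1 := qexp_powser q (RtoC (eta q)) w Hq Hw).
assert (P2 := qexp_powser q (RtoC (eta q)) _ Hq Hw').
fold (hfun q w) in P1; fold (hfun q (RtoC q * w)) in P2.
assert (E1 := powser_dilation _ q w _ _ P1 P2).
apply csums_shift in E1.
assert (E2 := csums_scal w _ _ (csums_plus _ _ _ _ (csums_scal (RtoC (Rpower q (1/2))) _ _ P1) P2)).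
assert (E3 : w * (RtoC (Rpower q (1/2)) * hfun q w + hfun q (RtoC q * w)) = hfun q w - hfun q (RtoC q * w)).
{ apply (csums_unique _ _ _ E2); revert E1.
  rewrite (Rminus_diag_eq 1 (q ^ 0)) by reflexivity.
  match goal with |- csums _ ?X -> _ =>
    replace X with (hfun q w - hfun q (RtoC q * w)) by ring end.
  apply csums_ext; intros n.
  assert (H := pow_lt_1 q n Hq).
  assert (N2 : RtoC (1 - q ^ S n) <> 0) by (apply RtoC_neq_0; lra).
  rewrite !vfun_eta by exact Hq.
  change (eta_coef q (S n)) with (eta_coef q n * (Rpower q (1/2) + q ^ n) / (1 - q ^ S n))%R.
  rewrite RtoC_div, RtoC_mult, RtoC_plus, Cpow_mult_l, <- RtoC_pow by lra.
  change (w ^ S n) with (w * w ^ n); field; exact N2. }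
replace ((1 - RtoC (Rpower q (1/2)) * w) * hfun q w)
  with (hfun q w - w * (RtoC (Rpower q (1/2)) * hfun q w + hfun q (RtoC q * w)) + w * hfun q (RtoC q * w))
  by ring.
rewrite E3; ring.
Qed.

Lemma hfun_lim (q : R) (w : C) : (0 < q < 1)%R -> (Cmod w < 1)%R ->
  clim (fun n => hfun q (RtoC (q ^ n) * w)) 1.
Proof.
intros Hq Hw; destruct (vfun_bounded q (RtoC (eta q)) Hq) as [K [_ B]].
rewrite <- (vfun_0_l q (RtoC (eta q)) Hq).
apply (bounded_dilation (fun n => vfun q n (RtoC (eta q))) K); auto.
intros v Hv; apply qexp_powser; assumption.
Qed.

Lemma one_plus_neq_0 (w : C) : (Cmod w < 1)%R -> 1 + w <> 0.
Proof.
intros Hw E; assert (H : w = - (1)) by (replace w with (1 + w - 1) by ring; rewrite E; ring).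
rewrite H, Cmod_opp, Cmod_1 in Hw; lra.
Qed.

(** By [hfun_eq] a zero at w propagates to all q^n w, as 1 + q^n w never vanishes; this contradicts
    the limit 1 along that sequence. *)
Lemma hfun_neq_0 (q : R) (w : C) : (0 < q < 1)%R -> (Cmod w < 1)%R -> hfun q w <> 0.
Proof.
intros Hq Hw E.
assert (Z : forall n, hfun q (RtoC (q ^ n) * w) = 0).
{ induction n as [|n IH]; [simpl; replace (1 * w) with w by ring; exact E|].
  assert (Hn := Cmod_scaled_lt q n w Hq Hw).
  assert (F := hfun_eq q _ Hq Hn); rewrite IH in F.
  rewrite <- (scaled_S q n w) in F.
  assert (N := one_plus_neq_0 _ Hn).
  replace (hfun q (RtoC (q ^ S n) * w)) with (/ (1 + RtoC (q ^ n) * w) *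
    ((1 + RtoC (q ^ n) * w) * hfun q (RtoC (q ^ S n) * w))) by (field; exact N).
  rewrite <- F; ring. }
assert (B := clim_unique _ _ _ (clim_ext _ _ _ Z (hfun_lim q w Hq Hw)) (clim_const 0)).
apply (f_equal fst) in B; simpl in B; lra.
Qed.

Lemma Cmod_one_minus_le (w : C) : (0 <= Re w)%R -> (Cmod (1 - w) <= Cmod (1 + w))%R.
Proof.
intros H; unfold Cmod; apply sqrt_le_1_alt; destruct w as [a b]; simpl in *; nra.
Qed.

Lemma Cmod_one_minus_lt (w : C) : (0 < Re w)%R -> (Cmod (1 - w) < Cmod (1 + w))%R.
Proof.
intros H; unfold Cmod; apply sqrt_lt_1_alt; split.
- apply Rplus_le_le_0_compat; apply pow2_ge_0.
- destruct w as [a b]; simpl in *; nra.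
Qed.

(* For Re w > 0 each factor of the product for h(-w)/h(w) has modulus at most 1,
   and the first one less than 1. *)
Lemma hfun_opp_lt (q : R) (w : C) : (0 < q < 1)%R -> (Cmod w < 1)%R -> (0 < Re w)%R ->
  (Cmod (hfun q (- w)) < Cmod (hfun q w))%R.
Proof.
intros Hq Hw Hre.
assert (Hp := Rpower_half_lt q Hq); set (p := Rpower q (1/2)) in *.
(* One step of the product without divisions: the ratio |h(-u) / h(u)| is at most the same ratio at
   q u times |1 - u| / |1 + u|. *)
assert (St : forall u, (Cmod u < 1)%R -> (0 < Re u)%R ->
  (Cmod (hfun q (- u)) * Cmod (hfun q (RtoC q * u)) * Cmod (1 + u)
   <= Cmod (hfun q u) * Cmod (hfun q (- (RtoC q * u))) * Cmod (1 - u))%R).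
{ intros u Hu Hru.
  assert (Hu' : (Cmod (- u) < 1)%R) by (rewrite Cmod_opp; exact Hu).
  assert (F1 := hfun_eq q u Hq Hu); assert (F2 := hfun_eq q (- u) Hq Hu'); fold p in F1, F2.
  replace (1 - RtoC p * - u) with (1 + RtoC p * u) in F2 by ring.
  replace (1 + - u) with (1 - u) in F2 by ring.
  replace (RtoC q * - u) with (- (RtoC q * u)) in F2 by ring.
  apply (f_equal Cmod) in F1; apply (f_equal Cmod) in F2; rewrite !Cmod_mult in F1, F2.
  assert (L : (Cmod (1 - RtoC p * u) <= Cmod (1 + RtoC p * u))%R).
  { apply Cmod_one_minus_le; destruct u as [a b]; unfold Re in *; simpl fst in *.
    assert (0 < p * a)%R by (apply Rmult_lt_0_compat; lra); lra. }
  assert (Hpu : (Cmod (RtoC p * u) < 1)%R).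
  { rewrite Cmod_mult, Cmod_R, Rabs_right by lra; assert (T := Cmod_ge_0 u); nra. }
  assert (L0 : (0 < Cmod (1 + RtoC p * u))%R) by (apply Cmod_gt_0, one_plus_neq_0; exact Hpu).
  apply Rmult_le_reg_l with (Cmod (1 + RtoC p * u)); [exact L0|].
  set (c := Cmod (1 + RtoC p * u)) in *; set (d := Cmod (1 - RtoC p * u)) in *.
  set (h1 := Cmod (hfun q u)) in *; set (h2 := Cmod (hfun q (- u))) in *.
  set (k1 := Cmod (hfun q (RtoC q * u))) in *; set (k2 := Cmod (hfun q (- (RtoC q * u)))) in *.
  set (e := Cmod (1 + u)) in *; set (e' := Cmod (1 - u)) in *.
  replace (c * (h2 * k1 * e))%R with ((c * h2) * (e * k1))%R by ring; rewrite F2, <- F1.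
  replace (c * (h1 * k2 * e'))%R with (c * (h1 * (k2 * e')))%R by ring.
  replace (e' * k2 * (d * h1))%R with (d * (h1 * (k2 * e')))%R by ring.
  apply Rmult_le_compat_r; [|exact L].
  repeat apply Rmult_le_pos; apply Cmod_ge_0. }
assert (Hk : forall n, let u := RtoC (q ^ n) * w in (Cmod u < 1)%R /\ (0 < Re u)%R).
{ intros n u; split; [apply Cmod_scaled_lt; assumption|].
  assert (P : (0 < q ^ n)%R) by (apply pow_lt; lra).
  unfold u; destruct w as [a b]; unfold Re in *; simpl fst in *.
  assert (0 < q ^ n * a)%R by (apply Rmult_lt_0_compat; lra); lra. }
assert (Pos : forall v, (Cmod v < 1)%R -> (0 < Cmod (hfun q v))%R)
  by (intros; apply Cmod_gt_0, hfun_neq_0; assumption).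
assert (Opp : forall v, (Cmod v < 1)%R -> (0 < Cmod (hfun q (- v)))%R)
  by (intros; apply Pos; rewrite Cmod_opp; assumption).
(* Chaining the steps compares the ratio at u with that at q^n u, which tends to 1. *)
assert (Ch : forall n u, (forall k, (Cmod (RtoC (q ^ k) * u) < 1)%R /\ (0 < Re (RtoC (q ^ k) * u))%R) ->
  (Cmod (hfun q (- u)) * Cmod (hfun q (RtoC (q ^ n) * u))
   <= Cmod (hfun q u) * Cmod (hfun q (- (RtoC (q ^ n) * u))))%R).
{ induction n as [|n IH]; intros u Hu.
  - simpl; replace (1 * u) with u by ring; lra.
  - specialize (IH u Hu); destruct (Hu n) as [U1 U2].
    assert (S1 := St _ U1 U2).
    rewrite (scaled_S q n u).
    assert (V1 : (Cmod (RtoC q * (RtoC (q ^ n) * u)) < 1)%R).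
    { rewrite <- (scaled_S q n u).
      apply Hu. }
    assert (LL := Cmod_one_minus_lt _ U2).
    assert (W0 : (Cmod u < 1)%R) by (destruct (Hu 0%nat) as [T _]; simpl in T; replace (1 * u) with u in T by ring; exact T).
    set (v := RtoC (q ^ n) * u) in *.
    assert (Q1 := Pos v U1); assert (Q2 := Opp v U1); assert (Q3 := Pos _ V1); assert (Q4 := Opp _ V1).
    assert (Q5 := Pos u W0); assert (Q6 := Opp u W0).
    set (a := Cmod (hfun q (- u))) in *; set (b := Cmod (hfun q u)) in *.
    set (c := Cmod (hfun q v)) in *; set (d := Cmod (hfun q (- v))) in *.
    set (c' := Cmod (hfun q (RtoC q * v))) in *; set (d' := Cmod (hfun q (- (RtoC q * v)))) in *.
    set (e := Cmod (1 + v)) in *; set (e' := Cmod (1 - v)) in *.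
    assert (E0 : (0 <= e')%R) by apply Cmod_ge_0.
    assert (S2 : (d * c' <= c * d')%R).
    { apply Rmult_le_reg_r with e; [lra|].
      eapply Rle_trans; [exact S1|]; apply Rmult_le_compat_l; [nra | lra]. }
    apply Rmult_le_reg_r with (c * d)%R; [nra|].
    replace (a * c' * (c * d))%R with ((a * c) * (d * c'))%R by ring.
    replace (b * d' * (c * d))%R with ((b * d) * (c * d'))%R by ring.
    apply Rmult_le_compat; nra. }
(* The limit preserves only the weak inequality, so it is taken at q w; the strict factor |1 - w| <
   |1 + w| of the step from w to q w is kept in reserve. *)
assert (Q : (Cmod (hfun q (- (RtoC q * w))) <= Cmod (hfun q (RtoC q * w)))%R).
{ assert (Hqw : forall k, (Cmod (RtoC (q ^ k) * (RtoC q * w)) < 1)%R /\ (0 < Re (RtoC (q ^ k) * (RtoC q * w)))%R).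
  { intros k; replace (RtoC (q ^ k) * (RtoC q * w)) with (RtoC (q ^ S k) * w)
      by (change (q ^ S k)%R with (q * q ^ k)%R; rewrite RtoC_mult; ring). apply Hk. }
  set (u := RtoC q * w) in *.
  assert (U0 : (Cmod u < 1)%R).
  { destruct (Hqw 0%nat) as [T _]; simpl in T; replace (1 * u) with u in T by ring; exact T. }
  assert (L1 := hfun_lim q u Hq U0).
  assert (L2 := hfun_lim q (- u) Hq ltac:(rewrite Cmod_opp; exact U0)).
  assert (P1 := Pos u U0).
  apply le_epsilon; intros e He.
  set (M := (Cmod (hfun q u) + Cmod (hfun q (- u)) + 1)%R).
  assert (PM : (1 < M)%R) by (assert (T := Opp u U0); unfold M; lra).
  destruct (L1 (e / (2 * M))%R) as [N1 H1]; [apply Rdiv_lt_0_compat; lra|].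
  destruct (L2 (e / (2 * M))%R) as [N2 H2]; [apply Rdiv_lt_0_compat; lra|].
  specialize (H1 (N1 + N2)%nat ltac:(lia)); specialize (H2 (N1 + N2)%nat ltac:(lia)).
  assert (C1 := Ch (N1 + N2)%nat u Hqw).
  replace (RtoC (q ^ (N1 + N2)) * - u) with (- (RtoC (q ^ (N1 + N2)) * u)) in H2 by ring.
  set (X := hfun q (RtoC (q ^ (N1 + N2)) * u)) in *; set (Y := hfun q (- (RtoC (q ^ (N1 + N2)) * u))) in *.
  assert (T1 := Cmod_triangle X (- (X - 1))); replace (X + - (X - 1)) with (RtoC 1) in T1 by ring.
  assert (T2 := Cmod_triangle (Y - 1) 1); replace (Y - 1 + 1) with Y in T2 by ring.
  rewrite Cmod_opp, Cmod_1 in T1; rewrite Cmod_1 in T2.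
  set (a := Cmod (hfun q (- u))) in *; set (b := Cmod (hfun q u)) in *.
  set (x := Cmod X) in *; set (y := Cmod Y) in *.
  set (eps := (e / (2 * M))%R) in *.
  assert (Ee : (2 * M * eps = e)%R) by (unfold eps; field; lra).
  assert (Pa : (0 <= a)%R) by apply Cmod_ge_0.
  assert (Peps : (0 < eps)%R) by (unfold eps; apply Rdiv_lt_0_compat; lra).
  assert (G1 : (a * (1 - eps) <= b * (1 + eps))%R).
  { apply Rle_trans with (a * x)%R; [apply Rmult_le_compat_l; lra|].
    eapply Rle_trans; [exact C1|]; apply Rmult_le_compat_l; lra. }
  unfold M in Ee; nra. }
assert (S0 := St w Hw Hre).
assert (LL := Cmod_one_minus_lt w Hre).
assert (Hqw : (Cmod (RtoC q * w) < 1)%R).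
{ apply Cmod_scaled_lt_1; assumption. }
assert (Q1 := Pos _ Hqw); assert (Q2 := Pos w Hw); assert (Q3 := Opp w Hw); assert (Q4 := Opp _ Hqw).
assert (E0 : (0 <= Cmod (1 - w))%R) by apply Cmod_ge_0.
set (a := Cmod (hfun q (- w))) in *; set (b := Cmod (hfun q w)) in *.
set (c := Cmod (hfun q (RtoC q * w))) in *; set (d := Cmod (hfun q (- (RtoC q * w)))) in *.
set (e := Cmod (1 + w)) in *; set (e' := Cmod (1 - w)) in *.
destruct (Rlt_or_le a b) as [L|L]; [exact L|exfalso].
assert (B1 : (b * d * e' <= b * c * e')%R) by (apply Rmult_le_compat_r; nra).
assert (B2 : (b * c * e' < b * c * e)%R) by (apply Rmult_lt_compat_l; nra).
assert (B3 : (b * c * e <= a * c * e)%R) by (apply Rmult_le_compat_r; nra).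
lra.
Qed.

Lemma hfun_sum_zero (q : R) (w : C) : (0 < q < 1)%R -> (Cmod w < 1)%R ->
  hfun q w + hfun q (- w) = 0 -> Re w = 0%R.
Proof.
intros Hq Hw E.
assert (E1 : Cmod (hfun q (- w)) = Cmod (hfun q w)).
{ rewrite <- (Cmod_opp (hfun q w)); f_equal.
  replace (hfun q (- w)) with (hfun q w + hfun q (- w) - hfun q w) by ring; rewrite E; ring. }
destruct (Rtotal_order (Re w) 0) as [L|[L|L]]; [|exact L|].
- assert (H := hfun_opp_lt q (- w) Hq ltac:(rewrite Cmod_opp; exact Hw)).
  replace (- - w) with w in H by ring.
  specialize (H ltac:(destruct w; simpl in *; lra)); lra.
- assert (H := hfun_opp_lt q w Hq Hw L); lra.
Qed.

(** * The Euler expansion *)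

Lemma powser_mult (a b : nat -> C) (f g : C -> C) (rad : R) :
  (forall w, (Cmod w < rad)%R -> powser a w (f w)) ->
  (forall w, (Cmod w < rad)%R -> powser b w (g w)) ->
  forall w, (Cmod w < rad)%R ->
    powser (fun n => csum (fun i => a i * b (n - i)%nat) (S n)) w (f w * g w).
Proof.
intros Ha Hb w Hw; assert (P := Cmod_ge_0 w).
set (s := ((Cmod w + rad) / 2)%R).
assert (Hs : (0 < s < rad)%R) by (unfold s; lra).
destruct (powser_coef_bound a f rad s Hs Ha) as [M1 [HM1 B1]].
destruct (powser_coef_bound b g rad s Hs Hb) as [M2 [HM2 B2]].
assert (Hp : (0 <= Cmod w / s < 1)%R).
{ split; [apply Rmult_le_pos; [exact P | left; apply Rinv_0_lt_compat; lra]|].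
  apply Rmult_lt_reg_r with s; [lra|]; unfold Rdiv; rewrite Rmult_assoc, Rinv_l by lra.
  unfold s; lra. }
assert (H := cauchy_product _ _ (M1 + M2) _ _ _ Hp
  (geom_bound_of_coef a (M1 + M2) s w ltac:(lra) ltac:(intros n; specialize (B1 n); lra))
  (geom_bound_of_coef b (M1 + M2) s w ltac:(lra) ltac:(intros n; specialize (B2 n); lra))
  (Ha w Hw) (Hb w Hw)).
revert H; apply csums_ext; intros n.
rewrite (Cmult_comm _ (w ^ n)), <- csum_scal; apply csum_ext; intros k Hk.
replace (w ^ n) with (w ^ k * w ^ (n - k)); [ring|].
rewrite <- Cpow_add_r; f_equal; lia.
Qed.

Lemma csums_even (c : nat -> C) (l : C) :
  csums (fun n => if Nat.even n then c n else 0) l -> csums (fun k => c (2 * k)%nat) l.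
Proof.
intros H e He; destruct (H e He) as [N HN]; exists N; intros n Hn.
specialize (HN (2 * n)%nat ltac:(lia)).
replace (csum (fun k => c (2 * k)%nat) n) with (csum (fun n => if Nat.even n then c n else 0) (2 * n));
  [exact HN|].
clear; induction n as [|n IH]; [reflexivity|].
replace (2 * S n)%nat with (S (S (2 * n))) by lia.
change (csum (fun n0 => if Nat.even n0 then c n0 else 0) (2 * n)
  + (if Nat.even (2 * n) then c (2 * n)%nat else 0)
  + (if Nat.even (S (2 * n)) then c (S (2 * n)) else 0)
  = csum (fun k => c (2 * k)%nat) n + c (2 * n)%nat).
rewrite IH, Nat.even_succ, <- Nat.negb_even, Nat.even_mul.
change (negb (Nat.even 2 || Nat.even n)) with false; change (Nat.even 2 || Nat.even n)%bool with true.
cbv iota; ring.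
Qed.

Lemma csums_odd (c : nat -> C) (l : C) :
  csums (fun n => if Nat.even n then 0 else c n) l -> csums (fun k => c (2 * k + 1)%nat) l.
Proof.
intros H e He; destruct (H e He) as [N HN]; exists N; intros n Hn.
specialize (HN (2 * n)%nat ltac:(lia)).
replace (csum (fun k => c (2 * k + 1)%nat) n) with (csum (fun n => if Nat.even n then 0 else c n) (2 * n));
  [exact HN|].
clear; induction n as [|n IH]; [reflexivity|].
replace (2 * S n)%nat with (S (S (2 * n))) by lia.
change (csum (fun n0 => if Nat.even n0 then 0 else c n0) (2 * n)
  + (if Nat.even (2 * n) then 0 else c (2 * n)%nat)
  + (if Nat.even (S (2 * n)) then 0 else c (S (2 * n)))
  = csum (fun k => c (2 * k + 1)%nat) n + c (2 * n + 1)%nat).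
rewrite IH, Nat.even_succ, <- Nat.negb_even, Nat.even_mul.
replace (2 * n + 1)%nat with (S (2 * n)) by lia.
change (negb (Nat.even 2 || Nat.even n)) with false; change (Nat.even 2 || Nat.even n)%bool with true.
cbv iota; ring.
Qed.

(** The orbit of z = q^(1/4), the point over eta. It avoids z^2 = 1 because the exponent 1/4 + m/2
    is never 0. *)
Definition eta_orbit (q : R) (z : C) : Prop :=
  exists m : Z, z = RtoC (Rpower q (1 / 4 + IZR m / 2)).

Lemma eta_orbit_closed (q : R) : (0 < q < 1)%R -> orbit_closed q (eta_orbit q).
Proof.
intros Hq z [m ->].
assert (P : forall s, (0 < Rpower q s)%R) by (intros; apply exp_pos).
split; [|split; [|split]].
- apply RtoC_neq_0; specialize (P (1/4 + IZR m / 2)%R); lra.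
- rewrite <- RtoC_mult, <- Rpower_plus; intros E; apply (f_equal fst) in E; simpl in E.
  unfold Rpower in E; apply (eq_trans (y := 1%R) (z := exp 0)) in E; [|symmetry; exact exp_0].
  apply exp_inv in E.
  assert (T := ln_increasing q 1 ltac:(lra) ltac:(lra)); rewrite ln_1 in T.
  assert (E2 : (1 / 4 + IZR m / 2 + (1 / 4 + IZR m / 2) = 0)%R)
    by (destruct (Rmult_integral _ _ E); lra).
  assert (E3 : IZR (1 + 2 * m) = 0%R) by (rewrite plus_IZR, mult_IZR; lra).
  apply eq_IZR in E3; lia.
- exists (m + 1)%Z; rewrite <- RtoC_mult, <- Rpower_plus; do 2 f_equal; rewrite plus_IZR; field.
- exists (m - 1)%Z.
  assert (T := Rpower_half_lt q Hq).
  rewrite <- RtoC_inv, <- RtoC_mult, <- Rpower_Ropp, <- Rpower_plus by lra.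
  do 2 f_equal; rewrite minus_IZR; field.
Qed.

Lemma joukowski_eta (q : R) : joukowski (RtoC (Rpower q (1/4))) = RtoC (eta q).
Proof.
assert (P : (0 < Rpower q (1/4))%R) by apply exp_pos.
unfold joukowski, eta; replace (-1/4)%R with (- (1/4))%R by field; rewrite Rpower_Ropp.
rewrite RtoC_div, RtoC_plus, RtoC_inv by lra; reflexivity.
Qed.

Lemma nth_root_lt (n : nat) (y t : R) : (0 < n)%nat -> (0 <= y)%R -> (0 < t)%R ->
  (nth_root n y < t)%R -> (y <= t ^ n)%R.
Proof.
intros Hn Hy Ht H; unfold nth_root in H; destruct (Req_EM_T y 0) as [E|N].
- rewrite E; left; apply pow_lt; exact Ht.
- assert (Pn : (0 < INR n)%R) by (apply lt_0_INR; exact Hn).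
  replace y with ((Rpower y (/ INR n)) ^ n)%R.
  + apply pow_incr; split; [left; apply exp_pos | lra].
  + rewrite <- Rpower_pow by apply exp_pos; rewrite Rpower_mult, Rinv_l by lra.
    apply Rpower_1; lra.
Qed.

Lemma eventually_geom_bound (u : nat -> R) (t : R) (N : nat) : (0 < t)%R ->
  (forall n, (N <= n)%nat -> (u n <= t ^ n)%R) ->
  exists K, (0 < K)%R /\ forall n, (u n <= K * t ^ n)%R.
Proof.
intros Ht H.
assert (G : forall M K, (0 < K)%R -> (forall n, (M <= n)%nat -> (u n <= K * t ^ n)%R) ->
  exists K', (0 < K')%R /\ forall n, (u n <= K' * t ^ n)%R).
{ induction M as [|M IH]; intros K HK B; [exists K; split; [exact HK | intros; apply B; lia]|].
  apply (IH (Rmax K (u M / t ^ M))).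
  - eapply Rlt_le_trans; [exact HK | apply Rmax_l].
  - intros n Hn; assert (P : forall k, (0 < t ^ k)%R) by (intros; apply pow_lt; exact Ht).
    destruct (Nat.eq_dec n M) as [->|E].
    + apply Rle_trans with (u M / t ^ M * t ^ M)%R.
      * right; field; specialize (P M); lra.
      * apply Rmult_le_compat_r; [left; apply P | apply Rmax_r].
    + eapply Rle_trans; [apply B; lia|].
      apply Rmult_le_compat_r; [left; apply P | apply Rmax_l]. }
apply (G N 1%R Rlt_0_1); intros n Hn; rewrite Rmult_1_l; apply H; exact Hn.
Qed.

(** Since gamma >= q^(1/4), the factor gamma^(-n) is at most the weight q^(-n/4) in the upper
    limit. *)
Lemma limsup_coef_bound (q : R) (c : nat -> C) (tau t : R) : (0 < q < 1)%R ->
  LimSup_seq (fun n => nth_root n (Cmod (c n) * Rpower q (- INR n / 4))) = Finite tau ->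
  (0 < tau < t)%R ->
  exists K, (0 < K)%R /\ forall n, (Cmod (/ RtoC (gamma q) ^ n * c n) <= K * t ^ n)%R.
Proof.
intros Hq HL Ht.
destruct (ex_LimSup_seq (fun n => nth_root n (Cmod (c n) * Rpower q (- INR n / 4)))) as [l H].
rewrite (is_LimSup_seq_unique _ _ H) in HL; subst l; destruct (H (mkposreal (t - tau) ltac:(lra))) as [_ [N HN]]; simpl in HN.
assert (Pg := gamma_pos q Hq).
assert (R4 : (0 < Rpower q (1/4))%R) by apply exp_pos.
(* Starting at N + 1 keeps n = 0 out, where the root carries no information. *)
apply (eventually_geom_bound _ t (S N)); [lra|].
intros n Hn; specialize (HN n ltac:(lia)).
assert (Pq : (0 < Rpower q (- INR n / 4))%R) by apply exp_pos.
assert (Pc := Cmod_ge_0 (c n)).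
replace (tau + (t - tau))%R with t in HN by ring.
apply nth_root_lt in HN; [|lia|nra|lra].
eapply Rle_trans; [|exact HN].
rewrite Cmod_mult, Rmult_comm; apply Rmult_le_compat_l; [exact Pc|].
rewrite Cmod_inv, Cmod_pow, Cmod_R, Rabs_right by
  (try (apply Cpow_neq_0, RtoC_neq_0); lra).
replace (Rpower q (- INR n / 4)) with (/ Rpower q (1/4) ^ n)%R.
2:{ rewrite <- Rpower_pow, Rpower_mult, <- Rpower_Ropp by exact R4; f_equal; field. }
apply Rinv_le_contravar; [apply pow_lt; exact R4|].
apply pow_incr; split; [lra|].
unfold gamma; apply Rmult_le_reg_r with (1 - q)%R; [lra|].
unfold Rdiv; rewrite Rmult_assoc, Rinv_l by lra; nra.
Qed.

(** A zero is purely imaginary by [hfun_sum_zero]. If it is i v or -i v with v > 0, then v is a zero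
    of C_q(eta; .) below w1; at 0 the sum is 2 h(0), which is not 0. *)
Lemma hfun_denom_neq_0 (q w1 : R) (w : C) : (0 < q < 1)%R ->
  smallest_positive_zero (qcos q (RtoC (eta q))) w1 -> (Cmod w < Rmin 1 w1)%R ->
  hfun q w + hfun q (- w) <> 0.
Proof.
intros Hq [H1 [_ H2]] Hw E.
assert (Hw1 : (Cmod w < 1)%R) by (eapply Rlt_le_trans; [exact Hw | apply Rmin_l]).
assert (Hw2 : (Cmod w < w1)%R) by (eapply Rlt_le_trans; [exact Hw | apply Rmin_r]).
assert (Hre := hfun_sum_zero q w Hq Hw1 E).
assert (V : forall v : R, (0 < v)%R -> (w = Ci * RtoC v \/ w = - (Ci * RtoC v)) -> False).
{ intros v Hv Ew.
  assert (Cv : Cmod w = v).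
  { destruct Ew as [->| ->]; rewrite ?Cmod_opp, Cmod_mult, Cmod_Ci, Cmod_R, Rabs_right; lra. }
  apply (H2 v); [lra|].
  unfold qcos; fold (hfun q (Ci * RtoC v)) (hfun q (Ci * - RtoC v)).
  replace (Ci * - RtoC v) with (- (Ci * RtoC v)) by ring.
  destruct Ew as [Ew|Ew].
  - rewrite <- Ew, E; field.
  - replace (Ci * RtoC v) with (- w) by (rewrite Ew; ring).
    replace (- - w) with w by ring.
    replace (hfun q (- w) + hfun q w) with (hfun q w + hfun q (- w)) by ring.
    rewrite E; field. }
destruct w as [a b]; simpl in Hre; subst a.
destruct (Rtotal_order b 0) as [L|[L|L]].
- apply (V (- b)%R); [lra|]; right; apply injective_projections; simpl; ring.
- assert (Z : ((0, b) : C) = 0) by (rewrite L; reflexivity).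
  rewrite Z in E; replace (- 0) with (RtoC 0) in E by ring.
  apply (hfun_neq_0 q 0 Hq); [rewrite Cmod_0; lra|].
  replace (hfun q 0) with ((hfun q 0 + hfun q 0) / 2) by field; rewrite E; field.
- apply (V b L); left; apply injective_projections; simpl; ring.
Qed.

(** * The generating functions of the q-Euler polynomials *)

Definition altern (n : nat) : C := if Nat.even n then 1 else - (1).

Lemma altern_pow (n : nat) (w : C) : altern n * w ^ n = (- w) ^ n.
Proof.
induction n as [|n IH]; [unfold altern; simpl; ring|].
change ((- w) ^ S n) with (- w * (- w) ^ n); rewrite <- IH.
unfold altern; rewrite Nat.even_succ, <- Nat.negb_even; destruct (Nat.even n); simpl; ring.
Qed.

Lemma hfun_opp_powser (q : R) (w : C) : (0 < q < 1)%R -> (Cmod w < 1)%R ->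
  powser (fun n => altern n * vfun q n (RtoC (eta q))) w (hfun q (- w)).
Proof.
intros Hq Hw.
generalize (qexp_powser q (RtoC (eta q)) (- w) Hq ltac:(rewrite Cmod_opp; exact Hw)).
apply csums_ext; intros n; rewrite <- altern_pow; ring.
Qed.

Section EulerExpansion.

Variables (q w1 : R) (x : C).
Hypothesis Hq : (0 < q < 1)%R.
Hypothesis Hw1 : smallest_positive_zero (qcos q (RtoC (eta q))) w1.

Let rad := Rmin 1 w1.
Let H (n : nat) : C := vfun q n (RtoC (eta q)).

Lemma rad_pos : (0 < rad <= 1)%R.
Proof.
destruct Hw1 as [H1 _]; split; [apply Rmin_glb_lt; lra | apply Rmin_l].
Qed.

(** [taylor_coef] guarantees a representation only on some disc around 0. That it extends to the
    radius [rad] follows from differentiability of the quotient there, and this radius is what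
    bounds the growth of the q-Euler polynomials in n. *)
Lemma qEuler_powser (w : C) : (Cmod w < rad)%R ->
  powser (fun n => qEuler q n x) w (qexp q x w / (hfun q w + hfun q (- w))).
Proof.
assert (Pr := rad_pos).
set (G := fun w => qexp q x w / (hfun q w + hfun q (- w))).
assert (D : forall z, (Cmod z < rad)%R -> diff G z).
{ intros z Hz; apply diff_mult.
  - apply (powser_diff (fun n => vfun q n x) _ 1); [|lra].
    intros; apply qexp_powser; assumption.
  - apply diff_inv; [apply diff_plus|].
    + apply (powser_diff H _ 1); [|lra].
      intros; apply qexp_powser; assumption.
    + apply (powser_diff (fun n => altern n * H n) _ 1); [|lra].
      intros; apply hfun_opp_powser; assumption.
    + apply (hfun_denom_neq_0 q w1); assumption. }
destruct (disc_powser G rad ltac:(lra) D) as [a [Ha _]].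
intros Hw; generalize (Ha w Hw); apply csums_ext; intros n; f_equal.
symmetry; apply (taylor_coef_eq _ a rad); [lra | exact Ha].
Qed.

Lemma qEuler_bound (r : R) : (0 < r < rad)%R ->
  exists M, (0 < M)%R /\ forall n, (Cmod (qEuler q n x) * r ^ n <= M)%R.
Proof. intros Hr; apply (powser_coef_bound _ _ rad r Hr qEuler_powser). Qed.

Lemma qEuler_tilde_eq (n : nat) : qEuler_tilde q n x
  = csum (fun i => qEuler q i x * (2 * (altern (n - i) * H (n - i)%nat))) (S n).
Proof.
assert (Pr := rad_pos).
apply (taylor_coef_eq _ (fun n => csum (fun i => qEuler q i x * (2 * (altern (n - i) * H (n - i)%nat))) (S n)) rad);
  [lra|]; intros w Hw.
assert (P := powser_mult (fun n => qEuler q n x) (fun n => 2 * (altern n * H n)) _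
   (fun w => 2 * hfun q (- w)) rad qEuler_powser).
replace (2 * qexp q (RtoC (eta q)) (- w) * qexp q x w /
   (qexp q (RtoC (eta q)) w + qexp q (RtoC (eta q)) (- w)))
 with (qexp q x w / (hfun q w + hfun q (- w)) * (2 * hfun q (- w)))
 by (unfold hfun, Cdiv; ring).
apply P; [|exact Hw].
intros v Hv; generalize (csums_scal 2 _ _ (hfun_opp_powser q v Hq ltac:(lra))).
apply csums_ext; intros m; unfold H; ring.
Qed.

Lemma vfun_qEuler (n : nat) : vfun q n x
  = csum (fun i => qEuler q i x * ((1 + altern (n - i)) * H (n - i)%nat)) (S n).
Proof.
assert (Pr := rad_pos).
apply (powser_unique (fun n => vfun q n x)
  (fun n => csum (fun i => qEuler q i x * ((1 + altern (n - i)) * H (n - i)%nat)) (S n)) (qexp q x) rad);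
  [lra | intros; apply qexp_powser; [exact Hq | lra] |]; intros w Hw.
assert (P := powser_mult (fun n => qEuler q n x) (fun n => (1 + altern n) * H n) _
   (fun w => hfun q w + hfun q (- w)) rad qEuler_powser).
replace (qexp q x w) with (qexp q x w / (hfun q w + hfun q (- w)) * (hfun q w + hfun q (- w)))
  by (field; apply (hfun_denom_neq_0 q w1); assumption).
apply P; [|exact Hw].
intros v Hv; generalize (csums_plus _ _ _ _ (qexp_powser q (RtoC (eta q)) v Hq ltac:(lra))
  (hfun_opp_powser q v Hq ltac:(lra))).
apply csums_ext; intros m; unfold H; ring.
Qed.

(* The coefficient form of
   E(x;w) = odd part of 2 h(-w) E(x;w) / (h(w) + h(-w)) + 2 h(w) * even part of E(x;w) / (h(w) + h(-w)). *)
Lemma vfun_split (n : nat) : vfun q n x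
  = (if Nat.even n then 0 else qEuler_tilde q n x)
    + csum (fun i => if Nat.even i then 2 * qEuler q i x * H (n - i)%nat else 0) (S n).
Proof.
rewrite vfun_qEuler.
assert (E : (if Nat.even n then RtoC 0 else qEuler_tilde q n x)
  = csum (fun i => (if Nat.even n then 0 else 1) * (qEuler q i x * (2 * (altern (n - i) * H (n - i)%nat)))) (S n)).
{ rewrite csum_scal, <- qEuler_tilde_eq; destruct (Nat.even n); ring. }
rewrite E, <- csum_plus; apply csum_ext; intros i Hi.
(* The two sides agree termwise, in each of the four cases for the parities of i and n - i. *)
assert (En : Nat.even n = Bool.eqb (Nat.even i) (Nat.even (n - i))).
{ rewrite <- Nat.even_add; f_equal; lia. }
rewrite En; unfold altern; destruct (Nat.even i), (Nat.even (n - i)); simpl; ring.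
Qed.

Lemma euler_expansion (f : C -> C) (tau : R) :
  (forall y, csums (fun k => / RtoC (gamma q) ^ k * AW_iter q k f 0 * vfun q k y) (f y)) ->
  LimSup_seq (fun n => nth_root n (Cmod (AW_iter q n f 0) * Rpower q (- INR n / 4))) = Finite tau ->
  (0 < tau < rad)%R ->
  exists s1 s2 : C,
    csums (fun k => / RtoC (gamma q ^ (2 * k + 1)) * qEuler_tilde q (2 * k + 1) x
            * AW_iter q (2 * k + 1) f 0) s1 /\
    csums (fun k => / RtoC (gamma q ^ (2 * k)) * qEuler q (2 * k) x
            * AW_iter q (2 * k) f (RtoC (eta q))) s2 /\
    f x = s1 + 2 * s2.
Proof.
intros Hf HL Ht; assert (Pr := rad_pos).
set (b := fun n => / RtoC (gamma q) ^ n * AW_iter q n f 0) in *.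
(* Any tau < t < r < [rad] would do: b_n is of order t^n and the q-Euler polynomials are of order
   r^(-n), so the double series has the ratio t/r. *)
set (t := ((2 * tau + rad) / 3)%R); set (r := ((tau + 2 * rad) / 3)%R).
assert (Htr : (tau < t < r /\ r < rad)%R) by (unfold t, r; lra).
destruct (limsup_coef_bound q (fun n => AW_iter q n f 0) tau t Hq HL ltac:(lra)) as [K1 [HK1 B1]].
destruct (qEuler_bound r ltac:(lra)) as [K2 [HK2 B2]].
destruct (vfun_bounded q (RtoC (eta q)) Hq) as [K3 [HK3 B3]].
(* Row i sums over j to the coefficient shift of f at eta, hence to a term with D_q^i f(eta);
   diagonal n collects b_n times the convolution in [vfun_split]. *)
set (a := fun i j => b (i + j)%nat * ((if Nat.even i then 2 * qEuler q i x else 0) * H j)).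
set (rw := fun i => if Nat.even i then
   2 * (/ RtoC (gamma q ^ i) * qEuler q i x * AW_iter q i f (RtoC (eta q))) else 0).
assert (Hp : (0 <= t / r < 1)%R).
{ split; [apply Rmult_le_pos; [lra | left; apply Rinv_0_lt_compat; lra]|].
  apply Rmult_lt_reg_r with r; [lra|]; unfold Rdiv; rewrite Rmult_assoc, Rinv_l by lra; lra. }
destruct (rows_diag a (K1 * (2 * K2) * K3) (t / r) rw Hp) as [l [L1 L2]].
- intros i j; unfold a; rewrite !Cmod_mult.
  assert (Pt : forall k, (0 < t ^ k)%R) by (intros; apply pow_lt; lra).
  assert (Prr : forall k, (0 < r ^ k)%R) by (intros; apply pow_lt; lra).
  assert (Q : (Cmod (if Nat.even i then 2 * qEuler q i x else 0) <= 2 * K2 * / r ^ i)%R).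
  { apply Rmult_le_reg_r with (r ^ i)%R; [apply Prr|].
    rewrite Rmult_assoc, Rinv_l by (specialize (Prr i); lra).
    destruct (Nat.even i).
    - rewrite Cmod_mult, Cmod_R, Rabs_right by lra; specialize (B2 i); lra.
    - rewrite Cmod_0; lra. }
  assert (Q3 := B3 j); assert (Q1 := B1 (i + j)%nat); fold (b (i + j)%nat) in Q1; fold (H j) in Q3.
  rewrite pow_add in Q1.
  (* In the index j only t^j is available, v_j(eta) being merely bounded; r < 1 allows the common
     ratio t/r in both indices. *)
  assert (Etj : (t ^ j <= (t / r) ^ j)%R).
  { apply pow_incr; split; [lra|]; unfold Rdiv; rewrite <- (Rmult_1_r t) at 1.
    apply Rmult_le_compat_l; [lra|]; rewrite <- Rinv_1; apply Rinv_le_contravar; lra. }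
  apply Rle_trans with (K1 * (t ^ i * (t / r) ^ j) * (2 * K2 * / r ^ i * K3))%R.
  + apply Rmult_le_compat; try apply Rmult_le_pos; try apply Cmod_ge_0.
    * eapply Rle_trans; [exact Q1|]; apply Rmult_le_compat_l; [lra|].
      apply Rmult_le_compat_l; [left; apply Pt | exact Etj].
    * apply Rmult_le_compat; try apply Cmod_ge_0; assumption.
  + right; unfold Rdiv; rewrite !Rpow_mult_distr, !pow_inv; ring.
- intros i; unfold a, rw.
  assert (O : eta_orbit q (RtoC (Rpower q (1/4)))).
  { exists 0%Z; do 2 f_equal; field. }
  assert (S0 := AW_iter_vseries q (eta_orbit q) Hq (eta_orbit_closed q Hq) b f i
     (fun z _ => Hf (joukowski z)) _ O).
  rewrite joukowski_eta in S0.
  assert (S1 := csums_scal (if Nat.even i then 2 * qEuler q i x else 0) _ _ S0).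
  replace (if Nat.even i then 2 * (/ RtoC (gamma q ^ i) * qEuler q i x * AW_iter q i f (RtoC (eta q))) else 0)
    with ((if Nat.even i then 2 * qEuler q i x else 0) *
      (/ RtoC (gamma q) ^ i * AW_iter q i f (RtoC (eta q)))).
  + revert S1; apply csums_ext; intros j; unfold H; ring.
  + rewrite RtoC_pow; destruct (Nat.even i); ring.
(* The odd series is not estimated on its own: it is the series of f minus the diagonal series, and
   so it converges to f x - l. *)
- exists (f x - l), (l / 2); split; [|split].
  + apply (csums_odd (fun n => / RtoC (gamma q ^ n) * qEuler_tilde q n x * AW_iter q n f 0)).
    generalize (csums_minus _ _ _ _ (Hf x) L2); apply csums_ext; intros n.
    assert (E : csum (fun i => a i (n - i)%nat) (S n)
      = b n * csum (fun i => if Nat.even i then 2 * qEuler q i x * H (n - i)%nat else 0) (S n)).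
    { rewrite <- csum_scal; apply csum_ext; intros i Hi; unfold a.
      replace (i + (n - i))%nat with n by lia; destruct (Nat.even i); ring. }
    rewrite E, vfun_split; fold (b n); rewrite RtoC_pow; unfold b.
    destruct (Nat.even n); ring.
  + apply (csums_even (fun n => / RtoC (gamma q ^ n) * qEuler q n x * AW_iter q n f (RtoC (eta q)))).
    replace (l / 2) with (/ 2 * l) by field.
    generalize (csums_scal (/ 2) _ _ L1); apply csums_ext; intros n; unfold rw.
    destruct (Nat.even n); [|ring].
    generalize (/ RtoC (gamma q ^ n) * qEuler q n x * AW_iter q n f (RtoC (eta q))); intros c; field.
  + field.
Qed.

End EulerExpansion.

Theorem theorem2 (q : R) (f : C -> C) :
  (0 < q < 1)%R ->
  entire f ->
  ((exists k alpha : R, (k < 2 * ln (/ q))%R /\ qexp_growth q f k alpha) \/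
   (exists alpha : R, (alpha < 2 * ln 2 / ln (/ q))%R /\
                      qexp_growth q f (2 * ln (/ q)) alpha)) ->
  (forall x : C,
     @is_series C_AbsRing C_NormedModule
       (fun k : nat =>
          RtoC (Rpower q ((INR k ^ 2 - INR k) / 4)) * RtoC ((1 - q) ^ k)
          / (RtoC (2 ^ k) * qpoch (RtoC q) q k)
          * AW_iter q k f 0
          * rho q k x)
       (f x))
  /\
  (forall w1 tau : R,
     smallest_positive_zero (qcos q (RtoC (eta q))) w1 ->
     LimSup_seq (fun n : nat =>
       nth_root n (Cmod (AW_iter q n f 0) * Rpower q (- INR n / 4))) = Finite tau ->
     (0 < tau < Rmin 1 w1)%R ->
     forall x : C,
       exists s1 s2 : C,
         @is_series C_AbsRing C_NormedModule
           (fun k : nat =>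
              / RtoC (gamma q ^ (2 * k + 1)) * qEuler_tilde q (2 * k + 1) x
              * AW_iter q (2 * k + 1) f 0) s1 /\
         @is_series C_AbsRing C_NormedModule
           (fun k : nat =>
              / RtoC (gamma q ^ (2 * k)) * qEuler q (2 * k) x
              * AW_iter q (2 * k) f (RtoC (eta q))) s2 /\
         f x = s1 + 2 * s2).
Proof.
intros Hq Hf Hg.
assert (Hs := rho_series q f Hq (fun z => ex_derive_diff f z (Hf z)) (growth_subcritical q f Hq Hg)).
split.
- intros x; apply csums_series.
  generalize (Hs x); apply csums_ext; intros n.
  assert (F := qfact_pos q n Hq); assert (Pg := gamma_pos q Hq).
  assert (P2 : (0 < 2 ^ n)%R) by (apply pow_lt; lra).
  assert (R4 : (0 < Rpower q (1/4) ^ n)%R) by (apply pow_lt, exp_pos).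
  assert (P1 : (0 < (1 - q) ^ n)%R) by (apply pow_lt; lra).
  transitivity (RtoC (/ gamma q ^ n * qexp_coef q n) * AW_iter q n f 0 * rho q n x).
  + unfold vfun; rewrite RtoC_mult, RtoC_inv, RtoC_pow by (apply pow_nonzero; lra); ring.
  + do 2 f_equal.
    rewrite qpoch_qfact, <- !RtoC_mult, <- RtoC_div by (apply Rmult_integral_contrapositive_currified; lra).
    (* The exponent (n^2 - n)/4 combines q^(n^2/4) from v_n with the q^(-n/4) contained in
       gamma^(-n). *)
    f_equal; unfold gamma, qexp_coef.
    replace ((INR n ^ 2 - INR n) / 4)%R with (INR n ^ 2 / 4 + - (INR n * (1/4)))%R by field.
    rewrite Rpower_plus, Rpower_Ropp.
    replace (Rpower q (INR n * (1/4))) with (Rpower q (1/4) ^ n)%R.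
    2:{ rewrite <- Rpower_pow by apply exp_pos; rewrite Rpower_mult; f_equal; ring. }
    unfold Rdiv; rewrite !Rpow_mult_distr, pow_inv; field; lra.
- intros w1 tau Hw1 HL Ht x.
  destruct (euler_expansion q w1 x Hq Hw1 f tau Hs HL Ht) as [s1 [s2 [S1 [S2 E]]]].
  exists s1, s2; rewrite <- !csums_series; auto.
Qed.
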